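(* Let $k\in\{0,1,2\}$ and let $\mathcal C\subset S_n$ be a union of equivalence classes of the relation $\equiv^{k}$ on $S_n$ such that $f=\sum_{\pi\in\mathcal C}F_{\mathrm{ID}(\pi)}$ is a symmetric function. Then $$f=\sum_{\lambda\vdash n}c_\lambda s_\lambda,\qquad c_\lambda=|\{\pi\in\mathcal C:\pi\in\mathrm{SYam}(\lambda)\}|,$$ where $s_\lambda$ is the Schur function.
   Context: Tableaux. Partition diagrams are in French notation: left-justified, rows numbered from bottom to top, row $r$ having $\lambda_r$ cells. $\mathrm{SYT}(\lambda)$ is the set of fillings of $\lambda\vdash n$ by $1,\dots,n$ (each used once), increasing left to right along rows and bottom to top up columns; $\mathrm{SYT}(n)=\bigcup_{\lambda\vdash n}\mathrm{SYT}(\lambda)$. The superstandard tableau $U_\lambda$ is the one whose bottom row is $1,\dots,\lambda_1$, whose second row is $\lambda_1+1,\dots,\lambda_1+\lambda_2$, and so on. The row reading word $\mathrm{rw}(T)$ reads each row left to right, starting with the top row and going down; cells are ordered by this reading order. For a permutation $\pi\in S_n$ in one-line notation, $\mathrm{ID}(\pi)$ is the set of $i\in[n-1]$ such that $i$ occurs to the right of $i+1$; $\mathrm{ID}(T)=\mathrm{ID}(\mathrm{rw}(T))$. For $D\subseteq[n-1]$, $F_D=\sum x_{j_1}\cdots x_{j_n}$ over $j_1\le\cdots\le j_n$ such that $j_k=j_{k+1}$ implies $k\notin D$. Runs. Write $\mathrm{ID}(T)\cup\{n\}=\{b_1<\dots<b_m\}$, $b_0=0$. The $r$-th run of $T$ is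 the set of cells with entries in $(b_{r-1},b_r]$; $\beta_r(T)=b_r-b_{r-1}$. Within a run, entries increase in reading order, so $T$ is determined by the sequence of cell sets of its runs. The first $r$ runs of $T$ form the standard Young tableau consisting of entries $\le b_r$. The maps $\mathrm{slink},\mathrm{slink}_*$ on $\mathrm{SYT}(\lambda)$. Let $j$ be minimal such that the first $j$ runs of $T$ do not form a superstandard tableau. If no such $j$ exists ($T=U_\lambda$), both maps fix $T$. Otherwise ($j\ge2$): (1) $\mathrm{slink}(T)$ has the same runs as $T$ except runs $j-1$ and $j$: among the cells of runs $j-1$ and $j$ of $T$ lying strictly below row $j$, the first $\beta_j(T)-1$ in reading order form the new $(j-1)$-th run, and the remaining ones together with the cells of run $j$ in row $j$ form the new $j$-th run. (2) Let $\mu$ be the shape of the first $j$ runs of $T$ and let $i\ge1$ be minimal with $\mu_{i+1}\le\beta_j(T)+i-j$ (so $i\le j-1$). $\mathrm{slink}_*(T)$ has the same runs as $T$ except runs $i$ and $j$: among the cells of runs $i$ and $j$ of $T$ lying strictly below row $i+1$, the first $\beta_j(T)+i-j$ in reading order form the new $i$-th run, and the remaining ones together with the cells of run $j$ in rows $\ge i+1$ form the new $j$-th run. Elementary dual equivalence. $d_i$ acts on a permutation by: $\ldots i\ldots i-1\ldots i+1\ldots\leftrightarrow\ldots i+1\ldots i-1\ldots i\ldots$ and $\ldots i\ldots i+1\ldots i-1\ldots\leftrightarrow\ldots i-1\ldots i+1\ldots i\ldots$ (all else fixed), and as the identity if $i$ is between $i-1$ and $i+1$. It acts on $\mathrm{SYT}(\lambda)$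 through $\mathrm{rw}$. For $i\in[2,n-2]$, $d_i^R(T)=T$ if $i+1\in\mathrm{ID}(T)\cap\mathrm{ID}(d_i(T))$, and $d_i^R(T)=d_i(T)$ otherwise. Relations on tableaux. $\equiv^0$, $\equiv^1$, $\equiv^2$ are the equivalence relations on $\mathrm{SYT}(n)$ generated by $T\sim\mathrm{slink}_*(T)$, by $T\sim\mathrm{slink}(T)$, and by $T\sim d_i^R(T)$ for all $i\in[2,n-2]$, respectively. Permutations. The RSK correspondence (row insertion) sends $\pi\in S_n$ to $(P(\pi),Q(\pi))$, insertion and recording tableaux in some $\mathrm{SYT}(\lambda)$. For $\pi,\pi'\in S_n$, $\pi\equiv^k\pi'$ means $P(\pi)\equiv^kP(\pi')$ and $Q(\pi)=Q(\pi')$. $\mathrm{SYam}(\lambda)=\{\pi\in S_n:P(\pi)=U_\lambda\}$. *)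

(* Defs.v *)
From Stdlib Require Export Relation_Operators.
From mathcomp Require Export all_boot all_order all_fingroup all_algebra.
From mathcomp Require Export finmap monalg.

Set Implicit Arguments.
Unset Strict Implicit.
Unset Printing Implicit Defensive.

(* A tableau is the list of its rows, from the bottom row to the top one
   (French notation).  Rows, columns, runs and entries are numbered from 1;
   a cell is a pair (row, column). *)
Definition tableau := seq (seq nat).

Definition cell := (nat * nat)%type.

Definition is_part (n : nat) (la : seq nat) : bool :=
  [&& sorted geq la, 0 \notin la & sumn la == n].

(* [s] is weakly longer than [s'], and the entries of [s'] are related to those
   of [s] just below them. *)
Definition below (e : rel nat) (s s' : seq nat) : bool :=
  (size s' <= size s) && all2 e (take (size s') s) s'.

Definition is_syt (n : nat) (T : tableau) : bool :=
  [&& is_part n (shape T), perm_eq (flatten T) (iota 1 n),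
      all (sorted ltn) T & sorted (below ltn) T].

Definition is_ssyt (T : tableau) : bool :=
  all (sorted leq) T && sorted (below ltn) T.

Definition superstandard (la : seq nat) : tableau :=
  reshape la (iota 1 (sumn la)).

Definition rw (T : tableau) : seq nat := flatten (rev T).

Definition IDw (w : seq nat) : seq nat :=
  [seq i <- iota 1 (size w).-1 | index i.+1 w < index i w].

Definition ID (T : tableau) : seq nat := IDw (rw T).

Section Runs.

Variable T : tableau.

Let n := size (rw T).

(* b_r, where b_0 = 0 and b_1 < ... < b_m are the elements of ID(T) and n *)
Definition runb (r : nat) : nat := nth 0 (0 :: rcons (ID T) n) r.

Definition nruns : nat := (size (ID T)).+1.

Definition beta (r : nat) : nat := runb r - runb r.-1.

Definition entry (z : cell) : nat := nth 0 (nth [::] T z.1.-1) z.2.-1.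

(* the cells of T in reading order *)
Definition cells : seq cell :=
  [seq (r, c) | r <- rev (iota 1 (size T)),
                c <- iota 1 (size (nth [::] T r.-1))].

Definition run (r : nat) : seq cell :=
  [seq z <- cells | runb r.-1 < entry z <= runb r].

Definition first_runs (r : nat) : tableau :=
  [seq s <- [seq [seq x <- s | x <= runb r] | s <- T] | s != [::]].

Definition first_runs_superstandard (r : nat) : bool :=
  first_runs r == superstandard (shape (first_runs r)).

(* the minimal j such that the first j runs of T do not form a superstandard
   tableau; it exceeds [nruns] if there is none *)
Definition bad_run : nat :=
  (find (fun r => ~~ first_runs_superstandard r) (iota 1 nruns)).+1.

(* The tableau of the shape of T whose r-th run is [R r], for 1 <= r <= nruns:
   the cells of the runs are filled successively, each run in reading order. *)
Definition tableau_of_runs (R : nat -> seq cell) : tableau :=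
  let zs := flatten [seq R r | r <- iota 1 nruns] in
  [seq [seq (index (r, c) zs).+1 | c <- iota 1 (size (nth [::] T r.-1))]
     | r <- iota 1 (size T)].

(* Runs i and j are replaced: among their cells strictly below row h, the first
   k in reading order form the new run i; the others, together with the cells
   of run j in rows >= h, form the new run j. *)
Definition exchange_runs (i j h k : nat) : tableau :=
  let lo := [seq z <- cells | ((z \in run i) || (z \in run j)) && (z.1 < h)] in
  let new_i := take k lo in
  let new_j := [seq z <- cells | (z \in drop k lo)
                                 || ((z \in run j) && (h <= z.1))] in
  tableau_of_runs
    (fun r => if r == i then new_i else if r == j then new_j else run r).

(* Run j has no cell above row j, so "in row j" is "in rows >= j" here. *)
Definition slink : tableau :=
  let j := bad_run in
  if j <= nruns then exchange_runs j.-1 j j (beta j).-1 else T.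

(* mu_{i+1} is [nth 0 mu i]; the defining inequality of i has its negative term
   moved to the left, so that no subtraction is truncated there. *)
Definition slink_star : tableau :=
  let j := bad_run in
  let mu := shape (first_runs j) in
  let i := (find (fun i => nth 0 mu i + j <= beta j + i) (iota 1 j)).+1 in
  if j <= nruns then exchange_runs i j i.+1 (beta j + i - j) else T.

End Runs.

Definition swap_values (a b x : nat) : nat :=
  if x == a then b else if x == b then a else x.

(* Elementary dual equivalence, as the relabelling of the entries of a word w:
   if i-1 (resp. i+1) is the one of i-1, i, i+1 whose position is the middle
   one, then i and i+1 (resp. i-1 and i) are exchanged. *)
Definition de_relabel (i : nat) (w : seq nat) : nat -> nat :=
  let between a b c := (index a w < index b w < index c w)
                       || (index c w < index b w < index a w) in
  if between i i.-1 i.+1 then swap_values i i.+1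
  else if between i i.+1 i.-1 then swap_values i.-1 i
  else id.

Definition de (i : nat) (T : tableau) : tableau :=
  [seq [seq de_relabel i (rw T) x | x <- s] | s <- T].

Definition deR (i : nat) (T : tableau) : tableau :=
  if (i.+1 \in ID T) && (i.+1 \in ID (de i T)) then T else de i T.

Definition tab_step (n k : nat) (T T' : tableau) : Prop :=
  is_syt n T /\
  match k with
  | 0 => T' = slink_star T
  | 1 => T' = slink T
  | 2 => exists i, 2 <= i <= n - 2 /\ T' = deR i T
  | _ => False
  end.

Definition tab_equiv (n k : nat) : tableau -> tableau -> Prop :=
  clos_refl_sym_trans tableau (tab_step n k).

Fixpoint row_insert (T : tableau) (x : nat) : tableau :=
  if T is s :: T' then
    let p := find (ltn x) s in
    if p < size s then set_nth 0 s p x :: row_insert T' (nth 0 s p)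
    else rcons s x :: T'
  else [:: [:: x]].

Definition rsk_step (PQ : tableau * tableau) (x : nat) : tableau * tableau :=
  let: (P, Q) := PQ in
  let P' := row_insert P x in
  let r := find (fun r => size (nth [::] P' r) != size (nth [::] P r))
                (iota 0 (size P')) in
  (P', set_nth [::] Q r (rcons (nth [::] Q r) (size (flatten Q)).+1)).

Definition rsk (w : seq nat) : tableau * tableau :=
  foldl rsk_step ([::], [::]) w.

(* one-line notation, with values in 1..n *)
Definition word (n : nat) (p : 'S_n) : seq nat :=
  [seq (val (p i)).+1 | i <- enum 'I_n].

Definition Ptab (n : nat) (p : 'S_n) : tableau := (rsk (word p)).1.
Definition Qtab (n : nat) (p : 'S_n) : tableau := (rsk (word p)).2.

Definition perm_equiv (n k : nat) (p q : 'S_n) : Prop :=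
  tab_equiv n k (Ptab p) (Ptab q) /\ Qtab p = Qtab q.

Definition union_of_classes (n : nat) (E : 'S_n -> 'S_n -> Prop)
    (C : {set 'S_n}) : Prop :=
  exists A : {set 'S_n}, forall p, p \in C <-> exists2 q, q \in A & E q p.

Definition SYam (n : nat) (la : seq nat) : {set 'S_n} :=
  [set p | Ptab p == superstandard la].

(* Formal power series over Z in the variables x_0, x_1, ..., given by the
   coefficient of each monomial. *)
Definition series := {cmonom nat} -> int.

Definition monom_of (js : seq nat) : {cmonom nat} :=
  \big[mmul/mone]_(j <- js) ucm j.

(* The coefficient of m in the sum of x_{j_1} ... x_{j_d} over the sequences j
   of length d satisfying P.  Every j with x_{j_1} ... x_{j_d} = m has its
   terms in the support of m, so only these finitely many j are counted. *)
Definition genseries (d : nat) (P : seq nat -> bool) : series := fun m =>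
  (#|[set j : d.-tuple (finsupp m) |
        let js := map val j in (monom_of js == m) && P js]|%:Z)%R.

Definition fundamental (n : nat) (D : seq nat) : series :=
  genseries n (fun js => sorted leq js &&
    all (fun k => (nth 0 js k.-1 == nth 0 js k) ==> (k \notin D))
        (iota 1 n.-1)).

Definition schur (la : seq nat) : series :=
  genseries (sumn la) (fun js => is_ssyt (reshape la js)).

Definition is_symmetric_function (f : series) : Prop :=
  (exists d, forall m, d < mdeg m -> f m = 0%R) /\
  (forall s : nat -> nat, bijective s ->
   forall m m' : {cmonom nat}, (forall i, m' (s i) = m i) -> f m' = f m).

(* Main.v *)
(* A standard Young tableau is encoded by its lattice word, the list of the rows
   of 1, ..., n: descents become ascents, and runs become maximal weakly
   decreasing blocks.

   Passing from T to slink_star T exchanges two rows of the Jacobi-Trudi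
   determinant of the run lengths, and slink_star is an involution on the
   tableaux that are not superstandard.  Hence if a finite set of tableaux is
   closed under slink_star, the coefficients of s_la in the determinants of its
   members add up to the number of members equal to U_la.

   A symmetric f is a combination of the s_la with some coefficients d_la, and
   each s_la is the sum of the F_ID(T) over T in SYT(la).  The F_D being
   linearly independent, the linear functional that sends F_D to the coefficient
   of s_la in the determinant of D can be evaluated on f in two ways: with the
   remark above applied to each SYT(mu) it gives d_la, and with the remark
   applied to C, through RSK, it gives c_la.

   It remains that T and slink_star T are equivalent.  For k = 1, slink and
   slink_star agree if i = j - 1 and commute otherwise, which allows an induction
   on j - i.  For k = 2, T and slink T only differ in how the cells of run j in
   row j are shuffled with the other cells of runs j - 1 and j.  These shuffles
   are ballot words in two letters, and ballot words are connected by elementary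
   dual equivalences; three cells in two increasing sequences never give two
   consecutive descents, so that the restriction defining d_i^R is void. *)
Require Import Defs.
From mathcomp Require Import zify.

Set Implicit Arguments.
Unset Strict Implicit.
Unset Printing Implicit Defensive.

(** Row r of the determinant depends only on alpha_r - r, where alpha lists the run lengths, and
    beta_j + i - j is the length of run i for which alpha_i - i and alpha_j - j trade places. The
    choice of i puts this length between mu_(i+1) and mu_i: the new run i fits into row i, the new
    word is again a lattice word, and i is again the chosen index, so that the map is its own
    inverse. RSK carries the map to permutations: the recording tableau is kept, the insertion
    tableau keeps its shape, and ID of a permutation is read off its insertion tableau. Symmetry of
    f enters as invariance of its coefficients under permuting exponents. Schur functions need the
    same invariance, which Bender-Knuth moves on lattice words supply; a unitriangular system then
    expands f over the integers. Linear independence takes an explicit form: the coefficient of F_D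
    at a monomial attached to a set E is 1 if D is contained in E and 0 otherwise, so Moebius
    inversion writes any functional on the F_D as a combination of coefficients. *)

(** * Sorted and filtered lists *)

Lemma geq_transitive : transitive geq.
Proof. by move=> y x z /= xy yz; exact: leq_trans yz xy. Qed.

Lemma geq_antisymmetric : antisymmetric geq.
Proof. by move=> x y /=; rewrite andbC => /anti_leq. Qed.

Lemma filter_nil (T : eqType) (a : pred T) (s : seq T) :
  (forall x, x \in s -> ~~ a x) -> [seq x <- s | a x] = [::].
Proof.
by move=> H; rewrite -(filter_pred0 s); apply: eq_in_filter => x /H/negbTE.
Qed.

Lemma sorted_split (T : eqType) (e : rel T) (a : pred T) (s : seq T) :
  transitive e -> (forall x y, e x y -> a y -> a x) -> sorted e s ->
  s = filter a s ++ filter (predC a) s.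
Proof.
move=> etr ea; elim: s => //= x s IHs xs.
case: ifP => ax /=; first by rewrite -IHs ?(path_sorted xs).
move: xs; rewrite path_sortedE // => /andP[xs _].
have {}xs : all (predC a) s.
  by apply: sub_all xs => y exy /=; apply/negP => /(ea _ _ exy); rewrite ax.
by rewrite (all_filterP xs) filter_nil // => y /(allP xs).
Qed.

Lemma count_nil (T : eqType) (a : pred T) (s : seq T) :
  (forall x, x \in s -> ~~ a x) -> count a s = 0.
Proof. by move=> H; rewrite -size_filter filter_nil. Qed.

Lemma sorted_geq_cat (s1 s2 : seq nat) :
  sorted geq (s1 ++ s2) = [&& allrel geq s1 s2, sorted geq s1 & sorted geq s2].
Proof. by rewrite !(sorted_pairwise geq_transitive) pairwise_cat. Qed.

Lemma geq_split (r : nat) (b : seq nat) : sorted geq b ->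
  b = [seq x <- b | r < x] ++ [seq x <- b | x <= r].
Proof.
move=> sb; rewrite [LHS](@sorted_split _ geq (fun x => r < x)) //.
- by congr (_ ++ _); apply: eq_filter => x /=; rewrite -leqNgt.
- exact: geq_transitive.
- by move=> x y /= yx ry; exact: leq_trans ry yx.
Qed.

Lemma sorted_geq_eq (b b' : seq nat) : sorted geq b -> sorted geq b' ->
  (forall r, count_mem r b = count_mem r b') -> b = b'.
Proof.
move=> sb sb' E; apply: (sorted_eq geq_transitive geq_antisymmetric) => //.
by apply/allP => x _; rewrite /= E.
Qed.

(** * Lattice words *)

(** [c r] counts the letters r already read. Keeping the starting counts as a parameter lets the
    condition split over concatenations, as in [latw_cat]. *)
Fixpoint latw (c : nat -> nat) (y : seq nat) : bool :=
  if y is x :: y' then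
    ((x == 0) || (c x < c x.-1)) && latw (fun r => c r + (x == r)) y'
  else true.

Definition lat (y : seq nat) : bool := latw (fun=> 0) y.

Lemma eq_latw (c c' : nat -> nat) : c =1 c' -> latw c =1 latw c'.
Proof.
move=> E y; elim: y c c' E => //= x y IHy c c' E.
by rewrite !E; congr (_ && _); apply: IHy => r; rewrite E.
Qed.

Lemma latw_cat (c : nat -> nat) (y1 y2 : seq nat) :
  latw c (y1 ++ y2) =
  latw c y1 && latw (fun r => c r + count_mem r y1) y2.
Proof.
elim: y1 c => [|x y1 IH] c /=; first by apply: eq_latw => r; rewrite addn0.
rewrite IH -andbA; congr [&& _, _ & _].
by apply: eq_latw => r; rewrite addnA.
Qed.

Lemma latwP (c : nat -> nat) (y : seq nat) : (forall r, c r.+1 <= c r) ->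
  reflect (forall t r, c r.+1 + count_mem r.+1 (take t y)
                       <= c r + count_mem r (take t y)) (latw c y).
Proof.
elim: y c => [|x y IHy] c cP /=.
  by apply: ReflectT => t r; rewrite !addn0.
apply: (iffP andP) => [[xP yP] [|t] r|H].
- by rewrite /= !addn0.
- have cP' q : c q.+1 + (x == q.+1) <= c q + (x == q).
    by have := cP q; case: (x =P q.+1) xP => [->|_] /=; lia.
  by move/(IHy _ cP'): yP => /(_ t r) /=; lia.
- have x0 : (x == 0) || (c x < c x.-1).
    by case: (x) (H 1 x.-1) => //= q; rewrite take0 /= eqxx; lia.
  split=> //; apply/IHy => [q|t r]; last by have := H t.+1 r; rewrite /= !addnA.
  by have := H 1 q; rewrite /= take0 /=; lia.
Qed.

Lemma latP (y : seq nat) :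
  reflect (forall t r, count_mem r.+1 (take t y) <= count_mem r (take t y))
          (lat y).
Proof. by apply: (iffP (latwP _ _)) => // H t r; have := H t r. Qed.

Lemma lat_count (y : seq nat) (r : nat) :
  lat y -> count_mem r.+1 y <= count_mem r y.
Proof. by move/latP/(_ (size y) r); rewrite take_size. Qed.

Lemma lat_count_le (y : seq nat) (r q : nat) :
  lat y -> r <= q -> count_mem q y <= count_mem r y.
Proof.
move=> ly; elim: q => [|q IHq]; first by rewrite leqn0 => /eqP->.
rewrite leq_eqVlt => /predU1P[-> //|rq].
exact: leq_trans (lat_count _ ly) (IHq rq).
Qed.

(** In a weakly decreasing block all letters r+1 come before all letters r, so the tightest prefix
    for r consists of the letters > r. The lattice condition thus becomes the interlacing of two
    shapes: the block adds a horizontal strip. *)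
Lemma latw_blockP (c : nat -> nat) (b : seq nat) : (forall r, c r.+1 <= c r) ->
  sorted geq b ->
  reflect (forall r, c r.+1 + count_mem r.+1 b <= c r) (latw c b).
Proof.
move=> cP sb; apply: (iffP idP) => [lb r|].
  move/latwP: lb => /(_ cP (size [seq x <- b | r < x]) r).
  have -> : take (size [seq x <- b | r < x]) b = [seq x <- b | r < x].
    by rewrite [X in take _ X](geq_split r sb) take_size_cat.
  have -> : count_mem r.+1 b =
      count_mem r.+1 [seq x <- b | r < x] + count_mem r.+1 [seq x <- b | x <= r].
    by rewrite [in LHS](geq_split r sb) count_cat.
  have -> : count_mem r.+1 [seq x <- b | x <= r] = 0.
    by apply/count_memPn; rewrite mem_filter; lia.
  have -> : count_mem r [seq x <- b | r < x] = 0.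
    by apply/count_memPn; rewrite mem_filter; lia.
  lia.
elim: b c cP {sb} => //= x b IHb c cP H; apply/andP; split.
  by case: x H => //= x /(_ x); rewrite eqxx; lia.
by apply: IHb => r; have := H r; lia.
Qed.

(** [Jw la] has two uses: it is the lattice word of the superstandard tableau of shape [la], and it
    is the sorted index list of the monomial with exponents [la]. In the second use zeros in [la]
    are allowed. *)
Fixpoint Jwo (i : nat) (la : seq nat) : seq nat :=
  if la is a :: la' then nseq a i ++ Jwo i.+1 la' else [::].

Notation Jw := (Jwo 0).

Lemma size_Jwo i la : size (Jwo i la) = sumn la.
Proof. by elim: la i => //= a la IH i; rewrite size_cat size_nseq IH. Qed.

Lemma Jwo_cat i la la' : Jwo i (la ++ la') = Jwo i la ++ Jwo (i + size la) la'.
Proof.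
elim: la i => [|a la IH] i /=; first by rewrite addn0.
by rewrite IH catA addSnnS.
Qed.

Lemma Jwo_ge i la : all (leq i) (Jwo i la).
Proof.
elim: la i => //= a la IH i; rewrite all_cat all_nseq leqnn orbT /=.
by apply: sub_all (IH i.+1) => x; apply: ltnW.
Qed.

Lemma sorted_Jwo i la : sorted leq (Jwo i la).
Proof.
rewrite (sorted_pairwise leq_trans); elim: la i => //= a la IH i.
rewrite pairwise_cat IH andbT; apply/andP; split.
  apply/allrelP => x y; rewrite mem_nseq => /andP[_ /eqP->].
  by move/(allP (Jwo_ge _ _))/ltnW.
by elim: a => //= a ->; rewrite all_nseq leqnn orbT.
Qed.

Lemma count_Jwo i la r :
  count_mem r (Jwo i la) = if i <= r then nth 0 la (r - i) else 0.
Proof.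
elim: la i => [|a la IH] i /=; first by rewrite nth_nil if_same.
rewrite count_cat count_nseq IH /=; case: (ltngtP i r) => [ir|//|<-]/=.
  by rewrite -[r - i]prednK ?subn_gt0 //= subnS.
by rewrite subnn mul1n addn0.
Qed.

Lemma count_Jw la r : count_mem r (Jw la) = nth 0 la r.
Proof. by rewrite count_Jwo subn0. Qed.

Lemma mem_Jw la r : r \in Jw la -> r < size la.
Proof.
by rewrite -has_pred1 has_count count_Jw; case: (ltnP r (size la)) => // ?; rewrite nth_default.
Qed.

Lemma Jwo_nil0 i (z : nat) : Jwo i (nseq z 0) = [::].
Proof. by elim: z i => //= z IH i; rewrite IH. Qed.

Lemma sorted_leq_eq_Jw (y : seq nat) (la : seq nat) : sorted leq y ->
  (forall r, count_mem r y = nth 0 la r) -> y = Jw la.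
Proof.
move=> sy E; apply: (sorted_eq leq_trans anti_leq) => //; first exact: sorted_Jwo.
by apply/allP => x _; rewrite /= E count_Jw.
Qed.

Lemma latw_leq_Jwo la : sorted geq la -> lat (Jw la).
Proof.
move=> sla; apply/latP => t r.
have [rt|/count_memPn -> //] := boolP (r.+1 \in take t (Jw la)).
 have := cat_take_drop t (Jw la) => E.
have sE := sorted_Jwo 0 la; rewrite -E (sorted_pairwise leq_trans) pairwise_cat in sE.
case/and3P: sE => /allrelP cE _ _.
(* A prefix that reaches a letter r+1 already contains every letter r. *)
have -> : count_mem r (take t (Jw la)) = nth 0 la r.
  rewrite -count_Jw -{2}E count_cat [X in _ + X](_ : _ = 0) ?addn0 //.
  by apply/count_memPn/negP => /(cE _ _ rt); rewrite ltnn.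
apply: (@leq_trans (nth 0 la r.+1)).
  by rewrite -count_Jw -{2}E count_cat leq_addr.
have [rs|rs] := ltnP r.+1 (size la); last by rewrite nth_default.
by have := sorted_ltn_nth geq_transitive 0 sla; apply; rewrite ?inE // ltnW.
Qed.

(** * The tableau of a word *)

Definition nr (y : seq nat) : nat := foldr (fun x m => maxn x.+1 m) 0 y.

Lemma nr_gt x y : x \in y -> x < nr y.
Proof.
elim: y => //= z y IH; rewrite inE => /predU1P[->|/IH]; first exact: leq_maxl.
by move=> xy; rewrite leq_max xy orbT.
Qed.

Lemma nr_leqP y N : reflect (forall x, x \in y -> x < N) (nr y <= N).
Proof.
apply: (iffP idP) => [le x /nr_gt/leq_trans -> //|].
elim: y => //= z y IH H; rewrite geq_max H ?mem_head //= IH // => x xy.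
by rewrite H // inE xy orbT.
Qed.

Lemma nr_mem y r : lat y -> r < nr y -> r \in y.
Proof.
move=> ly ry; rewrite -has_pred1 has_count.
suff [q qy rq] : exists2 q, q \in y & r <= q.
  by apply: leq_trans (lat_count_le ly rq); rewrite -has_count has_pred1.
apply/hasP; apply: contraLR ry => /hasPn H; rewrite -leqNgt.
by apply/nr_leqP => x /H; rewrite -ltnNge.
Qed.

Definition trow (z : seq (nat * nat)) (r : nat) : seq nat :=
  [seq p.2 | p <- z & p.1 == r].

(** [y] gives the rows and [J] the entries of the successive cells. Entries 1, ..., n give standard
    tableaux ([tab]); repeated entries give the semistandard ones that the Schur functions need. *)
Definition tabJ (y J : seq nat) : tableau := [seq trow (zip y J) r | r <- iota 0 (nr y)].

Definition tab (y : seq nat) : tableau := tabJ y (iota 1 (size y)).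

Lemma size_tabJ y J : size (tabJ y J) = nr y.
Proof. by rewrite size_map size_iota. Qed.

Lemma trow_out y J r : nr y <= r -> trow (zip y J) r = [::].
Proof.
move=> yr; rewrite /trow; apply/eqP; rewrite -size_eq0 size_map size_filter.
rewrite -leqn0 leqNgt -has_count; apply/hasP => -[[a b] /(map_f fst) /= ab /eqP e].
rewrite {a}e in ab.
suff /nr_gt : r \in y by rewrite ltnNge yr.
elim: y J ab {yr} => [|x y IH] [|j J] //=; rewrite !inE.
by case/orP=> [->//|/IH ->]; rewrite orbT.
Qed.

Lemma nth_tabJ y J r : nth [::] (tabJ y J) r = trow (zip y J) r.
Proof.
have [ry|yr] := ltnP r (nr y); last by rewrite nth_default ?size_tabJ ?trow_out.
by rewrite (nth_map 0) ?size_iota // nth_iota.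
Qed.

Lemma size_trow y J r : size y = size J -> size (trow (zip y J) r) = count_mem r y.
Proof.
move=> e; rewrite size_map size_filter -{2}(@unzip1_zip _ _ y J) ?e //.
by rewrite count_map; apply: eq_count.
Qed.

Lemma shape_tabJ y J : size y = size J ->
  shape (tabJ y J) = [seq count_mem r y | r <- iota 0 (nr y)].
Proof. by move=> e; rewrite /shape -map_comp; apply: eq_map => r /=; rewrite size_trow. Qed.

Lemma nth_shape_tabJ y J r : size y = size J ->
  nth 0 (shape (tabJ y J)) r = count_mem r y.
Proof.
move=> e; have [ry|yr] := ltnP r (nr y).
  by rewrite (nth_map [::]) ?size_tabJ // nth_tabJ size_trow.
rewrite nth_default ?size_map ?size_iota //; symmetry; apply/count_memPn.
by apply/negP => /nr_gt; rewrite ltnNge yr.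
Qed.

Lemma eq_perm_eq (T : eqType) (s s' : seq T) : s = s' -> perm_eq s s'.
Proof. by move=> ->. Qed.

Lemma perm_flatten_filter (T : eqType) (f : T -> nat) (s : seq T) N :
  perm_eq (flatten [seq [seq p <- s | f p == r] | r <- iota 0 N]) [seq p <- s | f p < N].
Proof.
elim: N => [|N IH]; first by rewrite /= (eq_filter (a2 := pred0)) ?filter_pred0.
rewrite -addn1 iotaD map_cat flatten_cat /= cats0 add0n addn1.
rewrite -(permPr (permEl (perm_filterC (fun p => f p < N) _))).
rewrite -!filter_predI perm_sym; apply: perm_cat.
  by rewrite perm_sym (permPl IH); apply/eq_perm_eq/eq_filter => p /=; lia.
by apply/eq_perm_eq/eq_filter => p /=; lia.
Qed.

Lemma perm_flatten_tabJ y J : size y = size J -> perm_eq (flatten (tabJ y J)) J.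
Proof.
move=> e; rewrite -{2}(@unzip2_zip _ _ y J) ?e // /tabJ.
have -> : [seq trow (zip y J) r | r <- iota 0 (nr y)] =
   map (map snd) [seq [seq p <- zip y J | p.1 == r] | r <- iota 0 (nr y)].
  by rewrite -map_comp.
rewrite -map_flatten perm_map // (permPl (perm_flatten_filter _ _ _)).
rewrite (_ : filter _ _ = zip y J) //; apply/all_filterP/allP => p.
by move/(map_f fst); rewrite -/(unzip1 _) unzip1_zip ?e // => /nr_gt.
Qed.

(** For sorted rows, column strictness only depends on how many entries lie below each threshold. In
    this form it compares directly with prefix counts of lattice words, and row insertion can be
    followed without tracking columns. *)
Lemma below_ltnP (s s' : seq nat) : sorted leq s -> sorted leq s' ->
  reflect (forall v, count (fun x => x <= v) s' <= count (fun x => x < v) s)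
          (below ltn s s').
Proof.
move=> ss ss'; apply: (iffP idP).
  rewrite /below => /andP[_ H] v; elim: s' s H {ss ss'} => [|x' s' IH] [|x s] //=.
  by case/andP=> xx' /IH; lia.
elim: s' s ss ss' => [|x' s' IH] [|x s] ss ss' //.
  by move/(_ x'); rewrite /= leqnn.
move=> H; have xx' : x < x'.
  rewrite ltnNge; apply/negP => x'x; have := H x'; rewrite /= leqnn ltnNge x'x /=.
  have -> : count (fun x0 => x0 < x') s = 0; last by lia.
  apply: count_nil => z zs /=.
  move: ss; rewrite /= (path_sortedE leq_trans) => /andP[/allP/(_ z zs)]; lia.
have : below ltn s s'.
  apply: IH => [||v]; try exact: path_sorted.
    exact: path_sorted ss. exact: path_sorted ss'.
  have [vx|xv] := ltnP v x'.
    rewrite count_nil // => z zs /=.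
    move: ss'; rewrite /= (path_sortedE leq_trans) => /andP[/allP/(_ z zs)]; lia.
  by have := H v; rewrite /= xv (leq_trans xx' xv).
by rewrite /below /= ltnS xx'.
Qed.

(** Equal entries of a semistandard tableau form a horizontal strip; from left to right their rows
    weakly descend, whence the reversed comparison of rows. *)
Definition lexi (p q : nat * nat) : bool :=
  (p.2 < q.2) || ((p.2 == q.2) && (q.1 <= p.1)).

Lemma lexi_trans : transitive lexi.
Proof. by move=> [a b] [c d] [e f]; rewrite /lexi /=; lia. Qed.

Lemma lexi_total : total lexi.
Proof. by move=> [a b] [c d]; rewrite /lexi /=; lia. Qed.

Lemma lexi_anti : antisymmetric lexi.
Proof.
move=> [a b] [c d]; rewrite /lexi /= => H.
by have [-> ->] : a = c /\ b = d by lia.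
Qed.

Lemma lat_lexiP (z : seq (nat * nat)) : sorted lexi z ->
  reflect (forall r v, count (fun p => (p.1 == r.+1) && (p.2 <= v)) z
                       <= count (fun p => (p.1 == r) && (p.2 < v)) z)
          (lat (unzip1 z)).
Proof.
move=> sz; apply: (iffP (latP _)) => [H r v|H t r].
  (* The decisive prefix: it contains every entry v of row r+1 and no entry v of row r. *)
  pose a p := (p.2 < v) || ((p.2 == v) && (r < p.1)).
  have E : z = filter a z ++ filter (predC a) z.
    apply: (sorted_split lexi_trans) sz => -[p q] [p' q']; rewrite /lexi /a /=; lia.
  have := H (size (filter a z)) r.
  have -> : take (size (filter a z)) (unzip1 z) = unzip1 (filter a z).
    by rewrite [X in unzip1 X]E /unzip1 map_cat take_size_cat ?size_map.
  rewrite !count_map !count_filter.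
  move=> H1; apply: leq_trans (leq_trans H1 _); apply: sub_count => -[p q]; rewrite /a /=; lia.
rewrite /unzip1 -map_take !count_map.
(* Conversely, a prefix is controlled by the threshold v given by its last entry. *)
move E : (take t z) => z0; case/lastP: z0 E => [//|z1 [b v]] E.
have Ez := cat_take_drop t z; have := sz; rewrite -Ez E.
rewrite (sorted_pairwise lexi_trans) pairwise_cat pairwise_rcons => /and3P[/allrelP A /andP[B _] _].
apply: leq_trans (leq_trans (H r v) _).
  rewrite -[in leqRHS]Ez E count_cat; apply: leq_trans (leq_addr _ _).
  rewrite (@eq_in_count _ (preim fst (pred1 r.+1)) (fun p => (p.1 == r.+1) && (p.2 <= v))) //.
  move=> [p q]; rewrite mem_rcons inE /= => /predU1P[[-> ->]|pz]; first by rewrite leqnn andbT.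
  by have := allP B _ pz; rewrite /lexi /=; lia.
rewrite -[in leqLHS]Ez E count_cat [X in _ + X](_ : _ = 0) ?addn0.
  by apply: sub_count => -[p q] /= /andP[].
apply: count_nil => -[p q] pz /=.
have := A (b, v) (p, q); rewrite mem_rcons mem_head => /(_ isT pz).
by rewrite /lexi /=; lia.
Qed.

Lemma sorted_lexi_snd z : sorted lexi z -> sorted leq (unzip2 z).
Proof.
rewrite sorted_map; apply: sub_sorted => -[a b] [c d]; rewrite /lexi /=; lia.
Qed.

Lemma sorted_trow z r : sorted lexi z -> sorted leq (trow z r).
Proof.
move=> sz; rewrite /trow sorted_map.
apply: (sub_sorted (e := lexi)); first by move=> [a b] [c d]; rewrite /lexi /=; lia.
exact: (sorted_filter lexi_trans).
Qed.

Lemma count_trow z r (a : pred nat) :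
  count a (trow z r) = count (fun p => (p.1 == r) && a p.2) z.
Proof. by rewrite count_map count_filter; apply: eq_count => p /=; rewrite andbC. Qed.

Lemma columns_tabJ y J : size y = size J -> sorted lexi (zip y J) ->
  sorted (below ltn) (tabJ y J) = lat y.
Proof.
move=> e sz; have := lat_lexiP sz; rewrite unzip1_zip ?e // => H.
apply/(sortedP [::])/H => [S r v|S r].
  have [ry|yr] := ltnP r.+1 (nr y).
    have := S r; rewrite size_tabJ => /(_ ry).
    rewrite !nth_tabJ => /below_ltnP; rewrite !sorted_trow // => /(_ isT isT v).
    by rewrite !count_trow.
  rewrite -(count_trow _ _ (fun x => x <= v)) trow_out //.
rewrite size_tabJ => ry; rewrite !nth_tabJ; apply/below_ltnP; rewrite ?sorted_trow // => v.
by rewrite !count_trow.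
Qed.

Lemma is_ssyt_tabJ y J : size y = size J -> sorted lexi (zip y J) ->
  is_ssyt (tabJ y J) = lat y.
Proof.
move=> e sz; rewrite /is_ssyt columns_tabJ //.
case: (lat y); rewrite ?andbF ?andbT //.
by apply/allP => _ /mapP[r _ ->]; apply: sorted_trow.
Qed.

(* Sorting the cells (row, entry) of a tableau by entry, equal entries by decreasing row, recovers its word. *)
Definition cellpairs (X : tableau) : seq (nat * nat) :=
  zip (Jw (shape X)) (flatten X).

Definition wordJ (X : tableau) : seq nat * seq nat :=
  let z := sort lexi (cellpairs X) in (unzip1 z, unzip2 z).

Lemma zip_nseq (T S : Type) (x : T) (s : seq S) : zip (nseq (size s) x) s = [seq (x, y) | y <- s].
Proof. by elim: s => //= y s ->. Qed.

Lemma trow_cellpairs_off (X : tableau) i r :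
  trow (zip (Jwo i (shape X)) (flatten X)) r = if i <= r then nth [::] X (r - i) else [::].
Proof.
elim: X i => [|s X IH] i /=; first by rewrite nth_nil if_same.
rewrite zip_cat ?size_nseq // /trow filter_cat map_cat -/(trow (zip (Jwo i.+1 _) _) r) IH.
rewrite zip_nseq filter_map -map_comp.
rewrite (eq_filter (a2 := fun=> i == r)) //=.
case: (ltngtP i r) => [ir|ir|<-] /=; rewrite ?filter_pred0 ?filter_predT ?map_id ?subnn ?cats0 //.
by rewrite -[r - i]prednK ?subn_gt0 // subnS.
Qed.

Lemma trow_cellpairs X r : trow (cellpairs X) r = nth [::] X r.
Proof. by rewrite trow_cellpairs_off subn0. Qed.

Lemma size_Jw_shape (X : tableau) : size (Jw (shape X)) = size (flatten X).
Proof. by rewrite size_Jwo size_flatten. Qed.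

Lemma perm_trow z z' r : perm_eq z z' -> perm_eq (trow z r) (trow z' r).
Proof. by move=> zz'; apply/perm_map/perm_filter. Qed.

Lemma wordJK (X : tableau) : 0 \notin shape X -> all (sorted leq) X ->
  tabJ (wordJ X).1 (wordJ X).2 = X.
Proof.
move=> X0 sX; rewrite /wordJ /=; set z := sort _ _.
have zp : perm_eq z (cellpairs X) by apply/permEl/perm_sort.
have sz : sorted lexi z by apply/(sort_sorted lexi_total).
have zz : zip (unzip1 z) (unzip2 z) = z by exact: zip_unzip.
have nz : nr (unzip1 z) = size X.
  have memz x : (x \in unzip1 z) = (x < size X).
    have -> : (x \in unzip1 z) = (x \in Jw (shape X)).
      rewrite (perm_mem (perm_map fst zp)) -/(unzip1 _) unzip1_zip //.
      by rewrite size_Jw_shape.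
    rewrite -has_pred1 has_count count_Jw.
    have [xX|xX] := ltnP x (size X); last by rewrite nth_default ?size_map.
    rewrite lt0n; apply: contraNneq X0 => <-; apply: mem_nth; by rewrite size_map.
  apply/eqP; rewrite eqn_leq; apply/andP; split.
    by apply/nr_leqP => x; rewrite memz.
  by have [->|X1] := posnP (size X); rewrite // -(prednK X1) nr_gt // memz prednK.
apply: (@eq_from_nth _ [::]); first by rewrite size_tabJ nz.
move=> r; rewrite size_tabJ nz => rX; rewrite nth_tabJ zz.
apply: (sorted_eq leq_trans anti_leq); first exact: sorted_trow.
  by apply: (allP sX); apply: mem_nth.
by rewrite (permPl (perm_trow r zp)) trow_cellpairs.
Qed.

Lemma size_wordJ X : size (wordJ X).1 = size (wordJ X).2.
Proof. by rewrite !size_map. Qed.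

Lemma lexi_wordJ X : sorted lexi (zip (wordJ X).1 (wordJ X).2).
Proof. by rewrite zip_unzip; apply/(sort_sorted lexi_total). Qed.

Lemma wordJ2 X J : sorted leq J -> perm_eq (flatten X) J -> (wordJ X).2 = J.
Proof.
move=> sJ pJ; apply: (sorted_eq leq_trans anti_leq) => //.
  exact/sorted_lexi_snd/(sort_sorted lexi_total).
rewrite -(permPr pJ) /= (permPl (perm_map snd (permEl (perm_sort _ _)))).
by rewrite -/(unzip2 _) unzip2_zip ?size_Jw_shape.
Qed.

Lemma perm_wordJ1 X : perm_eq (wordJ X).1 (Jw (shape X)).
Proof.
rewrite /= (permPl (perm_map fst (permEl (perm_sort _ _)))).
by rewrite -/(unzip1 _) unzip1_zip ?size_Jw_shape.
Qed.

Lemma perm_cellpairs_tabJ y J : lat y -> size y = size J ->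
  perm_eq (cellpairs (tabJ y J)) (zip y J).
Proof.
move=> ly e; apply/seq.permP => a.
have E z N : all (fun p : nat * nat => p.1 < N) z ->
    count a z = \sum_(r < N) count (fun x => a (r : nat, x)) (trow z r).
  elim: z => [|[b x] z IH] /=; first by rewrite big1 // => r _; rewrite count_map.
  case/andP => bN /IH ->; rewrite (bigD1 (Ordinal bN)) //= [in RHS](bigD1 (Ordinal bN)) //=.
  rewrite /trow /= eqxx /= addnA; congr (_ + _); apply: eq_bigr => r /negbTE rb.
  by rewrite -val_eqE /= eq_sym in rb; rewrite rb.
have sJ : size (Jw (shape (tabJ y J))) = size (flatten (tabJ y J)) by rewrite size_Jw_shape.
rewrite !(@E _ (nr y)).
- by apply: eq_bigr => r _; rewrite trow_cellpairs nth_tabJ.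
- apply/allP => p /(map_f fst); rewrite -/(unzip1 _) unzip1_zip ?e // => /nr_gt //.
- apply/allP => p /(map_f fst); rewrite -/(unzip1 _) unzip1_zip ?sJ // => /mem_Jw.
  by rewrite size_map size_tabJ.
Qed.

Lemma tabJK y J : lat y -> size y = size J -> sorted lexi (zip y J) ->
  wordJ (tabJ y J) = (y, J).
Proof.
move=> ly e sz; rewrite /wordJ.
have -> : sort lexi (cellpairs (tabJ y J)) = zip y J.
  rewrite -[RHS](sorted_sort lexi_trans sz).
  by apply/perm_sortP => //; [exact: lexi_total|exact: lexi_trans|exact: lexi_anti|exact: perm_cellpairs_tabJ].
by rewrite unzip1_zip ?unzip2_zip ?e.
Qed.

Lemma zip_iota (y : seq nat) m :
  zip y (iota m (size y)) = [seq (nth 0 y (k - m), k) | k <- iota m (size y)].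
Proof.
elim: y m => //= x y IH m; rewrite subnn IH; congr (_ :: _).
by apply/eq_in_map => k; rewrite mem_iota => /andP[mk _]; rewrite -[k - m]prednK ?subn_gt0 //= subnS.
Qed.

Lemma sorted_lexi_iota y m : sorted lexi (zip y (iota m (size y))).
Proof.
rewrite zip_iota sorted_map; apply: (sub_sorted (e := ltn)); last exact: iota_ltn_sorted.
by move=> a b /= ab; rewrite /lexi /= ab.
Qed.

Lemma trow_tab y r : trow (zip y (iota 1 (size y))) r =
  [seq k <- iota 1 (size y) | nth 0 y k.-1 == r].
Proof.
rewrite zip_iota /trow filter_map -map_comp /= map_id.
by apply: eq_filter => k /=; rewrite subn1.
Qed.

Lemma nth_tab y r : nth [::] (tab y) r = [seq k <- iota 1 (size y) | nth 0 y k.-1 == r].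
Proof. by rewrite nth_tabJ trow_tab. Qed.

Lemma tabE y : tab y = [seq [seq k <- iota 1 (size y) | nth 0 y k.-1 == r] | r <- iota 0 (nr y)].
Proof. by apply/eq_map => r; rewrite trow_tab. Qed.

Lemma size_tab y : size (tab y) = nr y.
Proof. by rewrite size_tabJ. Qed.

Lemma nth_shape_tab y r : nth 0 (shape (tab y)) r = count_mem r y.
Proof. by rewrite nth_shape_tabJ ?size_iota. Qed.

Lemma perm_Jw_shape y : perm_eq y (Jw (shape (tab y))).
Proof. by apply/allP => x _; rewrite /= count_Jw nth_shape_tab. Qed.

Lemma tab_inj y y' : lat y -> lat y' -> tab y = tab y' -> y = y'.
Proof.
move=> ly ly' E; have := tabJK ly _ (sorted_lexi_iota y 1); rewrite size_iota -/(tab y) E.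
by move=> /(_ erefl); rewrite tabJK ?size_iota ?sorted_lexi_iota // => -[].
Qed.

Lemma is_part_shape_tab y : lat y -> is_part (size y) (shape (tab y)).
Proof.
move=> ly; rewrite /is_part; apply/and3P; split.
- apply/(sortedP 0) => r _; rewrite !nth_shape_tab; exact: lat_count.
- apply/negP => /(nthP 0)[r]; rewrite nth_shape_tab size_map size_tab => /(nr_mem ly) ry.
  by move/eqP; rewrite -leqn0 leqNgt -has_count has_pred1 ry.
- by rewrite -size_flatten (perm_size (perm_flatten_tabJ _)) ?size_iota.
Qed.

Lemma tab_syt y : lat y -> is_syt (size y) (tab y).
Proof.
move=> ly; rewrite /is_syt is_part_shape_tab // perm_flatten_tabJ ?size_iota //=.
rewrite columns_tabJ ?size_iota ?sorted_lexi_iota // ly andbT.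
apply/allP => s; rewrite tabE => /mapP[r _ ->].
by apply: (sorted_filter ltn_trans); apply: iota_ltn_sorted.
Qed.

Lemma syt_tab n T : is_syt n T -> exists y, [/\ lat y, size y = n & T = tab y].
Proof.
case/and4P=> /and3P[_ T0 sT] pT rT cT.
have sJ : (wordJ T).2 = iota 1 n by apply: wordJ2 => //; exact: iota_sorted.
have rT' : all (sorted leq) T.
  by apply: sub_all rT => s; apply: sub_sorted => a b /=; apply: ltnW.
have E := wordJK T0 rT'; have lz := lexi_wordJ T; have ez := size_wordJ T.
have sy : size (wordJ T).1 = n by rewrite ez sJ size_iota.
exists (wordJ T).1; split=> //.
  by rewrite -(columns_tabJ ez lz) E.
by rewrite /tab sy -sJ E.
Qed.

Lemma tab_Jw la : 0 \notin la -> tab (Jw la) = superstandard la.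
Proof.
move=> la0; pose X : tableau := superstandard la.
have sX : shape X = la by rewrite /X /superstandard reshapeKl ?size_iota.
have fX : flatten X = iota 1 (sumn la) by rewrite /X /superstandard reshapeKr ?size_iota.
have cX : cellpairs X = zip (Jw la) (iota 1 (sumn la)) by rewrite /cellpairs sX fX.
have sc : sorted lexi (cellpairs X) by rewrite cX -(size_Jwo 0 la) sorted_lexi_iota.
have rX : all (sorted leq) X.
  apply/allP => s /(nthP [::])[r _ <-]; rewrite -trow_cellpairs; exact: sorted_trow.
rewrite -/X -(wordJK _ rX) ?sX //.
rewrite /wordJ (sorted_sort lexi_trans) //= cX unzip1_zip ?unzip2_zip ?size_Jwo ?size_iota //.
by rewrite /tab size_Jwo.
Qed.

Lemma superstandard_tab y : lat y ->
  (tab y == superstandard (shape (tab y))) = sorted leq y.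
Proof.
move=> ly; have /and3P[sp s0 _] := is_part_shape_tab ly.
apply/eqP/idP => [E|sy].
  have -> : y = Jw (shape (tab y)); last exact: sorted_Jwo.
  by apply: tab_inj; rewrite ?latw_leq_Jwo ?tab_Jw.
rewrite -tab_Jw //; congr tab; apply: sorted_leq_eq_Jw => // r.
by rewrite nth_shape_tab.
Qed.

Lemma pairwise_flatten (T : Type) (e : rel T) (ss : seq (seq T)) :
  pairwise e (flatten ss) = all (pairwise e) ss && pairwise (fun s s' => allrel e s s') ss.
Proof.
elim: ss => //= s ss IH; rewrite pairwise_cat IH.
have -> : allrel e s (flatten ss) = all [eta allrel e s] ss.
  by elim: ss {IH} => [|s' ss IH] /=; [rewrite allrel0r | rewrite allrel_catr IH].
by case: (all _ ss) => //=; rewrite ?andbF //; case: (pairwise e s).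
Qed.

(** The order in which entries occur in the reading word: higher rows first, and within a row from
    left to right, hence by value. *)
Definition before (y : seq nat) (a b : nat) : bool :=
  let ya := nth 0 y a.-1 in let yb := nth 0 y b.-1 in
  (yb < ya) || ((ya == yb) && (a < b)).

Lemma before_trans y : transitive (before y).
Proof. by move=> b a c; rewrite /before; lia. Qed.

Lemma before_rw y : sorted (before y) (rw (tab y)).
Proof.
rewrite (sorted_pairwise (@before_trans y)) /rw pairwise_flatten.
apply/andP; split.
  apply/allP => s; rewrite mem_rev tabE => /mapP[r _ ->].
  rewrite -(sorted_pairwise (@before_trans y)).
  apply: (sub_in_sorted (P := [pred k | nth 0 y k.-1 == r]) (e := ltn)).
  - by move=> a b /= /eqP E /eqP E'; rewrite /before E E' eqxx /= => ->; rewrite orbT.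
  - exact: filter_all.
  - exact: (sorted_filter ltn_trans _ (iota_ltn_sorted _ _)).
rewrite tabE -map_rev pairwise_map.
apply: (sub_pairwise (r := gtn)) => [r q /= qr|].
  apply/allrelP => a b; rewrite !mem_filter => /andP[/eqP E _] /andP[/eqP E' _].
  by rewrite /before E E' qr.
rewrite -(sorted_pairwise (fun b a c (ab : b < a) bc => ltn_trans bc ab)).
by rewrite rev_sorted iota_ltn_sorted.
Qed.

Lemma perm_rw (T : tableau) : perm_eq (rw T) (flatten T).
Proof. by rewrite /rw; apply: perm_flatten; rewrite perm_rev. Qed.

Lemma perm_rw_tab y : perm_eq (rw (tab y)) (iota 1 (size y)).
Proof. by rewrite (permPl (perm_rw _)) perm_flatten_tabJ ?size_iota. Qed.

Lemma size_rw_tab y : size (rw (tab y)) = size y.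
Proof. by rewrite (perm_size (perm_rw_tab y)) size_iota. Qed.

Lemma index_rw y a b : 0 < a <= size y -> 0 < b <= size y ->
  (index a (rw (tab y)) < index b (rw (tab y))) = before y a b.
Proof.
move=> an bn.
have ar : a \in rw (tab y) by rewrite (perm_mem (perm_rw_tab y)) mem_iota; lia.
have br : b \in rw (tab y) by rewrite (perm_mem (perm_rw_tab y)) mem_iota; lia.
have H := sorted_ltn_index (@before_trans y) (before_rw y).
apply/idP/idP; first exact: H.
move=> bab; rewrite ltnNge leq_eqVlt; apply/negP => /predU1P[E|/(H _ _ br ar)].
  have /eqP := congr1 (nth 0 (rw (tab y))) E; rewrite !nth_index // => /eqP E'.
  by move: bab; rewrite E' /before; lia.
by move: bab; rewrite /before; lia.
Qed.

Definition asc (y : seq nat) : seq nat :=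
  [seq i <- iota 1 (size y).-1 | nth 0 y i.-1 < nth 0 y i].

Lemma ID_tab y : ID (tab y) = asc y.
Proof.
rewrite /ID /IDw size_rw_tab; apply: eq_in_filter => i; rewrite mem_iota => ii.
rewrite index_rw; try lia; rewrite /before /=; lia.
Qed.

(** * Runs *)

(** The strict rise between neighbouring blocks makes them maximal, so they are the runs. *)
Definition blocks (bs : seq (seq nat)) : bool :=
  all (fun b => (b != [::]) && sorted geq b) bs &&
  sorted (fun b b' => last 0 b < head 0 b') bs.

Lemma asc_cat (b y : seq nat) : b != [::] -> y != [::] -> sorted geq b ->
  last 0 b < head 0 y -> asc (b ++ y) = size b :: map (addn (size b)) (asc y).
Proof.
move=> b0 y0 sb lk; rewrite /asc size_cat.
have {}b0 : 0 < size b by case: (b) b0.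
have {}y0 : 0 < size y by case: (y) y0.
have -> : (size b + size y).-1 = (size b).-1 + (1 + (size y).-1) by lia.
rewrite iotaD filter_cat iotaD filter_cat add1n prednK //=.
have -> : nth 0 (b ++ y) (size b).-1 < nth 0 (b ++ y) (size b).
  by rewrite !nth_cat ltnn subnn ltn_predL b0 nth_last nth0.
have -> : [seq i <- iota 1 (size b).-1 | nth 0 (b ++ y) i.-1 < nth 0 (b ++ y) i] = [::].
  apply: filter_nil => i.
  rewrite mem_iota => ib /=; rewrite !nth_cat !ifT; try lia.
  by have /= := sortedP 0 sb i.-1; rewrite prednK; lia.
rewrite /=; congr (_ :: _); rewrite iotaDl filter_map.
congr map; apply: eq_in_filter => i; rewrite mem_iota => ib /=.
rewrite !nth_cat !ifF; try lia.
by congr (nth 0 y _ < nth 0 y _); lia.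
Qed.

Lemma blocks_cons b bs : blocks (b :: bs) ->
  [/\ b != [::], sorted geq b & blocks bs].
Proof.
by case/andP=> /= /andP[/andP[b0 sb] H] /path_sorted H'; split; rewrite // /blocks H.
Qed.

Lemma flatten_blocks_eq0 b bs : blocks (b :: bs) ->
  flatten (b :: bs) != [::] /\ head 0 (flatten (b :: bs)) = head 0 b.
Proof. by case/blocks_cons; case: b. Qed.

(** Rises happen exactly at the ends of blocks, so the partial sums of the block lengths are the
    numbers b_r that delimit the runs. *)
Lemma asc_flatten b bs : blocks (b :: bs) ->
  rcons (asc (flatten (b :: bs))) (size (flatten (b :: bs))) =
  scanl addn 0 (shape (b :: bs)).
Proof.
elim: bs b => [|b' bs IH] b H.
  case/blocks_cons: (H) => b0 sb _; rewrite /= cats0 add0n /asc.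
  have -> // : [seq i <- iota 1 (size b).-1 | nth 0 b i.-1 < nth 0 b i] = [::].
  apply: filter_nil => i.
  rewrite mem_iota => ib /=.
  by have /= := sortedP 0 sb i.-1; rewrite prednK; lia.
case/blocks_cons: (H) => b0 sb Hb'; have [y0 hy] := flatten_blocks_eq0 Hb'.
rewrite [flatten (b :: _)]/= -[b' ++ _]/(flatten (b' :: bs)).
rewrite asc_cat //; last by rewrite hy; case/andP: H => _ /= /andP[].
rewrite size_cat rcons_cons -map_rcons IH // [shape (b :: _)]/= [in RHS]/= add0n.
have gen z w s : [seq z + i | i <- scanl addn w s] = scanl addn (z + w) s.
  by elim: s w => //= x s IHs w; rewrite IHs addnA.
by rewrite gen addn0.
Qed.

Lemma foldl_addn_sumn z s : foldl addn z s = z + sumn s.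
Proof. by elim: s z => [|x s IH] z /=; rewrite ?addn0 // IH addnA. Qed.

Section RunsTab.

Variable bs : seq (seq nat).
Hypothesis bbs : blocks bs.
Hypothesis bs0 : bs != [::].

Let y := flatten bs.

Lemma runb_tab r : r <= size bs -> runb (tab y) r = sumn (take r (shape bs)).
Proof.
rewrite /runb size_rw_tab ID_tab /y; case: bs bbs bs0 => // b bs' H _ rs.
rewrite asc_flatten //; case: r rs => // r rs.
rewrite -[LHS]/(nth 0 (scanl addn 0 (shape (b :: bs'))) r).
by rewrite nth_scanl ?size_map // foldl_addn_sumn.
Qed.

Lemma nruns_tab : nruns (tab y) = size bs.
Proof.
rewrite /nruns ID_tab /y; case: bs bbs bs0 => // b bs' H _.
by have /(congr1 size) := asc_flatten H; rewrite size_rcons size_scanl size_map.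
Qed.

Lemma beta_tab r : r < size bs -> beta (tab y) r.+1 = nth 0 (shape bs) r.
Proof.
move=> rs; rewrite /beta !runb_tab //=; last exact: ltnW.
by rewrite (take_nth 0) ?size_map // sumn_rcons addKn.
Qed.

End RunsTab.

(** Positions k count from 0, so this is the cell with entry k+1; its row and column count from
    1. *)
Definition cellof (y : seq nat) (k : nat) : cell :=
  ((nth 0 y k).+1, (count_mem (nth 0 y k) (take k y)).+1).

Lemma entry_cellof y k : k < size y -> entry (tab y) (cellof y k) = k.+1.
Proof.
move=> ky; rewrite /entry /= nth_tab.
have -> : size y = k + (1 + (size y - k.+1)) by lia.
rewrite iotaD filter_cat nth_cat.
set s := filter _ _; have -> : size s = count_mem (nth 0 y k) (take k y).
  rewrite /s; move: (nth 0 y k) => v {s}.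
  have -> : take k y = [seq nth 0 y i.-1 | i <- iota 1 k].
    apply: (@eq_from_nth _ 0); rewrite size_takel ?size_map ?size_iota 1?ltnW // => i ik.
    by rewrite (nth_map 0) ?size_iota // nth_iota // nth_take.
  by rewrite size_filter count_map.
by rewrite ltnn subnn iotaD filter_cat /= eqxx.
Qed.

Lemma cellof_inj y k l : k < size y -> l < size y -> cellof y k = cellof y l -> k = l.
Proof.
by move=> ky ly E; have := entry_cellof ky; rewrite E entry_cellof // => -[].
Qed.

Definition rdg (z z' : cell) : bool := (z'.1 < z.1) || ((z.1 == z'.1) && (z.2 < z'.2)).

Lemma rdg_trans : transitive rdg.
Proof. by move=> [a b] [c d] [e f]; rewrite /rdg /=; lia. Qed.

Lemma rdg_irr : irreflexive rdg.
Proof. by move=> [a b]; rewrite /rdg /=; lia. Qed.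

Lemma sorted_cells T : sorted rdg (cells T).
Proof.
rewrite (sorted_pairwise rdg_trans) /cells pairwise_flatten; apply/andP; split.
  apply/allP => _ /mapP[r _ ->]; rewrite -(sorted_pairwise rdg_trans) sorted_map.
  apply: (sub_sorted (e := ltn)); last exact: iota_ltn_sorted.
  by move=> a b /= ab; rewrite /rdg /= eqxx ab orbT.
rewrite pairwise_map; apply: (sub_pairwise (r := gtn)) => [r q /= qr|].
  by apply/allrelP => _ _ /mapP[a _ ->] /mapP[b _ ->]; rewrite /rdg /= qr.
rewrite -(sorted_pairwise (fun b a c (ab : b < a) bc => ltn_trans bc ab)).
by rewrite rev_sorted iota_ltn_sorted.
Qed.

Lemma mem_cells T z : (z \in cells T) =
  (0 < z.1 <= size T) && (0 < z.2 <= size (nth [::] T z.1.-1)).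
Proof.
case: z => r c; apply/allpairsPdep/idP => [[r' [c' [+ + [-> ->]]]] /=|/andP[/= rT cT]].
  by rewrite mem_rev !mem_iota !add1n !ltnS => -> ->.
by exists r, c; rewrite mem_rev !mem_iota !add1n !ltnS.
Qed.

Lemma mem_cellof y k : k < size y -> cellof y k \in cells (tab y).
Proof.
move=> ky; rewrite mem_cells size_tab /= nr_gt ?mem_nth //= nth_tabJ size_trow ?size_iota //.
move: (nth 0 y k) (drop_nth 0 ky) => v E.
have -> : count_mem v y = count_mem v (take k y) + count_mem v (drop k y).
  by rewrite -count_cat cat_take_drop.
by rewrite E /= eqxx; lia.
Qed.

Lemma perm_cells_tab y : perm_eq [seq cellof y k | k <- iota 0 (size y)] (cells (tab y)).
Proof.
have u1 : uniq [seq cellof y k | k <- iota 0 (size y)].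
  rewrite map_inj_in_uniq ?iota_uniq // => a b; rewrite !mem_iota => /= ay by'.
  exact: cellof_inj.
have u2 : uniq (cells (tab y)) by apply: (sorted_uniq rdg_trans rdg_irr (sorted_cells _)).
have sub : {subset [seq cellof y k | k <- iota 0 (size y)] <= cells (tab y)}.
  by move=> z /mapP[k]; rewrite mem_iota => ky ->; apply: mem_cellof.
apply: uniq_perm => //; apply: (uniq_min_size u1 sub _).2.
rewrite size_map size_iota /cells size_allpairs_dep.
suff -> : sumn [seq size (iota 1 (size (nth [::] (tab y) r.-1))) | r <- rev (iota 1 (size (tab y)))]
   = size (flatten (tab y)) by rewrite (perm_size (perm_flatten_tabJ _)) ?size_iota.
rewrite size_flatten map_rev sumn_rev; congr sumn.
rewrite (iotaDl 1 0) -map_comp -[in RHS](mkseq_nth [::] (tab y)) /shape -map_comp.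
by apply: eq_map => r /=; rewrite size_iota.
Qed.

(** A list of cells sorted strictly in reading order is determined by its members, so it suffices to
    list the right positions [ps] in reading order. *)
Lemma filter_cells y (P : pred cell) (ps : seq nat) :
  sorted rdg (map (cellof y) ps) -> all (ltn^~ (size y)) ps ->
  (forall k, k < size y -> P (cellof y k) = (k \in ps)) ->
  [seq z <- cells (tab y) | P z] = map (cellof y) ps.
Proof.
move=> sps pn HP; apply: (irr_sorted_eq rdg_trans rdg_irr) => //.
  exact: (sorted_filter rdg_trans _ (sorted_cells _)).
move=> z; rewrite mem_filter -(perm_mem (perm_cells_tab y)).
apply/andP/mapP => [[Pz /mapP[k]]|[k kp ->]].
  by rewrite mem_iota /= => ky E; exists k => //; rewrite -HP // -E.
have ky := allP pn _ kp; rewrite HP // kp; split=> //.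
by apply: map_f; rewrite mem_iota.
Qed.

(** Going forward in the word, a smaller letter means a lower row, and a repeated letter sits
    further right in the same row. *)
Lemma sorted_rdg_cellof y (ps : seq nat) : sorted ltn ps -> all (ltn^~ (size y)) ps ->
  sorted geq (map (nth 0 y) ps) -> sorted rdg (map (cellof y) ps).
Proof.
rewrite !sorted_map => s1 pn s2.
have : sorted [rel a b | (a < b) && geq (nth 0 y a) (nth 0 y b)] ps.
  by rewrite sorted_relI s1.
apply: (sub_in_sorted (P := [pred k | k < size y])) pn => a b /= ay bY /andP[ab].
rewrite /rdg /= ltnS eqSS leq_eqVlt.
case/predU1P => [->|->//]; rewrite eqxx ltnS /=; apply/orP; right.
have -> : take b y = take a.+1 y ++ drop a.+1 (take b y).
  by rewrite -{1}(cat_take_drop a.+1 (take b y)) take_takel.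
by rewrite count_cat (take_nth 0) // -cats1 count_cat /= eqxx; lia.
Qed.

(** Serves partitions, which avoid 0, and tableaux without empty rows: padding with the default then
    loses no information. *)
Lemma eq_nth_default (T : eqType) (x0 : T) (s t : seq T) : x0 \notin s -> x0 \notin t ->
  (forall r, nth x0 s r = nth x0 t r) -> s = t.
Proof.
move=> s0 t0 E; have le (u v : seq T) : x0 \notin u -> (forall r, nth x0 u r = nth x0 v r) -> size u <= size v.
  move=> u0 Euv; rewrite leqNgt; apply: contraNN u0 => vu.
  by rewrite -(nth_default x0 (leqnn (size v))) -Euv mem_nth.
by apply: (@eq_from_nth _ x0) => //; apply/eqP; rewrite eqn_leq !le.
Qed.

(** * Row insertion *)

(* [ins T x T' r]: row insertion of [x] into [T] gives [T'], whose new cell lies in row [r] (from 0). *)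
Inductive ins : tableau -> nat -> tableau -> nat -> Prop :=
| ins_nil x : ins [::] x [:: [:: x]] 0
| ins_end s T x : s != [::] -> all (ltn^~ x) s -> ins (s :: T) x (rcons s x :: T) 0
| ins_bump u b v T x T1 r : all (ltn^~ x) u -> x < b -> all (ltn b) v ->
    ins T b T1 r -> ins ((u ++ b :: v) :: T) x ((u ++ x :: v) :: T1) r.+1.

(** The tableau obtained from a proper prefix of a permutation need not contain 1, ..., m, so no
    condition is put on the set of entries. Columns are compared by counts, as in [below_ltnP]. *)
Fixpoint good (T : tableau) : Prop :=
  if T is s :: T' then
    [/\ sorted ltn s, s != [::],
        (forall v, count (leq^~ v) (head [::] T') <= count (ltn^~ v) s) & good T']
  else True.

Lemma ins_exists T x : good T -> uniq (x :: flatten T) -> exists T' r, ins T x T' r.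
Proof.
elim: T x => [|s T IH] x; first by exists [:: [:: x]], 0; constructor.
case=> ss s0 _ gT /= /andP[xs us]; rewrite mem_cat negb_or in xs; case/andP: xs => xs xT.
have E := sorted_split (a := ltn^~ x) ltn_trans (fun a b ab bx => ltn_trans ab bx) ss.
case Ev : (filter (predC (ltn^~ x)) s) => [|b v].
  rewrite Ev cats0 in E; exists (rcons s x :: T), 0; constructor=> //.
  by rewrite E filter_all.
have bx : x < b.
  have : b \in filter (predC (ltn^~ x)) s by rewrite Ev mem_head.
  rewrite mem_filter /= => /andP[bx bs]; rewrite ltn_neqAle leqNgt bx andbT.
  by apply: contraNneq xs => ->.
have bv : all (ltn b) v.
  have := sorted_filter ltn_trans (predC (ltn^~ x)) ss; rewrite Ev /=.
  by rewrite (path_sortedE ltn_trans) => /andP[].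
have [|T1 [r iT]] := IH b gT.
  move: us; rewrite /= cat_uniq => /and3P[_ /hasPn H ->]; rewrite andbT.
  by apply: contraTN isT => bT; have := H _ bT; rewrite /= E Ev mem_cat mem_head orbT.
rewrite E Ev; exists ((filter (ltn^~ x) s ++ x :: v) :: T1), r.+1; constructor=> //.
exact: filter_all.
Qed.

Lemma find_lt_cat u x (v : seq nat) : all (ltn^~ x) u -> find (ltn x) (u ++ v) = size u + find (ltn x) v.
Proof.
move=> ux; rewrite find_cat ifF //; apply/hasP => -[z zu /=].
by have := allP ux _ zu; rewrite /=; lia.
Qed.

Lemma ins_row_insert T x T' r : ins T x T' r -> row_insert T x = T'.
Proof.
elim=> {T x T' r} [x|s T x s0 sx|u b v T x T1 r ux xb bv _ IH] //=.
  by have := find_lt_cat [::] sx; rewrite cats0 /= addn0 => ->; rewrite ltnn.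
rewrite find_lt_cat //= xb addn0 size_cat /= -{1}[size u]addn0 ltn_add2l /=.
rewrite nth_cat ltnn subnn /= IH; congr (_ :: _).
by elim: u {ux} => //= z u ->.
Qed.

Lemma ins_size T x T' r : ins T x T' r -> r < size T' /\
  forall i, size (nth [::] T' i) = size (nth [::] T i) + (i == r).
Proof.
elim=> {T x T' r} [x|s T x s0 sx|u b v T x T1 r ux xb bv _ [IH1 IH2]].
- by split=> // -[|i] //=; rewrite nth_nil.
- by split=> // -[|i] /=; rewrite ?addn0 // size_rcons addn1.
- split=> // -[|i] /=; last by rewrite IH2.
  by rewrite !size_cat addn0.
Qed.

Lemma ins_perm T x T' r : ins T x T' r -> perm_eq (flatten T') (x :: flatten T).
Proof.
elim=> {T x T' r} [x|s T x s0 sx|u b v T x T1 r ux xb bv _ IH] //=.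
  by rewrite cat_rcons -cat1s perm_catCA.
apply/seq.permP => a; have := seq.permP IH a; rewrite /= !count_cat /= => ->; lia.
Qed.

(** How insertion changes the counting function of the bottom row: unchanged below x, one more at x,
    and above x either equal to the old value or still equal to the new value at x. With this,
    [ins_good] and [ins_reverse] compare with the row underneath. *)
Lemma ins_head T x T' r : ins T x T' r -> let t := head [::] T in let t' := head [::] T' in
  [/\ x \in t',
      forall v, v < x -> count (leq^~ v) t' = count (leq^~ v) t,
      count (leq^~ x) t' = (count (leq^~ x) t).+1,
      forall v, count (leq^~ v) t <= count (leq^~ v) t' &
      forall v, x <= v -> count (leq^~ v) t' = count (leq^~ v) t \/
                          count (leq^~ v) t' = count (leq^~ x) t'].
Proof.
case=> {T x T' r} [x|s T x s0 sx|u b v T x T1 r ux xb bv _] /=.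
- rewrite mem_head leqnn; split=> // w; rewrite ?addn0 //; first by case: leqP => //; lia.
  by move=> ->; right.
- rewrite mem_rcons mem_head -cats1; split=> //.
  + by move=> w wx; rewrite count_cat /= leqNgt wx /= !addn0.
  + by rewrite count_cat /= leqnn !addn0 addn1.
  + by move=> w; rewrite count_cat leq_addr.
  + move=> w xw; right; rewrite !count_cat /= xw leqnn; congr (_ + _).
    by apply: eq_in_count => z /(allP sx) /=; lia.
- rewrite mem_cat mem_head orbT; split=> //.
  + by move=> w wx; rewrite !count_cat /=; lia.
  + by rewrite !count_cat /= leqnn (leqNgt b) xb; lia.
  + by move=> w; rewrite !count_cat /=; lia.
  + move=> w xw; rewrite !count_cat /= xw leqnn; have [bw|wb] := leqP b w; first by left.
    right; congr (_ + (_ + _)).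
      by apply: eq_in_count => z /(allP ux) /=; lia.
    by apply: eq_in_count => z /(allP bv) /=; lia.
Qed.

Lemma sorted_mid u x (v : seq nat) : sorted ltn (u ++ x :: v) =
  [&& sorted ltn u, all (ltn^~ x) u, all (ltn x) v & sorted ltn (x :: v) && allrel ltn u v].
Proof.
rewrite !(sorted_pairwise ltn_trans) pairwise_cat allrel_consr /=.
case: (pairwise _ u); rewrite ?andbF //=; case: (all _ v); rewrite ?andbF //=.
by case: (all _ u) => //=; rewrite andbC.
Qed.

Lemma sorted_replace (u v : seq nat) x b : sorted ltn (u ++ b :: v) ->
  all (ltn^~ x) u -> all (ltn x) v -> sorted ltn (u ++ x :: v).
Proof.
rewrite !sorted_mid /= !(path_sortedE ltn_trans) => /and4P[-> _ _ /andP[/andP[_ ->] ->]] -> -> //.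
Qed.

Lemma ins_good T x T' r : ins T x T' r -> good T -> good T'.
Proof.
elim=> {T x T' r} [x|s T x s0 sx|u b v T x T1 r ux xb bv iT IH] //= [ss _ col gT].
  split=> //.
  - by rewrite (sorted_pairwise ltn_trans) pairwise_rcons -(sorted_pairwise ltn_trans) ss andbT.
  - by case: (s).
  - by move=> w; rewrite -cats1 count_cat; apply: leq_trans (leq_addr _ _).
have xv : all (ltn x) v by apply: sub_all bv => z; apply: ltn_trans.
split; last exact: IH.
- exact: sorted_replace ss ux xv.
- by case: (u).
- have [_ h1 h2 _ h3] := ins_head iT => w; rewrite count_cat /=.
  have := col w; have := col b; rewrite !count_cat /= ltnn.
  have [wb|bw] := ltnP w b; first by rewrite h1 //; lia.
  have [wb|bw'] := eqVneq w b; first by rewrite wb h2 xb /=; lia.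
  have ub : count (ltn^~ b) u = size u.
    by apply/eqP; rewrite -all_count; apply: sub_all ux => z zx; apply: ltn_trans zx xb.
  have uw : count (ltn^~ w) u = size u.
    by apply/eqP; rewrite -all_count; apply: sub_all ux => z zx; apply: leq_trans (ltn_trans zx xb) bw.
  have vb : count (ltn^~ b) v = 0.
    by apply: count_nil => z /(allP bv) /=; lia.
  case: (h3 w bw) => ->; rewrite ?h2 ub uw vb; lia.
Qed.

Lemma ins_inj T x S y T' r : ins T x T' r -> ins S y T' r -> T = S /\ x = y.
Proof.
move=> iT; elim: iT S y => {T x T' r} [x|s T x s0 sx|u b v T x T1 r ux xb bv iT IH] S y iS.
- inversion iS as [z|s T z s0 sz E|]; subst; first by [].
  by case: s s0 H sz {iS} => // a [|a' s].
- move E1 : (rcons s x :: T) iS => T1 iS; move E2 : 0 iS => r0 iS; case: iS E1 E2 => //.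
    by move=> z [/(congr1 size)]; rewrite size_rcons; case: s s0 {sx}.
  by move=> s' T' z s0' sz [/rcons_inj[-> ->] ->].
- move E1 : ((u ++ x :: v) :: T1) iS => T2 iS; move E2 : r.+1 iS => r2 iS.
  case: iS E1 E2 => // u' b' v' S' z S1 r' uz zb bv' iS' [E ET] [Er].
  subst S1 r'; have [ES Eb] := IH _ _ iS'; subst S' b'.
  (* In the new row, the entries smaller than the bumped value b are [u] followed by x, so that row
     and b determine both. *)
  have f w1 (w2 w3 : seq nat) : all (ltn^~ w1) w2 -> w1 < b -> all (ltn b) w3 ->
      [seq z <- w2 ++ w1 :: w3 | z < b] = rcons w2 w1.
    move=> h1 h2 h3; rewrite filter_cat /= h2.
    have -> : [seq z <- w3 | z < b] = [::].
      by apply: filter_nil => a /(allP h3) /=; lia.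
    rewrite cats1; congr rcons; apply/all_filterP; apply: sub_all h1 => a ax.
    exact: ltn_trans ax h2.
  have := f _ _ _ ux xb bv; rewrite E (f _ _ _ uz zb bv') => /rcons_inj[eu ez]; subst u' z.
  by move/(congr1 (drop (size u).+1)): E; rewrite -!cat_rcons !drop_size_cat ?size_rcons // => ->.
Qed.

Lemma good_size T i : good T -> size (nth [::] T i.+1) <= size (nth [::] T i).
Proof.
elim: T i => // s T IH [|i] /= [ss _ col gT]; last exact: IH.
have := col (\max_(z <- head [::] T) z); rewrite nth0.
have -> : count (leq^~ (\max_(z <- head [::] T) z)) (head [::] T) = size (head [::] T).
  apply/eqP; rewrite -all_count; apply/allP => z zT /=.
  by rewrite (big_rem z) //= leq_maxl.
by move=> H; apply: leq_trans H (count_size _ _).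
Qed.

Lemma good_nil T : good T -> [::] \notin T.
Proof. by elim: T => //= s T IH [_ s0 _ /IH gT]; rewrite inE negb_or gT eq_sym s0. Qed.

(** Reverse bumping from the corner in row r. A value b ejected from the row above replaces the
    largest entry smaller than b; column strictness provides one. *)
Lemma ins_reverse T' r : good T' -> uniq (flatten T') -> r < size T' ->
  size (nth [::] T' r.+1) < size (nth [::] T' r) ->
  exists T x, ins T x T' r /\ good T.
Proof.
elim: T' r => // s T1 IH [|r].
  case=> ss s0 col gT _ _ /=; rewrite nth0; case/lastP: s s0 ss col => // s x _ ss col.
  rewrite size_rcons ltnS => cs; move: ss.
  rewrite (sorted_pairwise ltn_trans) pairwise_rcons -(sorted_pairwise ltn_trans) => /andP[sx ss].
  have [s0|s0] := eqVneq s [::].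
    subst s; have : T1 = [::].
      case: T1 cs gT {IH col} => // t T1 /=; rewrite leqn0 size_eq0 => /eqP-> [_ //].
    by move=> ->; exists [::], x; split=> //; constructor.
  exists (s :: T1), x; split; first by constructor.
  split=> // w; have := col w; rewrite -cats1 count_cat /= addn0.
  have [xw|wx] := ltnP x w; last by rewrite addn0.
  have -> : count (ltn^~ w) s = size s.
    by apply/eqP; rewrite -all_count; apply: sub_all sx => z zx; apply: ltn_trans zx xw.
  by move=> _; apply: leq_trans (count_size _ _) cs.
case=> ss s0 col gT /= us; rewrite ltnS => rT cT.
have uT : uniq (flatten T1) by move: us; rewrite cat_uniq => /and3P[].
have [T [b [iT gT']]] := IH r gT uT rT cT.
have [bt h1 h2 h4 h3] := ins_head iT; have pT := ins_perm iT.
have bs : b \notin s.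
  move: us; rewrite cat_uniq => /and3P[_ /hasPn H _]; apply: contraTN isT => bs.
  by have := H b; rewrite (perm_mem pT) mem_head bs => /(_ isT).
have E := sorted_split (a := ltn^~ b) ltn_trans (fun a b ab bx => ltn_trans ab bx) ss.
have cb : 0 < count (ltn^~ b) s by apply: leq_trans (col b); rewrite -has_count; apply/hasP; exists b.
case/lastP Eu : (filter (ltn^~ b) s) E cb => [|u x] E; rewrite -size_filter Eu // => _.
set v := filter _ s in E; have xb : x < b.
  have : x \in filter (ltn^~ b) s by rewrite Eu mem_rcons mem_head.
  by rewrite mem_filter => /andP[].
have bv : all (ltn b) v.
  apply/allP => z; rewrite mem_filter /= => /andP[bz zs]; rewrite ltn_neqAle leqNgt bz andbT.
  by apply: contraNneq bs => ->.
rewrite cat_rcons in E.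
have := ss; rewrite E sorted_mid => /and4P[_ ux _ _].
exists ((u ++ b :: v) :: T), x; split; first by constructor.
have ub : all (ltn^~ b) u by apply: sub_all ux => z zx; apply: ltn_trans zx xb.
split=> //.
- by rewrite E in ss; exact: sorted_replace ss ub bv.
- by case: (u).
- move=> w; have := col w; have := col b; rewrite E !count_cat /= xb.
  have cub : count (ltn^~ b) u = size u by apply/eqP; rewrite -all_count.
  have cvb : count (ltn^~ b) v = 0.
    by apply: count_nil => z /(allP bv) /=; lia.
  rewrite cub cvb; have [wb|bw] := ltnP w b.
    rewrite (h1 w wb) h2 => H1 H2; have [xw|wx] := ltnP x w; last by lia.
    have -> : count (ltn^~ w) u = size u.
      by apply/eqP; rewrite -all_count; apply: sub_all ux => z zx; apply: ltn_trans zx xw.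
    suff : count (leq^~ w) (head [::] T) <= count (leq^~ b) (head [::] T) by lia.
    by apply: sub_count => z /= zw; apply: leq_trans zw (ltnW wb).
  have [->|bw'] := eqVneq w b; first by rewrite h2 cub cvb; lia.
  have := h4 w; lia.
Qed.

(* A bumping step [u b v x -> b u x v] with [u < x < b < v] is a sequence of Knuth moves; it never moves two consecutive values past each other. *)
Lemma ins_filter T x T' r i : ins T x T' r ->
  [seq z <- rw T' | (z == i) || (z == i.+1)] =
  [seq z <- rcons (rw T) x | (z == i) || (z == i.+1)].
Proof.
have rwc s S : rw (s :: S) = rw S ++ s by rewrite /rw rev_cons flatten_rcons.
elim=> {T x T' r} [x|s T x s0 sx|u b v T x T1 r ux xb bv _ IH] //.
  by rewrite !rwc rcons_cat.
rewrite !rwc -!cats1 !filter_cat IH -cats1 filter_cat -!catA; congr (_ ++ _).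
set a := fun z => _; rewrite -[b :: v]cat1s -[x :: v]cat1s !filter_cat -catA.
have H1 : [seq z <- u | a z] ++ [seq z <- [:: b] | a z] = [seq z <- [:: b] | a z] ++ [seq z <- u | a z].
  case ab : (a b); rewrite /= ab ?cats0 //.
  have -> : [seq z <- u | a z] = [::]; last by [].
  apply: filter_nil => z /(allP ux) /=.
  by move: ab; rewrite /a; lia.
have H2 : [seq z <- v | a z] ++ [seq z <- [:: x] | a z] = [seq z <- [:: x] | a z] ++ [seq z <- v | a z].
  case ab : (a x); rewrite /= ab ?cats0 //.
  have -> : [seq z <- v | a z] = [::]; last by [].
  apply: filter_nil => z /(allP bv) /=.
  by move: ab; rewrite /a; lia.
by rewrite H2 [RHS]catA H1 -catA.
Qed.

Lemma index_filter (w : seq nat) a b : uniq w -> a \in w -> b \in w -> a != b ->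
  (index a w < index b w) = ([seq z <- w | (z == b) || (z == a)] == [:: a; b]).
Proof.
elim: w => //= z w IH /andP[zw uw]; rewrite !inE => aw bw ab.
case: (eqVneq z a) => [za|za].
  subst z; rewrite (negbTE ab) orbT.
  have -> : [seq z <- w | (z == b) || (z == a)] = [seq z <- w | z == b].
    by apply: eq_in_filter => z; case: (eqVneq z a) => [->|]; rewrite ?orbF // (negbTE zw).
  have {}bw : b \in w by case/orP: bw => // /eqP E; rewrite E eqxx in ab.
  by rewrite (_ : [seq z <- w | z == b] = [:: b]) ?eqxx //; apply: filter_pred1_uniq.
case: (eqVneq z b) => [zb|zb] /=.
  by subst z; rewrite ltn0; apply/esym/negbTE/negP => /eqP[E]; rewrite E eqxx in ab.
rewrite ltnS IH //; [by move: aw; rewrite eq_sym (negbTE za)|by move: bw; rewrite eq_sym (negbTE zb)].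
Qed.

Lemma sorted_ltnW (s : seq nat) : sorted ltn s -> sorted leq s.
Proof. by apply: sub_sorted => a b /=; apply: ltnW. Qed.

Lemma good_columns T : good T -> all (sorted ltn) T /\ sorted (below ltn) T.
Proof.
elim: T => //= s T IH [ss _ col /[dup] gT /IH[aT cT]]; rewrite ss aT; split=> //.
case: T col gT aT cT {IH} => //= t T col [st _ _ _] _ ->; rewrite andbT.
by apply/below_ltnP => //; exact: sorted_ltnW.
Qed.

Lemma columns_good T : [::] \notin T -> all (sorted ltn) T -> sorted (below ltn) T -> good T.
Proof.
elim: T => //= s T IH; rewrite inE negb_or eq_sym => /andP[s0 T0] /andP[ss aT] cT.
split=> //; last by apply: IH => //; apply: path_sorted cT.
case: T cT aT {IH T0} => //= t T cT aT v.
case/andP: cT => /below_ltnP H _; apply: H; first exact: sorted_ltnW.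
by case/andP: aT => st _; exact: sorted_ltnW.
Qed.

Lemma good_syt n T : good T -> perm_eq (flatten T) (iota 1 n) -> is_syt n T.
Proof.
move=> gT pT; have [aT cT] := good_columns gT; rewrite /is_syt aT cT pT !andbT /is_part.
apply/and3P; split.
- apply/(sortedP 0) => i iT; rewrite size_map in iT.
  rewrite !(nth_map [::]) //; last exact: ltnW.
  exact: good_size.
- by apply: contra (good_nil gT) => /mapP[s sT /esym/size0nil <-].
- by rewrite -size_flatten (perm_size pT) size_iota.
Qed.

Lemma syt_good n T : is_syt n T -> good T.
Proof.
case/and4P => /and3P[_ T0 _] _ aT cT; apply: columns_good => //.
by apply: contra T0 => nT; apply/mapP; exists [::].
Qed.

Lemma good_shape0 T : good T -> 0 \notin shape T.
Proof. by move=> gT; apply: contra (good_nil gT) => /mapP[s sT /esym/size0nil <-]. Qed.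

Lemma nth_shape (T : tableau) i : nth 0 (shape T) i = size (nth [::] T i).
Proof.
have [iT|Ti] := ltnP i (size T); first by rewrite (nth_map [::]).
by rewrite !nth_default ?size_map.
Qed.

Lemma ins_le T x T' r : ins T x T' r -> r <= size T /\ size T' = maxn r.+1 (size T).
Proof.
elim=> {T x T' r} [x|s T x s0 sx|u b v T x T1 r ux xb bv iT [IH1 IH2]] //=.
  by split=> //; rewrite maxnSS max0n.
by split=> //; rewrite IH2 maxnSS.
Qed.

Definition addcell (Q : tableau) (r : nat) : tableau :=
  set_nth [::] Q r (rcons (nth [::] Q r) (size (flatten Q)).+1).

Lemma rsk_step_ins P Q x P' r : ins P x P' r -> rsk_step (P, Q) x = (P', addcell Q r).
Proof.
move=> iP; rewrite /rsk_step (ins_row_insert iP); congr (_, set_nth _ _ _ (rcons (nth _ _ _) _));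
  have [rP H] := ins_size iP.
all: have -> : size P' = r + (size P' - r).-1.+1 by lia.
all: rewrite iotaD find_cat ifF ?size_iota /= ?H ?add0n ?eqxx ?addn1 ?(gtn_eqF (ltnSn _)) ?addn0 //.
all: by apply/hasP => -[i]; rewrite mem_iota H => ir; rewrite (_ : i == r = false) ?addn0 ?eqxx //; lia.
Qed.

Lemma perm_addcell (Q : tableau) r m : r <= size Q ->
  perm_eq (flatten (set_nth [::] Q r (rcons (nth [::] Q r) m))) (m :: flatten Q).
Proof.
elim: Q r => [|s Q IH] [|r] //= rQ; first by rewrite cat_rcons -cat1s perm_catCA.
have H := IH r rQ; rewrite -cat1s perm_sym perm_catCA perm_cat2l perm_sym; exact: H.
Qed.

Lemma shape_addcell P Q x P' r : ins P x P' r -> shape Q = shape P -> shape (addcell Q r) = shape P'.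
Proof.
move=> iP sQ; have [rP sP'] := ins_le iP; have [_ H] := ins_size iP.
have sQP : size Q = size P by have := congr1 size sQ; rewrite !size_map.
apply: (@eq_from_nth _ 0) => [|i _]; first by rewrite !size_map size_set_nth sP' sQP.
have sz j : size (nth [::] Q j) = size (nth [::] P j) by rewrite -!nth_shape sQ.
rewrite !nth_shape H /addcell nth_set_nth /=.
by case: eqP => [->|_]; rewrite ?size_rcons sz ?addn1 ?addn0.
Qed.

Lemma rsk_rcons w x : rsk (rcons w x) = rsk_step (rsk w) x.
Proof. by rewrite /rsk foldl_rcons. Qed.

Lemma rskP w : uniq w ->
  [/\ good (rsk w).1, perm_eq (flatten (rsk w).1) w, shape (rsk w).2 = shape (rsk w).1 &
      perm_eq (flatten (rsk w).2) (iota 1 (size w))].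
Proof.
elim/last_ind: w => // w x IH; rewrite rcons_uniq => /andP[xw uw].
have [gP pP sQ pQ] := IH uw; rewrite rsk_rcons; case: (rsk w) gP pP sQ pQ => P Q gP pP sQ pQ.
rewrite /= in gP pP sQ pQ.
have uxP : uniq (x :: flatten P) by rewrite /= (perm_mem pP) xw (perm_uniq pP).
have [P' [r iP]] := ins_exists gP uxP; rewrite (rsk_step_ins Q iP) /=; split.
- exact: ins_good iP gP.
- by rewrite (permPl (ins_perm iP)) perm_sym perm_rcons perm_cons perm_sym.
- exact: shape_addcell iP sQ.
- have [rP _] := ins_le iP; have sQP : size Q = size P by have := congr1 size sQ; rewrite !size_map.
  rewrite /addcell (permPl (perm_addcell _ _)) ?sQP // size_rcons -[(size w).+1]addn1 iotaD cats1.
  by rewrite perm_sym perm_rcons (perm_size pQ) size_iota add1n perm_cons perm_sym.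
Qed.

Lemma rsk_rconsP w x : uniq (rcons w x) -> exists P' r,
  ins (rsk w).1 x P' r /\ rsk (rcons w x) = (P', addcell (rsk w).2 r).
Proof.
rewrite rcons_uniq => /andP[xw uw]; have [gP pP _ _] := rskP uw.
have uxP : uniq (x :: flatten (rsk w).1) by rewrite /= (perm_mem pP) xw (perm_uniq pP).
have [P' [r iP]] := ins_exists gP uxP; exists P', r; split=> //.
by rewrite rsk_rcons [rsk w]surjective_pairing; apply: rsk_step_ins.
Qed.

(** The largest entry, m+1, reveals the row of the last cell; deleting it recovers the tableau. *)
Lemma addcell_inj (Q S : tableau) r t m : perm_eq (flatten Q) (iota 1 m) -> perm_eq (flatten S) (iota 1 m) ->
  [::] \notin Q -> [::] \notin S -> addcell Q r = addcell S t -> r = t /\ Q = S.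
Proof.
move=> pQ pS Q0 S0 E.
have nm (X : tableau) i : perm_eq (flatten X) (iota 1 m) -> m.+1 \notin nth [::] X i.
  move=> pX; have [iX|Xi] := ltnP i (size X); last by rewrite nth_default.
  apply/negP => mX; have : m.+1 \in flatten X by apply/flattenP; exists (nth [::] X i) => //; apply: mem_nth.
  by rewrite (perm_mem pX) mem_iota; lia.
have H i : nth [::] (addcell Q r) i = nth [::] (addcell S t) i by rewrite E.
have sm (X : tableau) : perm_eq (flatten X) (iota 1 m) -> size (flatten X) = m by move/perm_size; rewrite size_iota.
have rt : r = t.
  have := H r; rewrite /addcell !nth_set_nth /= eqxx (sm _ pQ) (sm _ pS); case: eqP => // _ E'.
  by have := nm S r pS; rewrite -E' mem_rcons mem_head.
subst t; split=> //; apply: (@eq_nth_default _ [::]) => // i.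
have := H i; rewrite /addcell !nth_set_nth /=; case: eqP => // -> /rcons_inj[] //.
Qed.

Lemma shape_nil (T S : tableau) : shape T = shape S -> [::] \notin T -> [::] \notin S.
Proof.
move=> E; have H (X : tableau) : ([::] \in X) = (0 \in shape X).
  apply/idP/mapP => [nX|[s sX /esym/size0nil <-]] //; by exists [::].
by rewrite !H E.
Qed.

Lemma rsk_inj w w' : uniq w -> uniq w' -> size w = size w' -> rsk w = rsk w' -> w = w'.
Proof.
elim/last_ind: w w' => [|w x IH] w'; first by move=> _ _ /esym/size0nil.
case/lastP: w' => [|w' x']; first by rewrite size_rcons.
move=> uw uw'; rewrite !size_rcons => -[sw].
have [P1 [r [iP E]]] := rsk_rconsP uw; have [P1' [r' [iP' E']]] := rsk_rconsP uw'.
move: uw uw'; rewrite !rcons_uniq => /andP[_ uw] /andP[_ uw'].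
have [gP _ sQ pQ] := rskP uw; have [gP' _ sQ' pQ'] := rskP uw'.
rewrite E E' => -[EP EQ]; rewrite -sw in pQ'.
have [|| er eQ] := addcell_inj pQ pQ' _ _ EQ.
- by apply: shape_nil (esym sQ) (good_nil gP).
- by apply: shape_nil (esym sQ') (good_nil gP').
subst r' P1'; have [eP ex] := ins_inj iP iP'; subst x'; congr rcons.
by apply: IH => //; rewrite [rsk w]surjective_pairing [rsk w']surjective_pairing eP eQ.
Qed.

(** The last letter of [w] created a cell in some row r, which is therefore a corner of the common
    shape. Reverse bumping of [T'] from r, followed by induction, gives a word with the same
    recording tableau. *)
Lemma rsk_exists w T' : uniq w -> good T' -> uniq (flatten T') -> shape T' = shape (rsk w).1 ->
  exists w', rsk w' = (T', (rsk w).2) /\ perm_eq w' (flatten T').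
Proof.
elim/last_ind: w T' => [|w x IH] T'.
  by case: T' => // _ _ _ _; exists [::].
move=> uw gT' uT'; have [P1 [r [iP E]]] := rsk_rconsP uw; rewrite E /= => sT'.
move: uw; rewrite rcons_uniq => /andP[_ uw].
have [gP _ _ _] := rskP uw.
have [rP1 H] := ins_size iP.
have sT1 : size T' = size P1 by have := congr1 size sT'; rewrite !size_map.
have nT i : size (nth [::] T' i) = size (nth [::] P1 i) by rewrite -!nth_shape sT'.
have [|| T [x' [iT gT]]] := @ins_reverse T' r gT' uT'.
- by rewrite sT1.
- by rewrite !nT !H eqxx (gtn_eqF (ltnSn r)) addn0 addn1 ltnS good_size.
have [_ HT] := ins_size iT.
have [|| w' [E' p']] := IH T uw gT.
- by have := perm_uniq (ins_perm iT); rewrite uT' => /esym /= /andP[].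
- apply: (@eq_nth_default _ 0); rewrite ?good_shape0 // => i; rewrite !nth_shape.
  by have := nT i; rewrite H HT => /addIn.
exists (rcons w' x'); split; last first.
  by rewrite perm_sym (permPl (ins_perm iT)) perm_sym perm_rcons perm_cons.
by rewrite rsk_rcons E' (rsk_step_ins _ iT).
Qed.

Lemma rsk_filter w i : uniq w ->
  [seq z <- rw (rsk w).1 | (z == i) || (z == i.+1)] = [seq z <- w | (z == i) || (z == i.+1)].
Proof.
elim/last_ind: w => // w x IH uw; have [P1 [r [iP E]]] := rsk_rconsP uw; rewrite E /=.
rewrite (ins_filter _ iP) -!cats1 !filter_cat IH //.
by move: uw; rewrite rcons_uniq => /andP[].
Qed.

(** Insertion never moves i and i+1 past each other ([rsk_filter]), so their relative order is the
    same in the word and in the reading word of the insertion tableau. *)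
Lemma IDw_rsk (w : seq nat) : perm_eq w (iota 1 (size w)) -> IDw w = ID (rsk w).1.
Proof.
move=> pw; have uw : uniq w by rewrite (perm_uniq pw) iota_uniq.
have [_ pP _ _] := rskP uw; have pr : perm_eq (rw (rsk w).1) w by rewrite (permPl (perm_rw _)).
rewrite /ID /IDw (perm_size pr); apply: eq_in_filter => i; rewrite mem_iota => iw.
have ii : i.+1 != i by rewrite gtn_eqF.
have m1 : i \in w by rewrite (perm_mem pw) mem_iota; lia.
have m2 : i.+1 \in w by rewrite (perm_mem pw) mem_iota; lia.
rewrite !index_filter ?(perm_uniq pr) ?(perm_mem pr) //.
by rewrite rsk_filter.
Qed.

(** * Permutations and their insertion and recording tableaux *)

Section Perm.

Variable n : nat.
Implicit Types p q : 'S_n.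

Lemma size_word p : size (word p) = n.
Proof. by rewrite size_map size_enum_ord. Qed.

Lemma perm_word p : perm_eq (word p) (iota 1 n).
Proof.
apply: uniq_perm; rewrite ?iota_uniq //.
  by rewrite map_inj_uniq ?enum_uniq // => i j [] /val_inj /perm_inj.
move=> x; rewrite mem_iota; apply/mapP/idP => [[i _ ->]|x1]; first by rewrite /= add1n ltnS ltn_ord.
have x_n : x.-1 < n by lia.
by exists (p^-1%g (Ordinal x_n)); rewrite ?mem_enum // permKV /=; lia.
Qed.

Lemma uniq_word p : uniq (word p).
Proof. by rewrite (perm_uniq (perm_word p)) iota_uniq. Qed.

Lemma word_inj : injective (@word n).
Proof.
move=> p q /eq_in_map E; apply/permP => i; apply: val_inj.
by have [] := E i (mem_enum _ i).
Qed.

Lemma word_exists (w : seq nat) : perm_eq w (iota 1 n) -> exists p, word p = w.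
Proof.
move=> pw; have sw : size w = n by rewrite (perm_size pw) size_iota.
have wi (i : 'I_n) : 0 < nth 0 w i <= n.
  have : nth 0 w i \in w by rewrite mem_nth ?sw.
  by rewrite (perm_mem pw) mem_iota; lia.
have f_n (i : 'I_n) : (nth 0 w i).-1 < n by have := wi i; lia.
have f_inj : injective (fun i => Ordinal (f_n i)).
  move=> i j [] E; have {}E : nth 0 w i = nth 0 w j by have := wi i; have := wi j; lia.
  apply: val_inj; apply/eqP => /=.
  by rewrite -(nth_uniq 0 (s := w)) ?sw ?(perm_uniq pw) ?iota_uniq // E.
exists (perm f_inj); apply: (@eq_from_nth _ 0); rewrite size_word // => i i_n.
rewrite (nth_map (Ordinal i_n)) ?size_enum_ord // permE /=.
have := wi (nth (Ordinal i_n) (enum 'I_n) i); rewrite nth_enum_ord //; lia.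
Qed.

Lemma Ptab_syt p : is_syt n (Ptab p).
Proof.
have [gP pP _ _] := rskP (uniq_word p); apply: good_syt => //.
by rewrite (permPl pP) perm_word.
Qed.

Lemma PQ_inj p q : Ptab p = Ptab q -> Qtab p = Qtab q -> p = q.
Proof.
move=> EP EQ; apply: word_inj; apply: rsk_inj; rewrite ?uniq_word ?size_word //.
by rewrite [LHS]surjective_pairing [RHS]surjective_pairing; congr (_, _).
Qed.

Lemma PQ_exists p T : is_syt n T -> shape T = shape (Ptab p) ->
  exists q, Ptab q = T /\ Qtab q = Qtab p.
Proof.
move=> sT eT; have /and4P[_ pT _ _] := sT.
have uT : uniq (flatten T) by rewrite (perm_uniq pT) iota_uniq.
have [w [Ew pw]] := rsk_exists (uniq_word p) (syt_good sT) uT eT.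
have [|q Eq] := @word_exists w; first by rewrite (permPl pw).
by exists q; rewrite /Ptab /Qtab Eq Ew.
Qed.

Lemma IDw_word p : IDw (word p) = ID (Ptab p).
Proof. by apply: IDw_rsk; rewrite size_word perm_word. Qed.

End Perm.

(** * Exchanging two runs of a word *)

Lemma index_map_in (T S : eqType) (f : T -> S) (s : seq T) x :
  {in x :: s &, injective f} -> index (f x) (map f s) = index x s.
Proof.
elim: s => //= z s IH inj; rewrite IH; last first.
  have sub u : u \in x :: s -> u \in x :: z :: s by rewrite !inE => /orP[]->; rewrite ?orbT.
  by move=> a b /sub ax /sub bx; apply: inj.
rewrite (inj_in_eq inj) ?inE ?eqxx ?orbT //.
Qed.

Lemma map_index_iota (T : eqType) (s : seq T) : uniq s ->
  [seq index x s | x <- s] = iota 0 (size s).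
Proof.
case: s => // x0 s us; apply: (@eq_from_nth _ 0); rewrite size_map ?size_iota // => i si.
by rewrite (nth_map x0) // nth_iota // index_uniq.
Qed.

Lemma perm_nr y y' : perm_eq y y' -> nr y = nr y'.
Proof.
move=> pyy; apply/eqP; rewrite eqn_leq; apply/andP; split; apply/nr_leqP => x.
  by rewrite (perm_mem pyy); apply: nr_gt.
by rewrite -(perm_mem pyy); apply: nr_gt.
Qed.

Lemma map_nth_iota_cat (x1 x2 x3 : seq nat) :
  [seq nth 0 (x1 ++ x2 ++ x3) k | k <- iota (size x1) (size x2)] = x2.
Proof.
apply: (@eq_from_nth _ 0); rewrite size_map size_iota // => i i2.
by rewrite (nth_map 0) ?size_iota // nth_iota // !nth_cat ltnNge leq_addr /= addKn i2.
Qed.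

Lemma map_nth_iota (y : seq nat) : [seq nth 0 y k | k <- iota 0 (size y)] = y.
Proof. by have := map_nth_iota_cat [::] y [::]; rewrite cats0. Qed.

Lemma row_cells y r : r < nr y ->
  [seq (r.+1, c) | c <- iota 1 (count_mem r y)] =
  [seq cellof y k | k <- iota 0 (size y) & nth 0 y k == r].
Proof.
move=> ry; apply: (irr_sorted_eq rdg_trans rdg_irr).
- rewrite sorted_map; apply: (sub_sorted (e := ltn)); last exact: iota_ltn_sorted.
  by move=> a b /= ab; rewrite /rdg /= eqxx ab orbT.
- apply: sorted_rdg_cellof.
  + exact: (sorted_filter ltn_trans _ (iota_ltn_sorted _ _)).
  + by apply/allP => k; rewrite mem_filter mem_iota => /andP[_ /andP[]].
  + set s := filter _ _; have : all (fun k => nth 0 y k == r) s by exact: filter_all.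
    elim: s => //= k [|l s] IH //= /andP[/eqP Ek /andP[El H]].
    by rewrite Ek (eqP El) leqnn /=; move: IH; rewrite /= El (eqP El); apply.
- move=> z; apply/mapP/mapP => [[c]|[k]].
    rewrite mem_iota => c1 ->.
    have : (r.+1, c) \in cells (tab y).
      by rewrite mem_cells size_tab /= ry nth_tabJ size_trow ?size_iota; lia.
    rewrite -(perm_mem (perm_cells_tab y)) => /mapP[k kn E]; exists k => //.
    by rewrite mem_filter kn andbT; case: E => -> _.
  rewrite mem_filter mem_iota => /andP[/eqP Ek /andP[_ ky]] ->.
  have := mem_cellof ky; rewrite mem_cells /= nth_tabJ size_trow ?size_iota // Ek => /andP[_ cn].
  by exists (count_mem r (take k y)).+1; rewrite ?mem_iota /cellof ?Ek //=; lia.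
Qed.

(* A reordering [p] of the positions of [y] that keeps equal letters in order turns the list of cells into the tableau of the reordered word. *)
Lemma tab_of_cells y (p : seq nat) :
  (forall r, [seq k <- p | nth 0 y k == r] = [seq k <- iota 0 (size y) | nth 0 y k == r]) ->
  [seq [seq (index (r, c) (map (cellof y) p)).+1 | c <- iota 1 (size (nth [::] (tab y) r.-1))]
     | r <- iota 1 (size (tab y))] = tab (map (nth 0 y) p).
Proof.
move=> Hp; have pp : perm_eq p (iota 0 (size y)).
  apply/allP => x _ /=; have cf s : count_mem x s = count_mem x [seq k <- s | nth 0 y k == nth 0 y x].
    rewrite count_filter; apply: eq_count => k /=; case: eqP => // ->; by rewrite eqxx.
  by rewrite cf Hp -cf.
have py : perm_eq (map (nth 0 y) p) y by rewrite -{2}(map_nth_iota y) perm_map.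
have up : uniq p by rewrite (perm_uniq pp) iota_uniq.
have sp : size p = size y by rewrite (perm_size pp) size_iota.
have pn k : k \in p -> k < size y by rewrite (perm_mem pp) mem_iota.
rewrite [RHS]tabE (perm_nr py) size_tab (iotaDl 1 0) -map_comp.
apply/eq_in_map => r; rewrite mem_iota /= => ry.
rewrite nth_tabJ size_trow ?size_iota // add1n add0n.
transitivity [seq (index z (map (cellof y) p)).+1 | z <- [seq (r.+1, c) | c <- iota 1 (count_mem r y)]].
  by rewrite -map_comp.
rewrite row_cells // -Hp.
rewrite size_map.
have -> : iota 1 (size p) = [seq (index k p).+1 | k <- p].
  by rewrite (iotaDl 1 0) -map_index_iota // -map_comp.
rewrite filter_map -!map_comp.
have -> : [seq k <- p | preim (fun k => (index k p).+1) (fun k => nth 0 [seq nth 0 y i | i <- p] k.-1 == r) k]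
   = [seq k <- p | nth 0 y k == r].
  by apply: eq_in_filter => k kp /=; rewrite (nth_map 0) ?index_mem // nth_index.
apply/eq_in_map => k; rewrite mem_filter => /andP[_ kp] /=.
rewrite index_map_in // => a b; rewrite !inE => ap bp; apply: cellof_inj.
  by case/predU1P: ap => [->|]; [apply: pn | exact: pn].
by case/predU1P: bp => [->|]; [apply: pn | exact: pn].
Qed.

Lemma run_tab (bs1 bs2 : seq (seq nat)) b : blocks (bs1 ++ b :: bs2) ->
  run (tab (flatten (bs1 ++ b :: bs2))) (size bs1).+1 =
  map (cellof (flatten (bs1 ++ b :: bs2))) (iota (size (flatten bs1)) (size b)).
Proof.
move=> H; set bs := bs1 ++ _; set y := flatten bs.
have bs0 : bs != [::] by rewrite /bs; case: (bs1).
have Ey : y = flatten bs1 ++ b ++ flatten bs2 by rewrite /y /bs flatten_cat.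
have sy : size y = size (flatten bs1) + (size b + size (flatten bs2)) by rewrite Ey !size_cat.
have s1 : size bs1 < size bs by rewrite /bs size_cat /= addnS ltnS leq_addr.
apply: filter_cells.
- apply: sorted_rdg_cellof; first exact: iota_ltn_sorted.
    by apply/allP => k; rewrite mem_iota sy /=; lia.
  rewrite Ey map_nth_iota_cat.
  by case/andP: H => /allP/(_ b) + _; rewrite mem_cat inE eqxx orbT => /(_ isT)/andP[].
- by apply/allP => k; rewrite mem_iota sy /=; lia.
- move=> k ky; rewrite entry_cellof // /y !(runb_tab H bs0) //=; last exact: ltnW.
  rewrite (take_nth 0) ?size_map // sumn_rcons /bs.
  rewrite /shape map_cat take_size_cat ?size_map // nth_cat size_map ltnn subnn /=.
  by rewrite -/(shape bs1) -size_flatten mem_iota ltnS.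
Qed.

Lemma runs_tab (bs1 bs2 bs3 : seq (seq nat)) : blocks (bs1 ++ bs2 ++ bs3) ->
  flatten [seq run (tab (flatten (bs1 ++ bs2 ++ bs3))) r | r <- iota (size bs1).+1 (size bs2)] =
  map (cellof (flatten (bs1 ++ bs2 ++ bs3))) (iota (size (flatten bs1)) (size (flatten bs2))).
Proof.
elim: bs2 bs1 => [|b bs2 IH] bs1 H //=.
rewrite (run_tab (bs2 := bs2 ++ bs3)) // size_cat iotaD map_cat; congr (_ ++ _).
have := IH (rcons bs1 b); rewrite cat_rcons => /(_ H).
by rewrite size_rcons flatten_rcons size_cat.
Qed.

Section Exchange.

Variables (bs0 bm br : seq (seq nat)) (bI bJ : seq nat) (h k : nat).
Let bs := bs0 ++ bI :: bm ++ bJ :: br.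
Hypothesis bbs : blocks bs.
Hypothesis hI : all (ltn^~ h) bI.
Hypothesis hm : all (leq h) (flatten bm).
Let L := bI ++ [seq x <- bJ | x < h].
Hypothesis sL : sorted geq L.

(** Runs are blocks of consecutive positions, and the exchange reorders positions. Between runs i
    and j no letter is below h, and [L] lists those of runs i and j in order; the letters >= h keep
    their relative order. So equal letters never overtake each other, as [tab_of_cells] requires.
    Since letters count rows from 0, the row bound is [h.+1]. *)
Lemma exchange_tab :
  exchange_runs (tab (flatten bs)) (size bs0).+1 (size bs0 + size bm).+2 h.+1 k =
  tab (flatten bs0 ++ take k L ++ flatten bm ++
       ([seq x <- bJ | h <= x] ++ drop k L) ++ flatten br).
Proof.
set y := flatten bs; pose Y := nth 0 y.
have Ey : y = flatten bs0 ++ bI ++ flatten bm ++ bJ ++ flatten br.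
  by rewrite /y /bs flatten_cat /= flatten_cat.
set o0 := size (flatten bs0); pose o1 := o0 + size bI.
pose o2 := o1 + size (flatten bm); pose o3 := o2 + size bJ.
have sy : size y = o3 + size (flatten br) by rewrite Ey !size_cat /o3 /o2 /o1 -!addnA.
pose pI := iota o0 (size bI); pose pm := iota o1 (size (flatten bm)).
pose pJ := iota o2 (size bJ); pose pr := iota o3 (size (flatten br)).
have E0 : map Y (iota 0 o0) = flatten bs0.
  by have := map_nth_iota_cat [::] (flatten bs0) (bI ++ flatten bm ++ bJ ++ flatten br); rewrite -Ey.
have EI : map Y pI = bI by have := map_nth_iota_cat (flatten bs0) bI (flatten bm ++ bJ ++ flatten br); rewrite -Ey.
have Em : map Y pm = flatten bm.
  by have := map_nth_iota_cat (flatten bs0 ++ bI) (flatten bm) (bJ ++ flatten br); rewrite -catA -Ey size_cat.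
have EJ : map Y pJ = bJ.
  by have := map_nth_iota_cat ((flatten bs0 ++ bI) ++ flatten bm) bJ (flatten br); rewrite -!catA -Ey !size_cat addnA.
have Er : map Y pr = flatten br.
  by have := map_nth_iota_cat (((flatten bs0 ++ bI) ++ flatten bm) ++ bJ) (flatten br) [::];
    rewrite cats0 -!catA -Ey !size_cat !addnA.
have Ei : iota 0 (size y) = iota 0 o0 ++ pI ++ pm ++ pJ ++ pr.
  by rewrite sy iotaD {1}/o3 iotaD {1}/o2 iotaD {1}/o1 iotaD !add0n -!catA.
pose lo := pI ++ [seq p <- pJ | Y p < h]; pose hi := [seq p <- pJ | h <= Y p].
have Elo : map Y lo = L by rewrite /lo map_cat EI -(filter_map Y (ltn^~ h)) EJ.
have Ehi : map Y hi = [seq x <- bJ | h <= x] by rewrite -(filter_map Y (leq h)) EJ.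
have rI : run (tab y) (size bs0).+1 = map (cellof y) pI by exact: run_tab.
have rJ : run (tab y) (size bs0 + size bm).+2 = map (cellof y) pJ.
  have /run_tab : blocks ((bs0 ++ bI :: bm) ++ bJ :: br) by rewrite -catA.
  have -> : size (bs0 ++ bI :: bm) = (size bs0 + size bm).+1 by rewrite size_cat /= addnS.
  have -> : size (flatten (bs0 ++ bI :: bm)) = o2.
    by rewrite flatten_cat size_cat /= size_cat /o2 /o1 addnA.
  by rewrite -catA.
have mI p : (p \in pI) = (o0 <= p < o1) by rewrite mem_iota.
have mJ p : (p \in pJ) = (o2 <= p < o3) by rewrite mem_iota.
have mcell p q : {subset q <= iota 0 (size y)} -> p < size y -> (cellof y p \in map (cellof y) q) = (p \in q).
  move=> qs py; apply/mapP/idP => [[p' pq /cellof_inj E]|pq]; last by exists p.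
  by rewrite E //; have := qs _ pq; rewrite mem_iota.
have sI : {subset pI <= iota 0 (size y)} by move=> p; rewrite Ei !mem_cat => ->; rewrite orbT.
have sJ : {subset pJ <= iota 0 (size y)} by move=> p; rewrite Ei !mem_cat => ->; rewrite !orbT.
have slo : {subset lo <= iota 0 (size y)}.
  by move=> p; rewrite mem_cat mem_filter => /orP[/sI|/andP[_ /sJ]].
have ltlo : sorted ltn lo.
  rewrite (sorted_pairwise ltn_trans) pairwise_cat -!(sorted_pairwise ltn_trans) iota_ltn_sorted.
  rewrite (sorted_filter ltn_trans) ?iota_ltn_sorted // !andbT.
  by apply/allrelP => a b; rewrite mI mem_filter mJ /o2; lia.
have srlo : sorted rdg (map (cellof y) lo).
  apply: sorted_rdg_cellof => //; last by rewrite -/Y Elo.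
  by apply/allP => p /slo; rewrite mem_iota.
have Clo : [seq z <- cells (tab y) | ((z \in run (tab y) (size bs0).+1) || (z \in run (tab y) (size bs0 + size bm).+2)) && (z.1 < h.+1)] = map (cellof y) lo.
  apply: filter_cells => //; first by apply/allP => p /slo; rewrite mem_iota.
  move=> p py; rewrite rI rJ !mcell //= mem_cat mem_filter ltnS -/(Y p).
  case: (boolP (p \in pI)) => [pI'|_] /=; last by rewrite andbC.
  by apply: (allP hI); rewrite -EI; apply: map_f.
have Chi : [seq z <- cells (tab y) | (z \in drop k (map (cellof y) lo)) || ((z \in run (tab y) (size bs0 + size bm).+2) && (h.+1 <= z.1))]
    = map (cellof y) (hi ++ drop k lo).
  have ds : {subset drop k lo <= iota 0 (size y)} by move=> p /mem_drop/slo.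
  apply: filter_cells.
  - rewrite map_cat (sorted_pairwise rdg_trans) pairwise_cat -!(sorted_pairwise rdg_trans).
    apply/and3P; split.
    + apply/allrelP => _ _ /mapP[a ah ->] /mapP[b /mem_drop bl ->]; rewrite /rdg /= ltnS.
      move: ah; rewrite mem_filter => /andP[ah _]; suff bh : Y b < h by rewrite (leq_trans bh ah).
      move: bl; rewrite mem_cat mem_filter => /orP[bI'|/andP[]//].
      by apply: (allP hI); rewrite -EI; apply: map_f.
    + apply: sorted_rdg_cellof.
      * exact: (sorted_filter ltn_trans _ (iota_ltn_sorted _ _)).
      * by apply/allP => p; rewrite mem_filter => /andP[_ /sJ]; rewrite mem_iota.
      * rewrite -/Y Ehi; apply: (sorted_filter geq_transitive).
        case/andP: bbs => /allP/(_ bJ) + _; rewrite !(mem_cat, inE) eqxx !orbT => /(_ isT) /andP[]//.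
    + rewrite map_drop; exact: drop_sorted.
  - apply/allP => p; rewrite mem_cat => /orP[|/ds]; last by rewrite mem_iota.
    by rewrite mem_filter => /andP[_ /sJ]; rewrite mem_iota.
  - move=> p py; rewrite rJ -map_drop !mcell // mem_cat mem_filter /= ltnS -/(Y p).
    by rewrite orbC andbC.
rewrite /exchange_runs Clo Chi -map_take /tableau_of_runs.
set R := fun r => if r == _ then _ else _.
have nrs : nruns (tab y) = size bs0 + (1 + (size bm + (1 + size br))).
  by rewrite /y nruns_tab ?/bs; [rewrite !size_cat /= size_cat|exact: bbs|case: (bs0)].
have R0 a b : (forall r, a <= r < a + b -> r != (size bs0).+1 /\ r != (size bs0 + size bm).+2) ->
    [seq R r | r <- iota a b] = [seq run (tab y) r | r <- iota a b].
  move=> H; apply/eq_in_map => r; rewrite mem_iota => /H[/negbTE r1 /negbTE r2].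
  by rewrite /R r1 r2.
have -> : flatten [seq R r | r <- iota 1 (nruns (tab y))] =
   map (cellof y) (iota 0 o0 ++ take k lo ++ pm ++ (hi ++ drop k lo) ++ pr).
  rewrite nrs !iotaD !map_cat !flatten_cat; congr (_ ++ (_ ++ (_ ++ (_ ++ _)))).
  - rewrite R0; last by lia.
    exact: (@runs_tab [::] bs0 (bI :: bm ++ bJ :: br)).
  - by rewrite /= /R add1n eqxx cats0.
  - rewrite R0; last by lia.
    have /runs_tab : blocks ((bs0 ++ [:: bI]) ++ bm ++ bJ :: br) by rewrite -catA.
    have -> : size (flatten (bs0 ++ [:: bI])) = o1.
      by rewrite flatten_cat size_cat /= cats0.
    rewrite -catA size_cat /= => <-.
    by congr flatten; congr map; congr iota; lia.
  - rewrite /= /R cats0 ifF; last by lia.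
    by rewrite ifT ?map_cat //; lia.
  - rewrite R0; last by lia.
    have /runs_tab : blocks ((bs0 ++ bI :: bm ++ [:: bJ]) ++ br ++ [::]).
      by rewrite cats0 -catA /= -catA.
    have -> : size (flatten (bs0 ++ bI :: bm ++ [:: bJ])) = o3.
      by rewrite flatten_cat size_cat /= flatten_cat !size_cat /= ?cats0 ?addn0 !addnA.
    have -> : size (bs0 ++ bI :: bm ++ [:: bJ]) = (size bs0 + size bm).+2.
      by rewrite size_cat /= size_cat /=; lia.
    rewrite cats0 -catA /= -catA => <-.
    by congr flatten; congr map; congr iota; lia.
rewrite tab_of_cells; last first.
  move=> r; rewrite Ei !filter_cat.
  have flo : [seq p <- take k lo | nth 0 y p == r] ++ [seq p <- drop k lo | nth 0 y p == r] =
       [seq p <- pI | nth 0 y p == r] ++ [seq p <- pJ | (nth 0 y p == r) && (nth 0 y p < h)].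
    by rewrite -filter_cat cat_take_drop filter_cat -filter_predI.
  have [rh|hr] := ltnP r h.
    rewrite (@filter_nil _ _ pm) => [|p pp]; last first.
      have : h <= nth 0 y p by apply: (allP hm); rewrite -Em; apply: map_f.
      by apply: contraTN => /eqP->; rewrite -ltnNge.
    rewrite (@filter_nil _ _ hi) => [|p]; last by rewrite mem_filter /Y; lia.
    rewrite /= [X in _ ++ X]catA flo -catA; congr (_ ++ (_ ++ (_ ++ _))).
    by apply: eq_filter => p; case: eqP => // ->; rewrite rh.
  rewrite [X in _ ++ X = _](_ : _ = [seq p <- pm | nth 0 y p == r] ++ [seq p <- hi | nth 0 y p == r] ++ [seq p <- pr | nth 0 y p == r]); last first.
    rewrite (@filter_nil _ _ (take k lo)) => [|p /mem_take]; last first.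
      rewrite mem_cat mem_filter /Y => /orP[pp|]; last by lia.
      have : nth 0 y p < h by apply: (allP hI); rewrite -EI; apply: map_f.
      lia.
    rewrite (@filter_nil _ _ (drop k lo)) ?cats0 // => p /mem_drop.
    rewrite mem_cat mem_filter /Y => /orP[pp|]; last by lia.
    have : nth 0 y p < h by apply: (allP hI); rewrite -EI; apply: map_f.
    lia.
  rewrite (@filter_nil _ _ pI) => [|p pp]; last first.
    have : nth 0 y p < h by apply: (allP hI); rewrite -EI; apply: map_f.
    lia.
  congr (_ ++ (_ ++ (_ ++ _))); rewrite -filter_predI; apply: eq_filter => p /=.
  by case: eqP => // <- in hr *; rewrite /Y hr.
by rewrite -/Y !map_cat !map_take !map_drop E0 Em Er Ehi Elo.
Qed.

End Exchange.

(** * Initial runs and the bad run *)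

Lemma lat_take y t : lat y -> lat (take t y).
Proof. by move/latP => H; apply/latP => t' r; rewrite -take_min; apply: H. Qed.

Lemma lat_catl y1 y2 : lat (y1 ++ y2) -> lat y1.
Proof. by move/(lat_take (size y1)); rewrite take_size_cat. Qed.

(** The lattice condition on the tail [y] only sees how often each letter occurs before it. *)
Lemma perm_lat_cat w w' y : perm_eq w w' -> lat w' -> lat (w ++ y) -> lat (w' ++ y).
Proof.
rewrite /lat !latw_cat => pw -> /= /andP[_].
by rewrite (@eq_latw _ (fun r => 0 + count_mem r w')) // => r; rewrite (seq.permP pw).
Qed.

Lemma first_runs_tab y r : lat y -> runb (tab y) r <= size y ->
  first_runs (tab y) r = tab (take (runb (tab y) r) y).
Proof.
rewrite /first_runs => ly; move: (runb _ _) => b bn; have lt := lat_take b ly.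
rewrite [tab y]tabE -map_comp.
have Er q : [seq x <- [seq k <- iota 1 (size y) | nth 0 y k.-1 == q] | x <= b] =
    nth [::] (tab (take b y)) q.
  rewrite nth_tab size_takel // -filter_predI.
  have -> : size y = b + (size y - b) by rewrite subnKC.
  rewrite iotaD filter_cat [X in _ ++ X](_ : _ = [::]) ?cats0.
    by apply: eq_in_filter => k; rewrite mem_iota => kb /=; rewrite nth_take; lia.
  apply: filter_nil => k.
  by rewrite mem_iota /=; lia.
rewrite (eq_map (g := nth [::] (tab (take b y)))) //.
have nn : nr (take b y) <= nr y by apply/nr_leqP => x /mem_take/nr_gt.
have -> : nr y = nr (take b y) + (nr y - nr (take b y)) by rewrite subnKC.
rewrite iotaD map_cat filter_cat add0n [X in _ ++ X](_ : _ = [::]) ?cats0.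
  rewrite -{1}(size_tab (take b y)) -/(mkseq _ _) mkseq_nth; apply/all_filterP/allP => s.
  move/(nthP [::])=> [q]; rewrite size_tab => qn <-; rewrite nth_tabJ -size_eq0 size_trow ?size_iota //.
  by rewrite -lt0n -has_count has_pred1 nr_mem.
apply: filter_nil => s /mapP[q]; rewrite mem_iota => /andP[qn _] ->.
by rewrite nth_default ?size_tab.
Qed.

Lemma flatten_take (T : Type) (bs : seq (seq T)) r :
  flatten (take r bs) = take (sumn (take r (shape bs))) (flatten bs).
Proof.
elim: bs r => [|b bs IH] [|r] //=; first by rewrite take0.
by rewrite IH take_cat ifF ?addKn //; apply/negbTE; rewrite -leqNgt leq_addr.
Qed.

Lemma superst_tab bs r : blocks bs -> bs != [::] -> lat (flatten bs) -> r <= size bs ->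
  first_runs_superstandard (tab (flatten bs)) r = sorted leq (flatten (take r bs)).
Proof.
move=> bbs bs0 ly rs; rewrite /first_runs_superstandard first_runs_tab //.
  by rewrite superstandard_tab ?lat_take // runb_tab // flatten_take.
by rewrite runb_tab // size_flatten -[in leqRHS](cat_take_drop r (shape bs)) sumn_cat leq_addr.
Qed.

Lemma sorted_catl (T : Type) (e : rel T) (s1 s2 : seq T) : sorted e (s1 ++ s2) -> sorted e s1.
Proof. by case/cat_sorted2. Qed.

Lemma bad_run_tab bs1 B bs2 : blocks (bs1 ++ B :: bs2) -> lat (flatten (bs1 ++ B :: bs2)) ->
  sorted leq (flatten bs1) -> ~~ sorted leq (flatten bs1 ++ B) ->
  bad_run (tab (flatten (bs1 ++ B :: bs2))) = (size bs1).+1.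
Proof.
move=> bbs ly s1 s2; have bs0 : bs1 ++ B :: bs2 != [::] by case: (bs1).
rewrite /bad_run nruns_tab // size_cat /= iotaD find_cat ifF.
  rewrite /= size_iota superst_tab //; last by rewrite size_cat /= addnS ltnS leq_addr.
  rewrite add1n -cat_rcons take_size_cat ?size_rcons // flatten_rcons s2 addn0 //.
apply/hasP => -[r]; rewrite mem_iota => rs; rewrite superst_tab // ?size_cat; last by lia.
rewrite take_cat; case: ltnP => [r1|r1]; last first.
  have -> : r - size bs1 = 0 by lia.
  by rewrite take0 cats0 s1.
by move: s1; rewrite -{1}(cat_take_drop r bs1) flatten_cat => /sorted_catl ->.
Qed.

(** * Lattice words that are not superstandard *)

Fixpoint Ab (i : nat) (a : seq nat) : seq (seq nat) :=
  if a is x :: a' then nseq x i :: Ab i.+1 a' else [::].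

Lemma flatten_Ab i a : flatten (Ab i a) = Jwo i a.
Proof. by elim: a i => //= x a IH i; rewrite IH. Qed.

Lemma size_Ab i a : size (Ab i a) = size a.
Proof. by elim: a i => //= x a IH i; rewrite IH. Qed.

Lemma shape_Ab i a : shape (Ab i a) = a.
Proof. by elim: a i => //= x a IH i; rewrite -/(shape _) IH size_nseq. Qed.

Lemma Ab_cat i a a' : Ab i (a ++ a') = Ab i a ++ Ab (i + size a) a'.
Proof. by elim: a i => [|x a IH] i /=; rewrite ?addn0 // IH addSnnS. Qed.

Lemma sorted_geq_nseq x i : sorted geq (nseq x i).
Proof. by case: x => //= x; elim: x => //= x ->; rewrite leqnn. Qed.

Lemma blocks_cons2 b b' bs : blocks [:: b, b' & bs] =
  [&& b != [::], sorted geq b, last 0 b < head 0 b' & blocks (b' :: bs)].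
Proof.
rewrite /blocks /=; case: (b != [::]); case: (sorted geq b) => //=.
by case: (last 0 b < _); rewrite ?andbF.
Qed.

Lemma blocks_Ab i a B rs : blocks (Ab i a ++ B :: rs) =
  [&& 0 \notin a, (a == [::]) || ((i + size a).-1 < head 0 B) & blocks (B :: rs)].
Proof.
elim: a i => [|x a IH] i //=; rewrite inE negb_or.
have nx : (nseq x i != [::]) = (0 != x) by case: x.
have lx : 0 != x -> last 0 (nseq x i) = i by case: (x) => //= n _; elim: n.
case: a IH => [|x' a] IH.
  rewrite [Ab _ _ ++ _]/= blocks_cons2 nx sorted_geq_nseq [size _]/= addn1 /=.
  by case: (boolP (0 != x)) => //= /lx ->.
rewrite [Ab _ _ ++ _]/= blocks_cons2 -[nseq x' i.+1 :: _]/(Ab i.+1 (x' :: a) ++ B :: rs).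
rewrite IH nx sorted_geq_nseq inE negb_or.
case: (boolP (0 != x)) => //= /lx ->; case: x' {IH} => [|x'] //=.
by rewrite ltnSn !addnS.
Qed.

Lemma count_or (T : Type) (p q q' : pred T) (s : seq T) :
  (forall x, (p x : nat) = q x + q' x) -> count p s = count q s + count q' s.
Proof. by move=> H; elim: s => //= x s ->; rewrite H; lia. Qed.

(* The runs before the bad one form the superstandard tableau of shape [a]; [B] is the bad run and [rs] are the later ones. *)
Definition NF (a B : seq nat) (rs : seq (seq nat)) : Prop :=
  [/\ blocks (Ab 0 a ++ B :: rs), lat (Jw a ++ B ++ flatten rs) &
      has (ltn^~ (size a)) B].

Definition wordNF (a B : seq nat) (rs : seq (seq nat)) : seq nat :=
  Jw a ++ B ++ flatten rs.

Lemma flatten_wordNF a B rs : flatten (Ab 0 a ++ B :: rs) = wordNF a B rs.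
Proof. by rewrite flatten_cat flatten_Ab. Qed.

(** A letter x > 0 needs an earlier x-1, and [Jw a] only has letters below [size a]. *)
Lemma lat_head_le a x s : lat (Jw a ++ x :: s) -> x <= size a.
Proof.
move/latP => H; case: x H => // x H.
have := H (size (Jw a)).+1 x; rewrite take_cat ltnNge leqnSn /= subSnn /= take0.
rewrite !count_cat /= eqxx => H'; rewrite -[_ < _]/(x < size a).
apply: (@mem_Jw a); rewrite -has_pred1 has_count.
by move: H'; rewrite /= (gtn_eqF (ltnSn x)); lia.
Qed.

Section NFTheory.

Variables (a B : seq nat) (rs : seq (seq nat)).
Hypothesis nf : NF a B rs.

Lemma NF_sorted : sorted geq B.
Proof.
case: nf => bb _ _; move: bb; rewrite blocks_Ab => /and3P[_ _ /blocks_cons[]] //.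
Qed.

Lemma NF_pos : 0 \notin a.
Proof. by case: nf => bb _ _; move: bb; rewrite blocks_Ab => /and3P[]. Qed.

Lemma NF_a_gt0 : 0 < size a.
Proof. by case: nf => _ _ /hasP[x _ /=]; case: (size a). Qed.

(** Maximality of the runs makes the first letter of [B] exceed the last row of [a], and the lattice
    condition lets it open at most one new row. *)
Lemma NF_head : exists B', B = size a :: B'.
Proof.
case: nf => bb lB hB; move: bb; rewrite blocks_Ab => /and3P[_ + _].
case: B hB lB => //= x B' _ /lat_head_le xa.
rewrite -size_eq0 add0n => H; exists B'; congr (_ :: _).
by have := NF_a_gt0; move: H; rewrite /=; lia.
Qed.

Lemma NF_le : all (leq^~ (size a)) B.
Proof.
have := NF_sorted; case: NF_head => B' -> /=.
by rewrite (path_sortedE geq_transitive) leqnn => /andP[].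
Qed.

Lemma NF_interlace r : nth 0 a r.+1 + count_mem r.+1 B <= nth 0 a r.
Proof.
case: nf => _ + _; rewrite catA => /lat_catl lB.
have := lB; rewrite /lat latw_cat => /andP[la].
move/latw_blockP => H; rewrite -!count_Jw; apply: H => //; last exact: NF_sorted.
by move=> q; apply: lat_count.
Qed.

(** The inequalities [NF_interlace], summed over all rows from r upwards, telescope. *)
Lemma NF_tele r : count (ltn r) B <= nth 0 a r.
Proof.
have [d E] : exists d, size a <= r + d by exists (size a); rewrite leq_addl.
elim: d r E => [|d IH] r E.
  by rewrite addn0 in E; rewrite count_nil // => x /(allP NF_le) /= xa; lia.
apply: leq_trans (NF_interlace r).
have -> : count (ltn r) B = count_mem r.+1 B + count (ltn r.+1) B.
  by apply: count_or => x /=; lia.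
by rewrite addnC leq_add2r IH // addSnnS.
Qed.

End NFTheory.

Lemma blocks_exist y : exists bs, blocks bs /\ flatten bs = y.
Proof.
elim: y => [|x y [bs [bb <-]]]; first by exists [::].
case: bs bb => [|b bs] bb; first by exists [:: [:: x]].
have [b0 sb bb'] := blocks_cons bb.
have [xb|bx] := leqP (head 0 b) x.
  exists ((x :: b) :: bs); split=> //; case: b b0 sb bb xb => // z b _ sb.
  case: bs {bb'} => [|b' bs]; first by rewrite /blocks /= => /andP[/andP[-> _] _] ->.
  by rewrite !blocks_cons2 /= => /and3P[-> -> ->] ->.
by exists ([:: x] :: b :: bs); split=> //; rewrite blocks_cons2 /= bx.
Qed.

Lemma first_unsorted (bs : seq (seq nat)) : ~~ sorted leq (flatten bs) ->
  exists bs1 B bs2, [/\ bs = bs1 ++ B :: bs2, sorted leq (flatten bs1) &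
                        ~~ sorted leq (flatten bs1 ++ B)].
Proof.
elim/last_ind: bs => // bs b IH; rewrite flatten_rcons => H.
have [s1|/IH[bs1 [B [bs2 [-> s1 s2]]]]] := boolP (sorted leq (flatten bs)).
  by exists bs, b, [::]; rewrite -cats1.
by exists bs1, B, (rcons bs2 b); rewrite rcons_cat.
Qed.

Lemma blocks_catl bs1 bs2 : blocks (bs1 ++ bs2) -> blocks bs1.
Proof. by rewrite /blocks all_cat => /andP[/andP[-> _] /cat_sorted2[->]]. Qed.

(** In a sorted word a weakly decreasing block is constant; by maximality and the lattice condition
    each block opens exactly the next row. *)
Lemma sorted_blocks bs : blocks bs -> lat (flatten bs) -> sorted leq (flatten bs) ->
  bs = Ab 0 (shape bs).
Proof.
elim/last_ind: bs => // bs b IH; rewrite flatten_rcons -cats1 => bb lb sb.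
have {}IH := IH (blocks_catl bb) (lat_catl lb) (cat_sorted2 sb).1.
rewrite [shape _]map_cat -/(shape bs) Ab_cat -IH /= add0n; congr (_ ++ [:: _]).
move: bb lb sb; rewrite IH; rewrite [shape (Ab _ _)]shape_Ab flatten_Ab; move: (shape bs) => a.
rewrite blocks_Ab add0n /= => /and3P[_ ha /blocks_cons[b0 gb _]] lb /cat_sorted2[_ sb].
apply/all_pred1P; case: b b0 ha gb lb sb => // x b _ /= ha gb lb sb.
have xa := lat_head_le lb.
have -> : size a = x by move: ha xa; case: (a) => [|? ?] /=; lia.
rewrite eqxx /=; apply/allP => z zb.
move: gb sb; rewrite (path_sortedE geq_transitive) (path_sortedE leq_trans).
move=> /andP[/allP/(_ _ zb) + _] /andP[/allP/(_ _ zb) + _] /=; lia.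
Qed.

Lemma NF_exists y : lat y -> ~~ sorted leq y ->
  exists a B rs, NF a B rs /\ y = wordNF a B rs.
Proof.
move=> ly; have [bs [bb E]] := blocks_exist y; rewrite -E => /first_unsorted.
case=> [bs1 [B [rs [Ebs s1 s2]]]]; move: bb ly; rewrite -E Ebs => bb ly.
have l1 : lat (flatten bs1) by move: ly; rewrite flatten_cat => /lat_catl.
have E1 := sorted_blocks (blocks_catl bb) l1 s1.
exists (shape bs1), B, rs; split; last by rewrite -flatten_wordNF -E1.
split; rewrite -?flatten_Ab -?E1 //; first by rewrite flatten_cat in ly.
(* Without a cell below its own row, the bad run would be constant and would continue the
   superstandard tableau. *)
rewrite size_map; apply: contraNT s2 => /hasPn hB.
move: bb; rewrite E1 blocks_Ab => /and3P[_ _ /blocks_cons[b0 gb _]].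
have lB : lat (Jw (shape bs1) ++ B).
  by move: ly; rewrite flatten_cat {1}E1 flatten_Ab /= catA => /lat_catl.
rewrite {1}E1 flatten_Ab; case: B b0 gb hB lB {ly Ebs} => // x B _ gb hB /lat_head_le.
rewrite size_map => xs; have -> : x :: B = nseq (size B).+1 (size bs1).
  apply/all_pred1P/allP => z zB /=; have /= := hB _ zB; rewrite -leqNgt => zs.
  suff zx : z <= x by rewrite eqn_leq zs (leq_trans zx xs).
  move: zB gb; rewrite inE => /predU1P[-> //|zB] /=.
  by rewrite (path_sortedE geq_transitive) => /andP[/allP/(_ _ zB)].
have := sorted_Jwo 0 (shape bs1 ++ [:: (size B).+1]).
by rewrite Jwo_cat size_map add0n; move: (size B).+1 => m; rewrite /= cats0 -E1.
Qed.

Definition mu (a B : seq nat) (r : nat) : nat := nth 0 a r + count_mem r B.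

(* [I.+1] is the index i in the definition of [slink_star]. *)
Definition isI (a B : seq nat) (I : nat) : Prop :=
  [/\ I < size a, mu a B I.+1 + size a <= size B + I &
      forall I0, I0 < I -> size B + I0 < mu a B I0.+1 + size a].

Section Exch.

Variables (a B : seq nat) (rs : seq (seq nat)).
Hypothesis nf : NF a B rs.

Lemma count_lt_size : count_mem (size a) B < size B.
Proof.
case: nf => _ _ hB; rewrite -(count_predC (pred1 (size a)) B) -[ltnLHS]addn0 ltn_add2l.
rewrite -has_count; apply: sub_has hB => x /=; lia.
Qed.

Lemma isI_exists : exists I, isI a B I.
Proof.
have a0 := NF_a_gt0 nf.
pose P I := (I < size a) && (mu a B I.+1 + size a <= size B + I).
have exP : exists I, P I.
  (* i = j - 1 always qualifies, since row j of mu has fewer than beta_j cells. *)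
  exists (size a).-1; rewrite /P prednK // leqnn /= /mu nth_default //.
  by have := count_lt_size; lia.
exists (ex_minn exP); case: ex_minnP => I /andP[Ia Ic] mI; split=> // I0 I0I.
rewrite ltnNge; apply/negP => c0; suff : I <= I0 by lia.
by apply: mI; rewrite /P c0 andbT; lia.
Qed.

Lemma mu_le r : mu a B r.+1 <= nth 0 a r.
Proof. exact: (NF_interlace nf). Qed.

Lemma size_B_le : size B <= mu a B 0.
Proof.
have -> : size B = count_mem 0 B + count (ltn 0) B.
  by rewrite -[LHS]count_predT; apply: count_or => -[].
by rewrite /mu addnC leq_add2r (NF_tele nf).
Qed.

Lemma nth_a_le i j : i <= j -> nth 0 a j <= nth 0 a i.
Proof.
elim: j => [|j IH]; first by rewrite leqn0 => /eqP ->.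
rewrite leq_eqVlt => /predU1P[-> //|ij]; apply: leq_trans (IH ij).
by apply: leq_trans (mu_le j); apply: leq_addr.
Qed.

Variable I : nat.
Hypothesis iI : isI a B I.

Let k := size B + I - size a.

Lemma isI_k : k + size a = size B + I.
Proof. by case: iI => _ ? _; rewrite /k; lia. Qed.

Lemma isI_k_ge : mu a B I.+1 <= k.
Proof. by case: iI => _ ? _; rewrite /k; lia. Qed.

(** This is the minimality of I, read at I - 1. For I = 0 there is no predecessor, and [size_B_le],
    that is beta_j <= mu_1, takes its place. *)
Lemma isI_k_le : k <= mu a B I.
Proof.
rewrite /k; case: iI => Ia _; case: I Ia => [|I'] Ia.
  by move=> _; have := size_B_le; lia.
by move/(_ I' (ltnSn _)); lia.
Qed.

Lemma isI_mu_gt0 : 0 < mu a B I.+1.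
Proof.
case: iI => Ia _ _; have [IJ|] := eqVneq I.+1 (size a).
  rewrite IJ /mu addn_gt0 orbC -has_count has_pred1.
  by have [B' ->] := NF_head nf; rewrite mem_head.
move=> IJ; rewrite /mu addn_gt0 lt0n; apply/orP; left.
by apply: contraNneq (NF_pos nf) => <-; apply: mem_nth; rewrite ltn_neqAle IJ Ia.
Qed.

End Exch.

Lemma sorted_L (x I : nat) (B : seq nat) : sorted geq B ->
  sorted geq (nseq x I ++ [seq z <- B | z < I.+1]).
Proof.
move=> gB; rewrite sorted_geq_cat.
rewrite sorted_geq_nseq (sorted_filter geq_transitive) // !andbT.
by apply/allrelP => u v /nseqP[-> _]; rewrite mem_filter ltnS => /andP[].
Qed.

(** Preserves the rise from run j to the next run. If [B] has a letter <= I, both lists end with the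
    same one; otherwise the left list ends with I, below every letter of [B]. *)
Lemma last_L (x I : nat) (B : seq nat) : sorted geq B -> B != [::] -> 0 < x ->
  last 0 (nseq x I ++ [seq z <- B | z < I.+1]) <= last 0 B.
Proof.
move=> gB B0 x0; rewrite last_cat.
have E : last 0 B = last (last 0 [seq z <- B | I < z]) [seq z <- B | z < I.+1].
  by rewrite {1}(geq_split I gB) last_cat.
case Elo : [seq z <- B | z < I.+1] => [|z s] /=; last by rewrite E Elo.
have -> : last 0 (nseq x I) = I by case: (x) x0 => //= n _; elim: n.
have EB : B = [seq z <- B | I < z] by rewrite {1}(geq_split I gB) [X in _ ++ X]Elo cats0.
apply: ltnW; have : all (ltn I) B by rewrite EB filter_all.
by case: (B) B0 => // z s _ /allP; apply; apply: mem_last.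
Qed.

(* The run j of [slink_star]; [x] and [k] are the old and the new length of run i = [I.+1], all of whose cells are in row i. *)
Definition starB (I x k : nat) (B : seq nat) : seq nat :=
  [seq z <- B | I < z] ++ drop k (nseq x I ++ [seq z <- B | z < I.+1]).

Lemma filter_ltnS (I : nat) (B : seq nat) : sorted geq B ->
  [seq z <- B | z < I.+1] = nseq (count_mem I B) I ++ [seq z <- B | z < I].
Proof.
move=> gB; rewrite [LHS](@sorted_split _ geq (leq I)).
- congr (_ ++ _); rewrite -filter_predI; last by apply: eq_filter => z /=; lia.
  rewrite -(@eq_filter _ (pred1 I)); last by move=> z /=; lia.
  by rewrite -size_filter; apply/all_pred1P; apply: filter_all.
- exact: geq_transitive.
- by move=> u v /= vu Iv; apply: leq_trans Iv vu.
- exact: (sorted_filter geq_transitive).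
Qed.

Lemma take_starL (I x k : nat) (B : seq nat) : sorted geq B -> k <= x + count_mem I B ->
  take k (nseq x I ++ [seq z <- B | z < I.+1]) = nseq k I.
Proof.
move=> gB kx; rewrite (filter_ltnS _ gB).
rewrite catA -nseqD take_cat size_nseq; case: ltnP => kx'; first by rewrite take_nseq // ltnW.
have -> : k = x + count_mem I B by lia.
by rewrite subnn take0 cats0.
Qed.

(** By [take_starL] the k letters cut off the lower list all equal I, so putting k letters I back in
    front restores that list. *)
Lemma starB_inv (I x k : nat) (B : seq nat) : sorted geq B -> k <= x + count_mem I B ->
  starB I k x (starB I x k B) = B.
Proof.
move=> gB kx; have T := take_starL gB kx; rewrite /starB; set L := nseq x I ++ _ in T *.
have aL : all (leq^~ I) L.
  rewrite all_cat; apply/andP; split; first by apply/allP => z /nseqP[->]; rewrite /= leqnn.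
  by apply/allP => z; rewrite mem_filter ltnS => /andP[].
rewrite !filter_cat -!filter_predI.
have -> : [seq z <- drop k L | I < z] = [::].
  apply: filter_nil => z /mem_drop/(allP aL) /=; lia.
have -> : [seq z <- drop k L | z < I.+1] = drop k L.
  by apply/all_filterP/allP => z /mem_drop/(allP aL).
rewrite cats0 (eq_filter (a2 := ltn I)) => [|z /=]; last by rewrite andbb.
rewrite [X in X ++ drop k L](_ : _ = [::]); last first.
  by rewrite -(filter_pred0 B); apply: eq_filter => z /=; lia.
rewrite -T /= cat_take_drop drop_size_cat ?size_nseq //.
by rewrite [RHS](geq_split I gB); congr (_ ++ _).
Qed.

Lemma sorted_starB (I x k : nat) (B : seq nat) : sorted geq B -> sorted geq (starB I x k B).
Proof.
move=> gB; rewrite sorted_geq_cat.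
rewrite (sorted_filter geq_transitive) // (drop_sorted _ (sorted_L _ _ gB)) !andbT.
apply/allrelP => u v; rewrite mem_filter => /andP[uI _] /mem_drop; rewrite mem_cat => /orP[/nseqP[-> _]|].
  exact: ltnW.
by rewrite mem_filter ltnS => /andP[vI _]; exact: leq_trans vI (ltnW uI).
Qed.

Lemma perm_starB (I x k : nat) (B : seq nat) : sorted geq B -> k <= x + count_mem I B ->
  perm_eq (nseq k I ++ starB I x k B) (nseq x I ++ B).
Proof.
move=> gB kx; rewrite -(take_starL gB kx) /starB perm_catCA cat_take_drop.
rewrite perm_catCA perm_cat2l [X in perm_eq _ X](geq_split I gB).
by rewrite perm_refl.
Qed.

Lemma last_blocks B B' rs : blocks (B :: rs) -> B' != [::] -> sorted geq B' ->
  last 0 B' <= last 0 B -> blocks (B' :: rs).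
Proof.
case: rs => [|b rs] H B0 gB lB; first by rewrite /blocks /= B0 gB.
move: H; rewrite !blocks_cons2 B0 gB => /and4P[_ _ /(leq_ltn_trans lB) -> ->] //.
Qed.

Lemma lat_interlace a B : sorted geq a -> sorted geq B ->
  (forall r, nth 0 a r.+1 + count_mem r.+1 B <= nth 0 a r) -> lat (Jw a ++ B).
Proof.
move=> ga gB H; rewrite /lat latw_cat -/(lat _) latw_leq_Jwo //=.
have cP r : 0 + count_mem r.+1 (Jw a) <= 0 + count_mem r (Jw a).
  by rewrite !count_Jw; apply: leq_trans (H r); apply: leq_addr.
by apply/(latw_blockP cP gB) => r; rewrite !count_Jw; apply: H.
Qed.

Lemma find_iota1 (p : pred nat) I N : I < N -> p I.+1 ->
  (forall I0, I0 < I -> ~~ p I0.+1) -> find p (iota 1 N) = I.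
Proof.
move=> IN pI H; have -> : N = I + (N - I).-1.+1 by lia.
rewrite iotaD find_cat ifF ?size_iota /= ?add1n ?pI ?addn0 //.
by apply/hasP => -[[|i]]; rewrite mem_iota => iI //; apply/negP; apply: H; lia.
Qed.

Section NFRuns.

Variables (a B : seq nat) (rs : seq (seq nat)).
Hypothesis nf : NF a B rs.
Let T := tab (wordNF a B rs).

Lemma lat_wordNF : lat (wordNF a B rs).
Proof. by case: nf. Qed.

Lemma NF_unsorted : ~~ sorted leq (Jw a ++ B).
Proof.
apply/negP => /cat_sorted2[_]; case: nf => _ _; have [B' ->] := NF_head nf.
rewrite /= ltnn /= (path_sortedE leq_trans) => /hasP[z zB /= za] /andP[/allP/(_ _ zB)].
by rewrite leqNgt za.
Qed.

Lemma NF_wordNF_unsorted : ~~ sorted leq (wordNF a B rs).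
Proof. by apply: contra NF_unsorted; rewrite /wordNF catA => /cat_sorted2[]. Qed.

Lemma bad_run_NF : bad_run T = (size a).+1.
Proof.
rewrite /T -flatten_wordNF -(size_Ab 0 a); case: nf => bb lB _; apply: bad_run_tab => //.
- by rewrite flatten_wordNF.
- by rewrite flatten_Ab sorted_Jwo.
- by rewrite flatten_Ab NF_unsorted.
Qed.

Let bs0 : Ab 0 a ++ B :: rs != [::].
Proof. by case: (Ab 0 a). Qed.

Lemma nruns_NF : nruns T = (size a + size rs).+1.
Proof.
rewrite /T -flatten_wordNF nruns_tab //; last by case: nf.
by rewrite size_cat size_Ab /= addnS.
Qed.

Lemma bad_le_nruns : (bad_run T <= nruns T).
Proof. by rewrite bad_run_NF nruns_NF ltnS leq_addr. Qed.

Lemma beta_NF : beta T (size a).+1 = size B.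
Proof.
rewrite /T -flatten_wordNF beta_tab //; last by rewrite size_cat size_Ab /= addnS ltnS leq_addr.
  by rewrite /shape map_cat nth_cat size_map size_Ab ltnn subnn.
by case: nf.
Qed.

Lemma runb_NF : runb T (size a).+1 = size (Jw a ++ B).
Proof.
rewrite /T -flatten_wordNF runb_tab //; last by rewrite size_cat size_Ab /= addnS ltnS leq_addr.
  by rewrite /shape map_cat -/(shape _) shape_Ab take_cat ltnNge leqnSn /= subSnn /= take0 sumn_cat size_cat size_Jwo /= addn0.
by case: nf.
Qed.

Lemma mu_NF i : nth 0 (shape (first_runs T (size a).+1)) i = mu a B i.
Proof.
rewrite first_runs_tab ?lat_wordNF //; last by rewrite runb_NF /wordNF catA !size_cat leq_addr.
rewrite runb_NF.
by rewrite nth_shape_tab /wordNF catA take_size_cat // count_cat count_Jw.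
Qed.

End NFRuns.

(** * The map slink_star on words *)

Section SlinkStar.

Variables (a0 : seq nat) (x : nat) (a1 B : seq nat) (rs : seq (seq nat)).
Let a := a0 ++ x :: a1.
Let I := size a0.
Hypothesis nf : NF a B rs.
Hypothesis iI : isI a B I.
Let k := size B + I - size a.
Let a' := a0 ++ k :: a1.
Let B' := starB I x k B.

Let aI : nth 0 a I = x.
Proof. by rewrite /a nth_cat ltnn subnn. Qed.

Let sa : size a' = size a.
Proof. by rewrite /a /a' !size_cat. Qed.

Let na' r : r != I -> nth 0 a' r = nth 0 a r.
Proof.
move=> rI; rewrite /a /a' !nth_cat; case: ltnP => // Ir.
by rewrite -[r - _]prednK // subn_gt0 ltn_neqAle eq_sym rI.
Qed.

Let aI' : nth 0 a' I = k.
Proof. by rewrite /a' nth_cat ltnn subnn. Qed.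

Let kx : k <= x + count_mem I B.
Proof. by have := isI_k_le nf iI; rewrite /mu aI. Qed.

Lemma perm_star : perm_eq (Jw a' ++ B') (Jw a ++ B).
Proof.
rewrite /a /a' !Jwo_cat -!catA perm_cat2l /= !add0n -/I.
rewrite perm_catCA perm_sym perm_catCA perm_cat2l perm_sym.
by rewrite perm_starB ?(NF_sorted nf).
Qed.

Let cnt' r : nth 0 a' r + count_mem r B' = mu a B r.
Proof. by rewrite -count_Jw -count_cat (seq.permP perm_star) count_cat count_Jw. Qed.

Lemma mu_star r : mu a' B' r = mu a B r.
Proof. exact: cnt'. Qed.

Let gB := NF_sorted nf.

(** mu and the parts of [a] other than the one at I are unchanged, and there [isI_k_ge] makes the
    new part [k] large enough. *)
Lemma interlace_star r : nth 0 a' r.+1 + count_mem r.+1 B' <= nth 0 a' r.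
Proof.
rewrite cnt'; have [->|rI] := eqVneq r I; first by rewrite aI'; apply: isI_k_ge.
by rewrite na' //; apply: mu_le nf _.
Qed.

(** Together with [isI_k] this says that runs i and j exchange their values of length minus index,
    which is the exchange of two rows of the Jacobi-Trudi matrix. *)
Lemma size_star : size B' + I = x + size a.
Proof.
have := perm_size perm_star; have := isI_k iI; rewrite -/k (size_cat (Jw a')) (size_cat (Jw a)) !size_Jwo.
have -> : sumn a' = sumn a0 + (k + sumn a1) by rewrite sumn_cat.
have -> : sumn a = sumn a0 + (x + sumn a1) by rewrite sumn_cat.
lia.
Qed.

Let IJ : I < size a.
Proof. by case: iI. Qed.

Let x_gt0 : 0 < x.
Proof.
rewrite lt0n; apply: contraNneq (NF_pos nf) => x0.
by rewrite /a x0 mem_cat mem_head orbT.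
Qed.

Let L := nseq x I ++ [seq z <- B | z < I.+1].

(** Some cell below row j is left for the new run j, which therefore stays bad: [k] is smaller than
    beta_j, and [NF_tele] bounds the number of letters of [B] above I by x. *)
Let dropL : drop k L != [::].
Proof.
have t := NF_tele nf I; rewrite aI in t; have := isI_k iI; rewrite -/k => ek.
have sL : size L = x + count (fun z => z < I.+1) B by rewrite size_cat size_nseq size_filter.
have cB : size B = count (fun z => z < I.+1) B + count (ltn I) B.
  by rewrite -[LHS]count_predT; apply: count_or => z /=; lia.
have : 0 < size (drop k L) by rewrite size_drop sL; lia.
by case: (drop k L).
Qed.

Let L_le z : z \in L -> z <= I.
Proof. by rewrite mem_cat mem_filter => /orP[/nseqP[->//]|/andP[]]. Qed.

Lemma last_star : last 0 B' <= last 0 B.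
Proof.
have -> : last 0 B' = last 0 L.
  rewrite /B' /starB last_cat -/L -[in RHS](cat_take_drop k L) last_cat.
  by case: (drop k L) dropL.
by apply: last_L => //; have [B1 ->] := NF_head nf.
Qed.

Lemma NF_star : NF a' B' rs.
Proof.
have lJ : lat (Jw a' ++ B').
  apply: lat_interlace; last exact: interlace_star.
    apply/(sortedP 0) => i _; apply: leq_trans (interlace_star i); exact: leq_addr.
  exact: sorted_starB.
have hB : B' != [::] by rewrite /B' /starB; case: (drop _ _) dropL => // z s; case: (filter _ _).
split.
- rewrite blocks_Ab; case: nf; rewrite blocks_Ab => /and3P[na _ bb] _ _.
  apply/and3P; split; first 1 last.
  + apply/orP; right; rewrite sa; have [B1 EB] := NF_head nf.
    by rewrite /B' /starB {1}EB /= IJ /=; lia.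
  + exact: last_blocks bb hB (sorted_starB _ _ _ gB) last_star.
  + move: na; rewrite /a /a' !mem_cat !inE !negb_or => /and3P[-> _ ->]; rewrite andbT /= eq_sym -lt0n.
    exact: leq_trans (isI_mu_gt0 nf iI) (isI_k_ge iI).
- rewrite catA; apply: (@perm_lat_cat (Jw a ++ B)) => //; first by rewrite perm_sym perm_star.
  by rewrite -catA; case: nf.
- rewrite sa /B' /starB has_cat; apply/orP; right; rewrite -/L.
  case E : (drop k L) dropL => [//|z s] _; apply/hasP; exists z; first exact: mem_head.
  have : z \in L by apply: (mem_drop (n0 := k)); rewrite E mem_head.
  by move/L_le => zI /=; apply: leq_ltn_trans zI IJ.
Qed.

(** The new run j has length x + j - i, so the inequality at i reads mu_(i+1) <= x, which is
    interlacing. The strict inequalities before it hold because mu is at least [a], whose parts up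
    to i are at least x. *)
Lemma isI_star : isI a' B' I.
Proof.
split; rewrite ?sa //; first by rewrite mu_star size_star leq_add2r -aI (mu_le nf).
move=> I0 I0I; rewrite mu_star; have := size_star; have := nth_a_le nf I0I; rewrite aI.
by rewrite /mu; lia.
Qed.

Lemma star_inv : starB I k (size B' + I - size a') B' = B /\ size B' + I - size a' = x.
Proof.
have -> : size B' + I - size a' = x by rewrite sa size_star addnK.
by split=> //; apply: starB_inv.
Qed.

Lemma slink_star_NF : slink_star (tab (wordNF a B rs)) = tab (wordNF a' B' rs).
Proof.
rewrite /slink_star bad_le_nruns // bad_run_NF // beta_NF //.
case: (iI) => _ I1 I2.
rewrite (@find_iota1 _ I); last first.
- by move=> I0 /I2; rewrite mu_NF //; lia.
- by rewrite mu_NF //; lia.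
- by rewrite ltnS ltnW.
have bb : blocks (Ab 0 a0 ++ nseq x I :: Ab I.+1 a1 ++ B :: rs).
  by case: nf; rewrite /a Ab_cat -catA.
have := @exchange_tab (Ab 0 a0) (Ab I.+1 a1) rs (nseq x I) B I.+1 k bb.
have -> : flatten (Ab 0 a0 ++ nseq x I :: Ab I.+1 a1 ++ B :: rs) = wordNF a B rs.
  by rewrite -flatten_wordNF /a Ab_cat -catA.
rewrite !size_Ab !flatten_Ab -/I.
have -> : (I + size a1).+2 = (size a).+1 by rewrite /a size_cat /= addnS.
have -> : size B + I.+1 - (size a).+1 = k by rewrite addnS subSS.
move=> ->.
- rewrite take_starL // /wordNF /a' Jwo_cat /= -!catA; congr (tab (_ ++ (_ ++ (_ ++ _)))).
- by apply/allP => z /nseqP[-> _]; exact: ltnSn.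
- by apply/allP => z /(allP (Jwo_ge _ _)).
- exact: sorted_L.
Qed.

End SlinkStar.

(** * Elementary dual equivalences on words *)

Lemma swap_tab (A C : seq nat) (u v : nat) : u != v ->
  [seq [seq swap_values (size A).+1 (size A).+2 k | k <- s] | s <- tab (A ++ [:: u, v & C])] =
  tab (A ++ [:: v, u & C]).
Proof.
move=> uv; have pp : perm_eq (A ++ [:: u, v & C]) (A ++ [:: v, u & C]).
  by rewrite perm_cat2l -[_ :: _ :: C]/([:: u] ++ [:: v] ++ C) perm_catCA.
rewrite !tabE (perm_nr pp) (perm_size pp) -map_comp; apply/eq_map => r /=.
rewrite size_cat /=; have -> : size A + (size C).+2 = size A + (2 + size C) by lia.
rewrite !iotaD !filter_cat !map_cat; congr (_ ++ _).
  rewrite -[RHS]map_id; have -> : [seq k <- iota 1 (size A) | nth 0 (A ++ [:: u, v & C]) k.-1 == r] =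
    [seq k <- iota 1 (size A) | nth 0 (A ++ [:: v, u & C]) k.-1 == r].
    by apply: eq_in_filter => k; rewrite mem_iota => kA; rewrite !nth_cat; case: ltnP => //; lia.
  apply/eq_in_map => k; rewrite mem_filter mem_iota /swap_values => /andP[_ kA].
  by rewrite !ifF //; lia.
congr (_ ++ _).
  rewrite /= !nth_cat add1n /= ltnn subnn ltnNge leqnSn /= subSnn /=.
  case: (eqVneq u r) => [ur|_]; case: (eqVneq v r) => [vr|_] //=.
  - by move: uv; rewrite ur vr eqxx.
  - by rewrite /swap_values eqxx.
  - by rewrite /swap_values eqxx ifF //; lia.
rewrite -[RHS]map_id; have -> : [seq k <- iota (1 + size A + 2) (size C) | nth 0 (A ++ [:: u, v & C]) k.-1 == r] =
    [seq k <- iota (1 + size A + 2) (size C) | nth 0 (A ++ [:: v, u & C]) k.-1 == r].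
  apply: eq_in_filter => k; rewrite mem_iota => kA; rewrite !nth_cat !ifF; try lia.
  by have -> : k.-1 - size A = (k - (1 + size A + 2)).+2 by lia.
apply/eq_in_map => k; rewrite mem_filter mem_iota /swap_values => /andP[_ kA].
by rewrite !ifF //; lia.
Qed.

Section Moves.

Variables (A Z : seq nat) (J l1 l2 m : nat).

Let nthA n s : nth 0 (A ++ s) (size A + n) = nth 0 s n.
Proof. by rewrite nth_cat ltnNge leq_addr /= addKn. Qed.

Let eqs : ((size A).+1 = size A + 1) * ((size A).+2 = size A + 2) * ((size A).+3 = size A + 3).
Proof. by rewrite addn1 addn2 addn3. Qed.

(** The entries i - 1, i, i + 1 are those of l1, J, l2, and i - 1 is the middle one in reading
    order. The extra letter m <= J makes i at most n - 2 and keeps i + 1 out of ID after the move,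
    so that d_i^R acts as d_i. *)
Lemma de_step1 : l2 <= l1 < J -> m <= J ->
  lat (A ++ [:: l1, J, l2, m & Z]) -> 
  tab_step (size (A ++ [:: l1, J, l2, m & Z])) 2
    (tab (A ++ [:: l1, J, l2, m & Z])) (tab (A ++ [:: l1, l2, J, m & Z])).
Proof.
set y := A ++ [:: l1, J, l2, m & Z] => l12 mJ ly.
have sy : size y = size A + 4 + size Z by rewrite size_cat /=; lia.
split; first exact: tab_syt.
exists (size A).+2; split; first by rewrite sy; lia.
have Yi : nth 0 y (size A).+1 = J by rewrite eqs nthA.
have Yp : nth 0 y (size A) = l1 by rewrite -[size A]addn0 nthA.
have Ys : nth 0 y (size A).+2 = l2 by rewrite eqs nthA.
have E : de (size A).+2 (tab y) = tab (A ++ [:: l1, l2, J, m & Z]).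
  have J2 : J != l2 by lia.
  have := @swap_tab (rcons A l1) (m :: Z) J l2 J2; rewrite !cat_rcons size_rcons => <-.
  rewrite /de; apply/eq_map => s; apply/eq_map => k; rewrite /de_relabel.
  rewrite !index_rw /before ?sy /= ?Yi ?Yp ?Ys; try lia.
  by rewrite ifT //; lia.
rewrite /deR E ifF //; apply/negbTE; rewrite negb_and; apply/orP; right.
rewrite ID_tab /asc mem_filter /= !negb_and; apply/orP; left.
have n3 s : nth 0 (A ++ s) (size A).+3 = nth 0 s 3 by rewrite -(nthA 3 s) addn3.
have n2 s : nth 0 (A ++ s) (size A).+2 = nth 0 s 2 by rewrite -(nthA 2 s) addn2.
by rewrite -leqNgt n3 n2.
Qed.

(** Here i + 1 is the middle one, so i - 1 and i are exchanged; the letter m keeps i + 1 out of ID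
    before the move. *)
Lemma de_step2 : l1 < J -> m <= J ->
  lat (A ++ [:: J, l1, J, m & Z]) ->
  tab_step (size (A ++ [:: J, l1, J, m & Z])) 2
    (tab (A ++ [:: J, l1, J, m & Z])) (tab (A ++ [:: l1, J, J, m & Z])).
Proof.
set y := A ++ _ => l12 mJ ly.
have sy : size y = size A + 4 + size Z by rewrite size_cat /=; lia.
split; first exact: tab_syt.
exists (size A).+2; split; first by rewrite sy; lia.
have Yi : nth 0 y (size A).+1 = l1 by rewrite eqs nthA.
have Yp : nth 0 y (size A) = J by rewrite -[size A]addn0 nthA.
have Ys : nth 0 y (size A).+2 = J by rewrite eqs nthA.
have Yt : nth 0 y (size A).+3 = m by rewrite eqs nthA.
have E : de (size A).+2 (tab y) = tab (A ++ [:: l1, J, J, m & Z]).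
  have J2 : J != l1 by lia.
  have := @swap_tab A [:: J, m & Z] J l1 J2; rewrite -/y => <-.
  rewrite /de; apply/eq_map => s; apply/eq_map => k; rewrite /de_relabel.
  rewrite !index_rw /before ?sy /= ?Yi ?Yp ?Ys; try lia.
  by rewrite ifF ?ifT //; lia.
rewrite /deR E ifF //; apply/negbTE; rewrite negb_and; apply/orP; left.
rewrite ID_tab /asc mem_filter /= !negb_and; apply/orP; left.
by rewrite -leqNgt Yt Ys.
Qed.

End Moves.

(** Exchanging J and l2 could only matter for l2 = J - 1, and then l1 = J - 1 as well, which already
    permits J before l2. *)
Lemma lat_move1 A Z J l1 l2 : l2 <= l1 < J ->
  lat (A ++ [:: l1, J, l2 & Z]) = lat (A ++ [:: l1, l2, J & Z]).
Proof.
move=> /andP[l21 l1J]; rewrite /lat !latw_cat; case lA : (latw _ A) => //=.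
have cJ := @lat_count A J.-1 lA; case: J l1J cJ => // J l1J /= cJ.
have -> : latw (fun r => 0 + count_mem r A + (l1 == r) + (J.+1 == r) + (l2 == r)) Z =
    latw (fun r => 0 + count_mem r A + (l1 == r) + (l2 == r) + (J.+1 == r)) Z.
  by apply: eq_latw => r; lia.
case: (latw _ Z); rewrite ?andbF ?andbT //; congr (_ && _).
have -> : (l2 == J.+1) = false by lia.
case: (eqVneq l2 J) => [E|l2J].
  have -> : l1 = J by lia.
  rewrite E eqxx (ltn_eqF (ltnSn J)) (gtn_eqF (ltnSn J)) /=.
  case: J {E l1J cJ l21} => [|J] //= in cJ *; lia.
have -> : (J.+1 == l2) = false by lia.
have -> : (J.+1 == l2.-1) = false by lia.
have -> : (l1 == J.+1) = false by lia.
lia.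
Qed.

Lemma lat_move2 A Z J l : l < J ->
  lat (A ++ [:: J, l, J & Z]) = lat (A ++ [:: l, J, J & Z]).
Proof.
move=> lJ; rewrite /lat !latw_cat; case lA : (latw _ A) => //=.
have -> : latw (fun r => 0 + count_mem r A + (J == r) + (l == r) + (J == r)) Z =
    latw (fun r => 0 + count_mem r A + (l == r) + (J == r) + (J == r)) Z.
  by apply: eq_latw => r; lia.
case: (latw _ Z); rewrite ?andbF ?andbT //.
case: J lJ => // J lJ /=; rewrite !eqxx.
have -> : (J.+1 == J) = false by lia.
have -> : (J.+1 == l) = false by lia.
have -> : (J.+1 == l.-1) = false by lia.
have -> : (l == J.+1) = false by lia.
by lia.
Qed.

(* [true] stands for the letter J, [false] for the next letter of a fixed weakly decreasing word in smaller letters. *)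
Inductive bmove : seq bool -> seq bool -> Prop :=
| BMove1 u w : bmove (u ++ [:: false, true, false & w]) (u ++ [:: false, false, true & w])
| BMove2 u w : bmove (u ++ [:: true, false, true & w]) (u ++ [:: false, true, true & w]).

Definition bequiv := clos_refl_sym_trans (seq bool) bmove.

Definition bal (t : seq bool) : bool :=
  all (fun i => count id (take i t) <= count negb (take i t)) (iota 0 (size t).+1).

Lemma bal_rcons s b : bal (rcons s b) =
  bal s && (count id (rcons s b) <= count negb (rcons s b)).
Proof.
rewrite /bal size_rcons -[(size s).+2]addn1 iotaD all_cat; congr (_ && _).
  apply: eq_in_all => i; rewrite mem_iota /= => si.
  by rewrite -cats1 takel_cat.
by rewrite /= andbT add0n take_oversize ?size_rcons.
Qed.

Lemma bal_count s : bal s -> count id s <= count negb s.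
Proof. by move/allP/(_ (size s)); rewrite mem_iota take_size; apply; rewrite /= add0n. Qed.

Lemma bal_nseq s (b : bool) m : bal s -> count id s + b * m <= count negb s -> bal (s ++ nseq m b).
Proof.
move=> bs; elim: m => [|m IH] H; first by rewrite cats0.
have -> : s ++ nseq m.+1 b = rcons (s ++ nseq m b) b.
  by rewrite -cats1 -catA; congr (_ ++ _); elim: m {IH H} => //= m ->.
rewrite bal_rcons IH; last by lia.
by rewrite -cats1 !count_cat !count_nseq /=; case: b H {IH} => /=; lia.
Qed.

Lemma bequiv_rcons t t' b : bequiv t t' -> bequiv (rcons t b) (rcons t' b).
Proof.
elim=> {t t'} [t t' H|t|t t' _|t t' t'' _ H1 _ H2].
- apply: rst_step; case: H => u w; rewrite !rcons_cat !rcons_cons; constructor.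
- exact: rst_refl.
- exact: rst_sym.
- exact: rst_trans H1 H2.
Qed.

Lemma count_bool (s : seq bool) : size s = count id s + count negb s.
Proof. by rewrite -(count_predC id). Qed.

(** Induction on the length, by the last letter. If the last letters differ, the induction
    hypothesis brings the words to the forms z f t f and z f f t (f for [false], t for [true]),
    which one [BMove1] connects. Placing all [false] letters of z first makes it ballot. *)
Lemma bal_connected t t' : size t = size t' -> count id t = count id t' ->
  bal t -> bal t' -> bequiv t t'.
Proof.
move: {2}(size t) (erefl (size t)) => N; elim: N t t' => [|N IH] t t'.
  by move/size0nil=> -> /esym/size0nil-> *; apply: rst_refl.
case/lastP: t => // s b; case/lastP: t' => [|s' b']; first by rewrite size_rcons.
rewrite !size_rcons => -[sN] [ss]; rewrite -!cats1 !count_cat /= !addn0 => cs.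
have main (u u' : seq bool) : size u = N -> size u = size u' -> count id u = count id u' + true ->
    bal u -> bal u' -> bal (rcons u' true) -> bequiv (rcons u false) (rcons u' true).
  move=> uN uu cu bu bu' bu1.
  have q1 : 0 < count id u by rewrite cu addn1.
  have p1 := bal_count bu; have e1 := count_bool u; have e2 := count_bool u'.
  pose z := nseq (count negb u).-1 false ++ nseq (count id u).-1 true.
  have cz : count id z = (count id u).-1 by rewrite count_cat !count_nseq /= mul0n mul1n.
  have cz' : count negb z = (count negb u).-1 by rewrite count_cat !count_nseq /= mul0n mul1n addn0.
  have bz : bal z.
    apply: bal_nseq; last by rewrite !count_nseq /=; lia.
    by apply: (@bal_nseq [::] false).
  clearbody z.
  have H1 : bequiv u (rcons (rcons z false) true).
    apply: IH; rewrite ?size_rcons -?cats1 ?count_cat /= ?cz //.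
    - by rewrite (count_bool z) cz cz'; lia.
    - by lia.
    - rewrite !cats1 !bal_rcons bz -!cats1 !count_cat /= cz cz'; lia.
  have H2 : bequiv u' (rcons (rcons z false) false).
    apply: IH; rewrite ?size_rcons -?cats1 ?count_cat /= ?cz //; try lia.
    - by rewrite (count_bool z) cz cz'; lia.
    - rewrite !cats1 !bal_rcons bz -!cats1 !count_cat /= cz cz'; lia.
  apply: rst_trans (bequiv_rcons false H1) _.
  apply: rst_trans _ (rst_sym _ _ _ _ (bequiv_rcons true H2)).
  by apply: rst_step; rewrite -!cats1 -!catA /=; apply: (BMove1 z [::]).
rewrite !cats1 !bal_rcons => /andP[bs c1] /andP[bs' c2].
case: b b' cs c1 c2 => [] [] /= cs c1 c2.
- by apply/bequiv_rcons/IH => //; lia.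
- by apply/rst_sym/main => //; rewrite ?bal_rcons ?bs ?c1 //; lia.
- by apply: main => //; rewrite ?bal_rcons ?bs' ?c2 //; lia.
- by apply/bequiv_rcons/IH => //; lia.
Qed.

Fixpoint weave (J : nat) (t : seq bool) (L : seq nat) : seq nat :=
  match t with
  | [::] => [::]
  | true :: t' => J :: weave J t' L
  | false :: t' => head 0 L :: weave J t' (behead L)
  end.

Lemma weave_cat J t1 t2 L :
  weave J (t1 ++ t2) L = weave J t1 L ++ weave J t2 (drop (count negb t1) L).
Proof.
elim: t1 L => [|[] t1 IH] L /=; rewrite ?drop0 // IH ?add0n //.
by rewrite add1n; case: L.
Qed.

Lemma size_weave J t L : size (weave J t L) = size t.
Proof. by elim: t L => [|[] t IH] L //=; rewrite IH. Qed.

Lemma weave_true J m L : weave J (nseq m true) L = nseq m J.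
Proof. by elim: m => //= m ->. Qed.

Lemma weave_false J m L : m <= size L -> weave J (nseq m false) L = take m L.
Proof. by elim: m L => [|m IH] [|z L] //= mL; rewrite ?take0 // IH. Qed.

Lemma weave_le J t L : all (ltn^~ J) L -> all (leq^~ J) (weave J t L).
Proof.
elim: t L => [|[] t IH] L HL //=; rewrite ?leqnn IH //; first by case: L HL => //= z L /andP[/ltnW->].
by case: L HL => //= z L /andP[].
Qed.

Section Weave.

Variables (J : nat) (A L R : seq nat).
Hypotheses (J0 : 0 < J) (gL : sorted geq L) (LJ : all (ltn^~ J) L).

(** The last letter is a fixed [false]: it guarantees that every move is followed by a letter m <=
    J, as [de_step1] and [de_step2] demand. *)
Let Y t := A ++ weave J (rcons t false) L ++ R.

Let headL_lt n : head 0 (drop n L) < J.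
Proof.
rewrite -nth0 nth_drop addn0; case: (ltnP n (size L)) => nL; last by rewrite nth_default.
by apply: (allP LJ); apply: mem_nth.
Qed.

Let head_le n : head 0 (drop n.+1 L) <= head 0 (drop n L).
Proof.
rewrite -!nth0 !nth_drop !addn0; case: (ltnP n.+1 (size L)) => nL; last by rewrite nth_default.
by have := sortedP 0 gL n; apply.
Qed.

Lemma weave_tail t n : exists m Z, weave J (rcons t false) (drop n L) ++ R = m :: Z /\ m <= J.
Proof.
have aL : all (ltn^~ J) (drop n L) by apply/allP => z /mem_drop; apply: (allP LJ).
have := weave_le (rcons t false) aL; case E : (weave J _ _) => [|m Z] /=.
  by move/(congr1 size): E; rewrite size_weave size_rcons.
by move=> /andP[mJ _]; exists m, (Z ++ R).
Qed.

Lemma weave_move t t' : bmove t t' -> lat (Y t) = lat (Y t') /\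
  (lat (Y t) -> tab_step (size (Y t)) 2 (tab (Y t)) (tab (Y t'))).
Proof.
case=> u w; rewrite /Y !rcons_cat !rcons_cons !weave_cat /= -!drop1 !drop_drop -!catA !add1n /=.
  set n := count negb u; have [m [Z [-> mJ]]] := weave_tail w n.+2.
  rewrite !catA; split; first by apply: lat_move1; rewrite head_le headL_lt.
  by apply: de_step1; rewrite ?head_le ?headL_lt.
set n := count negb u; have [m [Z [-> mJ]]] := weave_tail w n.+1.
rewrite !catA; split; first by apply: lat_move2.
by apply: de_step2.
Qed.

Lemma size_bequiv t t' : bequiv t t' -> size t = size t'.
Proof.
elim=> {t t'} [t t' []|t|t t' _ ->|t t' t'' _ -> _ ->] //.
  by move=> u w; rewrite !size_cat.
by move=> u w; rewrite !size_cat.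
Qed.

Lemma weave_equiv t t' : bequiv t t' -> lat (Y t) = lat (Y t') /\
  (lat (Y t) -> tab_equiv (size (Y t)) 2 (tab (Y t)) (tab (Y t'))).
Proof.
have sY s s' : bequiv s s' -> size (Y s) = size (Y s').
  by move/size_bequiv => e; rewrite !size_cat !size_weave !size_rcons e.
elim=> {t t'} [t t' H|t|t t' H [E IH]|t t' t'' H [E1 IH1] H' [E2 IH2]].
- have [E S] := weave_move H; split=> // /S; exact: rst_step.
- by split=> // _; apply: rst_refl.
- split=> //; rewrite -E => /IH; rewrite (sY _ _ H); exact: rst_sym.
- split; first by rewrite E1.
  move=> ly; apply: rst_trans (IH1 ly) _; rewrite (sY _ _ H); apply: IH2.
  by rewrite -E1.
Qed.

End Weave.

(** * The map slink as a reshuffling of ballot words *)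

Section Slink.

Variables (a0 : seq nat) (x : nat) (B : seq nat) (rs : seq (seq nat)).
Let a := a0 ++ [:: x].
Hypothesis nf : NF a B rs.
Let L := nseq x (size a0) ++ [seq z <- B | z < (size a0).+1].

Definition slinkw : seq nat :=
  Jw a0 ++ take (size B).-1 L ++
  ([seq z <- B | size a0 < z] ++ drop (size B).-1 L) ++ flatten rs.

Let sa : size a = (size a0).+1.
Proof. by rewrite size_cat addn1. Qed.

Let gB := NF_sorted nf.

Lemma slink_NF : slink (tab (wordNF a B rs)) = tab slinkw.
Proof.
rewrite /slink bad_le_nruns // bad_run_NF // beta_NF //= sa.
have bb : blocks (Ab 0 a0 ++ nseq x (size a0) :: [::] ++ B :: rs).
  by case: nf; rewrite /a Ab_cat -catA.
have := @exchange_tab (Ab 0 a0) [::] rs (nseq x (size a0)) B (size a0).+1 (size B).-1 bb.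
rewrite cat0s -[_ :: B :: rs]cat1s catA -[Ab 0 a0 ++ _](Ab_cat 0 a0 [:: x]) -/a flatten_wordNF.
rewrite !size_Ab !flatten_Ab addn0 => -> //.
- by apply/allP => z /nseqP[-> _]; exact: ltnSn.
- exact: sorted_L.
Qed.

Lemma slinkw_star : isI a B (size a0) ->
  slink (tab (wordNF a B rs)) = slink_star (tab (wordNF a B rs)).
Proof.
move=> iI; rewrite slink_NF slink_star_NF // /slinkw /wordNF.
have -> : size B + size a0 - size (a0 ++ [:: x]) = (size B).-1 by rewrite -/a sa; lia.
have kx := isI_k_le nf iI; rewrite sa in kx.
have ek : size B + size a0 - (size a0).+1 = (size B).-1 by lia.
rewrite ek /mu /a nth_cat ltnn subnn /= in kx.
by rewrite /L take_starL // Jwo_cat /= cats0 /starB -!catA.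
Qed.

Let J0 : 0 < size a. Proof. by rewrite sa. Qed.

Let rho := count_mem (size a) B.

Let EB : B = nseq rho (size a) ++ [seq z <- B | z < (size a0).+1].
Proof.
rewrite {1}(geq_split (size a0) gB); congr (_ ++ _).
rewrite (@eq_in_filter _ _ (pred1 (size a))) => [|z /(allP (NF_le nf)) /=]; last by rewrite sa; lia.
by rewrite /rho -size_filter; apply/all_pred1P; apply: filter_all.
Qed.

Let hiB : [seq z <- B | size a0 < z] = nseq rho (size a).
Proof.
rewrite (@eq_in_filter _ _ (pred1 (size a))) => [|z /(allP (NF_le nf)) /=]; last by rewrite sa; lia.
by rewrite /rho -size_filter; apply/all_pred1P; apply: filter_all.
Qed.

Let sL : size L + rho = x + size B.
Proof. by rewrite [in RHS]EB !size_cat !size_nseq; lia. Qed.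

Let rhoB : rho < size B. Proof. exact: count_lt_size nf. Qed.

Let rhox : rho <= x.
Proof.
have := NF_interlace nf (size a0); rewrite {2}/a nth_cat ltnn subnn /= -sa -/rho.
lia.
Qed.

Lemma size_slinkw : size slinkw = size (wordNF a B rs).
Proof.
rewrite /slinkw hiB /wordNF /a Jwo_cat /= cats0 -/L; move: L sL => L' e.
have := size_cat (take (size B).-1 L') (drop (size B).-1 L'); rewrite cat_take_drop.
by rewrite !size_cat !size_nseq; lia.
Qed.

Lemma slink_weave : lat slinkw /\
  tab_equiv (size (wordNF a B rs)) 2 (tab (wordNF a B rs)) (tab slinkw).
Proof.
have LJ : all (ltn^~ (size a)) L.
  rewrite sa; apply/allP => z; rewrite mem_cat mem_filter => /orP[/nseqP[-> _]|/andP[]//].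
  exact: ltnSn.
(* [t1] and [t2] describe the shuffles in T and in slink T, each without its last [false], which
   [weave_equiv] appends. They are ballot because [rho] is at most x and smaller than beta_j. *)
pose t1 := (nseq x false ++ nseq rho true) ++ nseq (size B - rho).-1 false.
pose t2 := (nseq (size B).-1 false ++ nseq rho true) ++ nseq (x - rho) false.
have et : bequiv t1 t2.
  apply: bal_connected.
  - by rewrite !size_cat !size_nseq; lia.
  - by rewrite !count_cat !count_nseq /=; lia.
  - apply: bal_nseq; last by rewrite !count_cat !count_nseq /=; lia.
    by apply: bal_nseq; rewrite ?count_nseq /=; [apply: (@bal_nseq [::] false) | lia].
  - apply: bal_nseq; last by rewrite !count_cat !count_nseq /=; lia.
    by apply: bal_nseq; rewrite ?count_nseq /=; [apply: (@bal_nseq [::] false) | lia].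
have W m m' : m + m' = size L ->
    weave (size a) ((nseq m false ++ nseq rho true) ++ nseq m' false) L =
    take m L ++ nseq rho (size a) ++ drop m L.
  move=> mm; rewrite -catA !weave_cat weave_true weave_false; last by lia.
  rewrite !count_nseq /= mul1n mul0n drop0 weave_false ?size_drop; last by lia.
  by rewrite (take_oversize (s := drop m L)) // size_drop; lia.
have rn m : rcons (nseq m false) false = nseq m.+1 false by elim: m => //= m ->.
have := weave_equiv (Jw a0) (flatten rs) J0 (sorted_L _ _ gB) LJ et.
rewrite !rcons_cat !rn !W; try lia.
have -> : Jw a0 ++ (take x L ++ nseq rho (size a) ++ drop x L) ++ flatten rs = wordNF a B rs.
  rewrite /L take_size_cat ?drop_size_cat ?size_nseq // -EB /wordNF /a Jwo_cat /= cats0.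
  by rewrite -!catA.
have -> : Jw a0 ++ (take (size B).-1 L ++ nseq rho (size a) ++ drop (size B).-1 L) ++ flatten rs = slinkw.
  by rewrite /slinkw hiB -!catA.
by case=> <- H; have lw := lat_wordNF nf; split=> //; apply: H.
Qed.

End Slink.

(** * Commutation of slink and slink_star for i < j - 1 *)

Section Commute.

Variables (p : seq nat) (y0 : nat) (q : seq nat) (x : nat) (B : seq nat) (rs : seq (seq nat)).
Let I := size p.
Let a0 := p ++ y0 :: q.
Let a := a0 ++ [:: x].
Hypothesis nf : NF a B rs.
Hypothesis iI : isI a B I.
Let c := size B.
Let J1 := size a0.
Let L := nseq x J1 ++ [seq z <- B | z < J1.+1].
Let B1 := take c.-1 L.
Let B2 := [seq z <- B | J1 < z] ++ drop c.-1 L.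

Let sa : size a = J1.+1. Proof. by rewrite size_cat addn1. Qed.
Let IJ1 : I < J1. Proof. by rewrite /J1 /a0 size_cat /= addnS ltnS leq_addr. Qed.
Let gB := NF_sorted nf.
Let k := c + I - size a.
(** [P] and [W] split the cells of runs j - 1 and j below row j into those above row i and the rest.
    Telescoped interlacing gives [size P <= mu a B I.+1 <= k], which is less than beta_j - 1, so the
    cut made by slink falls inside [W]. *)
Let P := nseq x J1 ++ [seq z <- B | I < z < J1.+1].
Let W := [seq z <- B | z < I.+1].

Let LE : L = P ++ W.
Proof.
rewrite /L /P -catA; congr (_ ++ _).
rewrite [LHS](geq_split I (sorted_filter geq_transitive _ gB)) -!filter_predI.
congr (_ ++ _); apply: eq_filter => z /=; lia.
Qed.

Let aI : nth 0 a I = y0.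
Proof. by rewrite /a /a0 -catA nth_cat ltnn subnn. Qed.

Let aJ1 : nth 0 a J1 = x.
Proof. by rewrite /a nth_cat ltnn subnn. Qed.

Let tele r : I < r <= J1 -> x + count (fun z => r <= z < J1.+1) B <= mu a B r.
Proof.
case/andP=> Ir rJ; have [d E] : exists d, J1 = r + d by exists (J1 - r); lia.
elim: d r Ir rJ E => [|d IH] r Ir rJ E.
  have -> : r = J1 by lia.
  rewrite /mu aJ1 leq_add2l; apply: eq_leq; apply: eq_count => z /=; lia.
have H : x + count (fun z => r < z < J1.+1) B <= mu a B r.+1 by apply: IH; lia.
have m1 := mu_le nf r.
have -> : count (fun z => r <= z < J1.+1) B = count_mem r B + count (fun z => r < z < J1.+1) B.
  by apply: count_or => z /=; lia.
by rewrite /mu; lia.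
Qed.

Let sP : size P = x + count (fun z => I < z < J1.+1) B.
Proof. by rewrite size_cat size_nseq size_filter. Qed.

Let sPmu : size P <= mu a B I.+1.
Proof. by rewrite sP; apply: tele; rewrite ltnSn. Qed.

Let sPk : size P <= k.
Proof. exact: leq_trans sPmu (isI_k_ge iI). Qed.

Let sPy : size P <= y0.
Proof. by rewrite -aI; apply: leq_trans sPmu (mu_le nf I). Qed.

Let kc : k + size a = c + I. Proof. exact: isI_k iI. Qed.
Let kc1 : k.+1 < c. Proof. have := kc; rewrite sa; lia. Qed.

Let m := c.-1 - size P.

Let rho := count_mem (size a) B.

Let rhox : rho <= x.
Proof.
by have := NF_interlace nf J1; rewrite -sa -/rho aJ1; lia.
Qed.

Let sW : size W + size P + rho = x + c.
Proof.
have e1 : count (fun z => z <= size a) B = c.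
  by apply/eqP; rewrite -all_count; exact: NF_le nf.
have e2 : count (fun z => z <= size a) B = count (fun z => z < J1.+1) B + rho.
  by apply: count_or => z /=; rewrite sa; lia.
have e3 : count (fun z => z < J1.+1) B = count (fun z => I < z < J1.+1) B + size W.
  by rewrite size_filter; apply: count_or => z /=; lia.
by rewrite sP; lia.
Qed.

Let B1E : B1 = P ++ take m W.
Proof. by rewrite /B1 LE take_cat ifF //; apply/negbTE; rewrite -leqNgt; lia. Qed.

Let x_gt0 : 0 < x.
Proof.
rewrite lt0n; apply: contraNneq (NF_pos nf) => x0.
by rewrite /a x0 mem_cat mem_head orbT.
Qed.

Let WI z : z \in W -> z <= I.
Proof. by rewrite mem_filter => /andP[]. Qed.

Let PI z : z \in P -> I < z < J1.+1.
Proof. rewrite mem_cat mem_filter => /orP[/nseqP[-> _]|/andP[]//]; lia. Qed.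

Let c0 : nth 0 a0 =1 (fun r => if r == J1 then 0 else nth 0 a r).
Proof.
move=> r; rewrite /a nth_cat; case: (ltngtP r J1) => // rJ.
  rewrite !nth_default // ?leq_subLR //=; [rewrite -/J1; lia|exact: ltnW].
by rewrite nth_default // rJ.
Qed.

(** As the cut falls inside [W], the new run j - 1 has a cell below its own row. It becomes the bad
    run, and [B2] joins the later runs. *)
Lemma NF_slink : NF a0 B1 (B2 :: rs).
Proof.
have [B' EB] := NF_head nf.
have hB2 : exists s, B2 = size a :: s.
  rewrite /B2 {1}EB /= sa ltnSn /=; eexists; reflexivity.
split.
- have := NF_pos nf; rewrite /a mem_cat negb_or => /andP[na0 _].
  rewrite blocks_Ab na0 /=; apply/andP; split.
    apply/orP; right; rewrite B1E /P; case: (x) x_gt0 => //= *; rewrite -/J1; lia.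
  rewrite blocks_cons2; apply/and4P; split.
  + by rewrite B1E /P; case: (x) x_gt0.
  + exact: (take_sorted _ (sorted_L _ _ gB)).
  + case: hB2 => s -> /=; rewrite sa ltnS.
    have : all (leq^~ J1) B1.
      by apply/allP => z /mem_take; rewrite mem_cat mem_filter => /orP[/nseqP[-> _]|/andP[]].
    by case: (B1) => //= z s'; rewrite -/(all _ (z :: s')) => /allP; apply; apply: mem_last.
  + case: nf; rewrite blocks_Ab => /and3P[_ _ bb] _ _; apply: last_blocks bb _ _ _.
    * by case: hB2 => s ->.
    * rewrite sorted_geq_cat.
      rewrite (sorted_filter geq_transitive) // (drop_sorted _ (sorted_L _ _ gB)) !andbT.
      apply/allrelP => u v; rewrite mem_filter => /andP[uJ _] /mem_drop.
      rewrite mem_cat mem_filter => /orP[/nseqP[-> _]|/andP[vJ _]]; first exact: ltnW.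
      by move: vJ uJ; rewrite /=; lia.
    * rewrite /B2 last_cat.
      have -> : last (last 0 [seq z <- B | J1 < z]) (drop c.-1 L) = last 0 L.
        rewrite -[in RHS](cat_take_drop c.-1 L) last_cat.
        have : 0 < size (drop c.-1 L) by rewrite size_drop LE size_cat; lia.
        by case: (drop _ _).
      by apply: last_L => //; rewrite EB.
- by rewrite /= catA; have [+ _] := slink_weave nf; rewrite /slinkw -!catA.
- rewrite B1E has_cat; apply/orP; right.
  have : 0 < size (take m W) by rewrite size_take /m; case: ifP => _; lia.
  case E : (take m W) => [//|z s] _; apply/hasP; exists z; first exact: mem_head.
  have /WI zI : z \in W by apply: (mem_take (n0 := m)); rewrite E mem_head.
  exact: leq_ltn_trans zI IJ1.
Qed.

Let sB1 : size B1 = c.-1.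
Proof. by rewrite size_takel // LE size_cat; lia. Qed.

Let count_P r : I < r -> r <= J1 -> count_mem r B1 = (r == J1) * x + count_mem r B.
Proof.
move=> Ir rJ; rewrite B1E count_cat [X in _ + X](_ : _ = 0).
  rewrite addn0 /P count_cat count_nseq /= eq_sym; congr (_ + _).
  rewrite count_filter; apply: eq_count => z /=; lia.
by apply/count_memPn; apply/negP => /mem_take/WI; lia.
Qed.

(** slink lowers both the length and the index of the bad run by one, so the inequality at I is the
    same as before, mu being unchanged in row I + 1. *)
Lemma isI_slink : isI a0 B1 I.
Proof.
case: iI => _ i1 i2; split=> //.
  rewrite sB1 -/J1; suff -> : mu a0 B1 I.+1 = mu a B I.+1 by move: i1; rewrite sa -/c; lia.
  rewrite /mu c0 count_P //; case: eqP => [->|_] /=; rewrite ?mul1n ?mul0n //.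
  by rewrite aJ1.
move=> I0 I0I; rewrite sB1 -/J1.
have i3 : c + I.-1 < mu a B I + J1.+1 by rewrite -sa; have := i2 I.-1; rewrite prednK; [apply; lia|lia].
have [I1|I1] := eqVneq I0.+1 I; last first.
  have : mu a B I <= nth 0 a I0.+1.
    have -> : I = I.-1.+1 by lia.
    apply: leq_trans (mu_le nf I.-1) _; apply: (nth_a_le nf); lia.
  rewrite /mu c0 ifF; last by lia.
  by rewrite -/(mu a B I); lia.
(* Row I may lose cells, as [B1] keeps only the first m letters of [W]; [size P <= y0]
   compensates. *)
rewrite I1 /mu c0 ifF; last by lia.
rewrite aI B1E count_cat.
have WE : W = nseq (count_mem I B) I ++ [seq z <- B | z < I] by exact: filter_ltnS.
have cW : minn m (count_mem I B) <= count_mem I (take m W).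
  rewrite WE take_cat size_nseq; case: ltnP => mc.
    by rewrite take_nseq ?(ltnW mc) // count_nseq /= eqxx mul1n; lia.
  by rewrite count_cat count_nseq /= eqxx mul1n; lia.
move: i3; rewrite {1}/mu aI; lia.
Qed.

Lemma slink_comm :
  slink (slink_star (tab (wordNF a B rs))) = slink_star (slink (tab (wordNF a B rs))).
Proof.
have nfs := NF_slink; have iIs := isI_slink.
have aE : a = p ++ y0 :: (q ++ [:: x]) by rewrite /a /a0 -catA.
have nf' := nf; have iI' := iI; rewrite aE in nf' iI'.
rewrite [in LHS]aE slink_star_NF // -aE -/I -/c -/k.
have nf2 := NF_star nf' iI'; have s2 := size_star nf' iI'.
rewrite -aE -/I -/c -/k in nf2 s2.
set B' := starB I y0 k B in nf2 s2 *.
have aE' : p ++ k :: q ++ [:: x] = (p ++ k :: q) ++ [:: x] by rewrite -catA.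
rewrite aE' in nf2 *; rewrite slink_NF // slink_NF //.
have -> : slinkw a0 x B rs = wordNF a0 B1 (B2 :: rs).
  by rewrite /slinkw /wordNF /= -/J1 -/L -/c -/B1 -!catA.
rewrite slink_star_NF // -/I sB1.
have -> : c.-1 + I - size (p ++ y0 :: q) = k by rewrite -/a0 -/J1; have := kc; rewrite sa; lia.
congr tab; rewrite /slinkw /wordNF; congr (_ ++ _).
have sJ : size (p ++ k :: q) = J1 by rewrite /J1 /a0 !size_cat.
rewrite !sJ; set L' := nseq x J1 ++ [seq z <- B' | z < J1.+1].
(* [Z] lists the cells of runs i, j - 1 and j in rows up to i. In either order the two maps cut it
   after k and after y0 + m cells, and the three pieces go to runs i, j - 1 and j. *)
pose Z := nseq y0 I ++ W.
have ZI z : z \in Z -> z <= I by rewrite mem_cat => /orP[/nseqP[-> _]|/WI].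
have BE' : B' = [seq z <- B | I < z] ++ drop k Z by [].
have LE' : L' = P ++ drop k Z.
  rewrite /L' BE' filter_cat -filter_predI /P -catA; congr (_ ++ (_ ++ _)).
    by apply: eq_filter => z /=; rewrite andbC.
  by apply/all_filterP/allP => z /mem_drop/ZI; lia.
have hE : [seq z <- B' | J1 < z] = [seq z <- B | J1 < z].
  rewrite BE' filter_cat -filter_predI [X in _ ++ X](_ : _ = [::]) ?cats0.
    by apply: eq_filter => z /=; lia.
  by apply: filter_nil => z /mem_drop/ZI /=; lia.
have sB' : (size B').-1 - size P = y0 + m - k.
  by move: s2 kc; rewrite sa /m; lia.
have PB : size P <= (size B').-1 by move: s2; rewrite sa; lia.
have ky : k <= y0 + m by move: s2 kc; rewrite sa /m; lia.
have ZE : nseq y0 I ++ take m W = take (y0 + m) Z.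
  by rewrite /Z take_cat size_nseq ltnNge leq_addr /= addKn.
have -> : take (size B').-1 L' = starB I y0 k B1.
  rewrite LE' take_cat ltnNge PB /= sB' /starB B1E !(filter_cat _ P).
  have -> : [seq z <- P | I < z] = P by apply/all_filterP/allP => z /PI/andP[].
  have -> : [seq z <- take m W | I < z] = [::].
    by apply: filter_nil => z /mem_take/WI /=; lia.
  have -> : [seq z <- P | z < I.+1] = [::].
    by apply: filter_nil => z /PI /=; lia.
  have -> : [seq z <- take m W | z < I.+1] = take m W.
    by apply/all_filterP/allP => z /mem_take/WI.
  by rewrite cats0 /= ZE -{2}(subnK ky) take_drop.
have -> : drop (size B').-1 L' = drop c.-1 L.
  rewrite LE' drop_cat ltnNge PB /= sB' drop_drop subnK // /Z drop_cat size_nseq.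
  rewrite ltnNge leq_addr /= addKn LE drop_cat ltnNge.
  by have -> : size P <= c.-1 by lia.
by rewrite hE /= -catA.
Qed.

End Commute.

Lemma slink_equiv a0 x B rs k : k \in [:: 1; 2] -> NF (a0 ++ [:: x]) B rs ->
  tab_equiv (size (wordNF (a0 ++ [:: x]) B rs)) k
    (tab (wordNF (a0 ++ [:: x]) B rs)) (slink (tab (wordNF (a0 ++ [:: x]) B rs))).
Proof.
rewrite !inE => /orP[] /eqP-> nf.
  by apply: rst_step; split=> //; apply/tab_syt/lat_wordNF.
by rewrite slink_NF //; case: (slink_weave nf).
Qed.

Lemma perm_wordNF_star p y0 q B rs k : NF (p ++ y0 :: q) B rs -> isI (p ++ y0 :: q) B (size p) ->
  k = size B + size p - size (p ++ y0 :: q) ->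
  perm_eq (wordNF (p ++ k :: q) (starB (size p) y0 k B) rs) (wordNF (p ++ y0 :: q) B rs).
Proof. by move=> nf iI ->; rewrite /wordNF catA [X in perm_eq _ X]catA perm_cat2r (perm_star nf iI). Qed.

Lemma isI_split a B I : isI a B I -> exists p y0 q, a = p ++ y0 :: q /\ size p = I.
Proof.
case=> Ia _ _; exists (take I a), (nth 0 a I), (drop I.+1 a).
by rewrite -drop_nth // cat_take_drop size_takel // ltnW.
Qed.

(** The chain is T, slink T, then slink_star of slink T, which is slink of slink_star T, and finally
    slink_star T. Its second step is the induction hypothesis, because the bad run of slink T comes
    one place earlier. *)
Lemma star_equiv a B rs I k : k \in [:: 0; 1; 2] -> NF a B rs -> isI a B I ->
  tab_equiv (size (wordNF a B rs)) k (tab (wordNF a B rs)) (slink_star (tab (wordNF a B rs))).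
Proof.
rewrite inE => /predU1P[-> nf _|k12].
  by apply: rst_step; split=> //; apply/tab_syt/lat_wordNF.
elim/last_ind: a B rs => [|a0 x IH] B rs nf iI; first by case: iI.
rewrite -cats1 in nf iI *.
have [p [y0 [q [aE sp]]]] := isI_split iI.
have [e|ne] := eqVneq I (size a0).
  by rewrite e in iI; rewrite -slinkw_star //; apply: slink_equiv.
have [q' a0E] : exists q', a0 = p ++ y0 :: q'.
  case/lastP: q aE => [|q' z].
    by rewrite !cats1 => /rcons_inj[E]; move: ne; rewrite -sp E eqxx.
  by rewrite -rcons_cons -rcons_cat cats1 => /rcons_inj[-> _]; exists q'.
rewrite -sp a0E in nf iI IH *.
apply: rst_trans (slink_equiv k12 nf) _.
have := IH _ _ (NF_slink nf iI) (isI_slink nf iI).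
set w := wordNF (p ++ y0 :: q') _ _.
have -> : w = slinkw (p ++ y0 :: q') x B rs by rewrite /w /slinkw /wordNF /= -!catA.
rewrite size_slinkw // -slink_NF // => H.
apply: rst_trans H _; rewrite -slink_comm //.
have aE' : (p ++ y0 :: q') ++ [:: x] = p ++ y0 :: (q' ++ [:: x]) by rewrite -catA.
have nf1 := nf; have iI1 := iI; rewrite aE' in nf1 iI1.
have nf2 := NF_star nf1 iI1; have pm := perm_wordNF_star nf1 iI1 erefl.
rewrite aE' slink_star_NF // -(perm_size pm).
set kk := size B + _ - _ in nf2 *.
have aE2 : p ++ kk :: q' ++ [:: x] = (p ++ kk :: q') ++ [:: x] by rewrite -catA.
rewrite aE2 in nf2 *; apply/rst_sym/slink_equiv => //.
Qed.

(** * Straightening coefficients *)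

Definition runlens (n : nat) (D : seq nat) : seq nat :=
  pairmap (fun b b' => b' - b) 0 (rcons D n).

Lemma runlens_flatten b bs : blocks (b :: bs) ->
  runlens (size (flatten (b :: bs))) (asc (flatten (b :: bs))) = shape (b :: bs).
Proof.
by move=> bb; rewrite /runlens asc_flatten // scanlK // => z w; rewrite addKn.
Qed.

Lemma runlens_NF a B rs : NF a B rs ->
  runlens (size (wordNF a B rs)) (asc (wordNF a B rs)) = a ++ size B :: shape rs.
Proof.
case=> bb _ _; rewrite -flatten_wordNF.
have -> : a ++ size B :: shape rs = shape (Ab 0 a ++ B :: rs).
  by rewrite /shape map_cat -/(shape (Ab 0 a)) shape_Ab.
by case: (Ab 0 a) bb => [|b bs] bb; apply: runlens_flatten.
Qed.

Section StraighteningCoefficients.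

Import GRing.Theory.
Local Open Scope ring_scope.

(* The coefficient of the Schur function of [la] in the Jacobi-Trudi determinant of the composition with descent set [D]. *)
Definition Phi (n : nat) (la D : seq nat) : int :=
  \det (\matrix_(i < n, k < n)
     ((nth 0 (runlens n D) i + k == nth 0 la k + i)%N%:R : int)).

Lemma sumn_ge_size (a : seq nat) : 0%N \notin a -> (size a <= sumn a)%N.
Proof.
by elim: a => //= x a IH; rewrite inE negb_or => /andP[x0 /IH]; case: x x0 => // x _; lia.
Qed.

Lemma size_NF_lt a B rs : NF a B rs -> (size a < size (wordNF a B rs))%N.
Proof.
move=> nf; rewrite /wordNF size_cat size_Jwo; have := sumn_ge_size (NF_pos nf).
by have [B' ->] := NF_head nf; rewrite /=; lia.
Qed.

Lemma det_swap_rows n (M M' : 'M[int]_n) (i j : 'I_n) : i != j ->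
  (forall k, M' i k = M j k) -> (forall k, M' j k = M i k) ->
  (forall r k, r != i -> r != j -> M' r k = M r k) -> \det M' = - \det M.
Proof.
move=> ij Hi Hj Hr.
have -> : M' = row_perm (tperm i j) M.
  apply/matrixP => r k; rewrite mxE.
  case: tpermP => [->|->|/eqP ri /eqP rj]; [exact: Hi|exact: Hj|exact: Hr].
by rewrite row_permE det_mulmx det_perm odd_tperm ij expr1 mulN1r.
Qed.

(** Row r of the matrix only depends on the r-th run length minus r, and by [isI_k] and [size_star]
    these values are exchanged between two runs. *)
Lemma Phi_star la p y0 q B rs : NF (p ++ y0 :: q) B rs -> isI (p ++ y0 :: q) B (size p) ->
  let k := (size B + size p - size (p ++ y0 :: q))%N in
  let y := wordNF (p ++ y0 :: q) B rs in
  let y' := wordNF (p ++ k :: q) (starB (size p) y0 k B) rs in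
  Phi (size y) la (asc y') = - Phi (size y) la (asc y).
Proof.
move=> nf iI k y y'; have pm : perm_eq y' y := perm_wordNF_star nf iI erefl.
have nf' := NF_star nf iI.
have Jn : (size (p ++ y0 :: q) < size y)%N := size_NF_lt nf.
have [IJ _ _] := iI; have In := ltn_trans IJ Jn.
have ek := isI_k iI; have ec := size_star nf iI; rewrite -/k in ek ec.
apply: (@det_swap_rows _ _ _ (Ordinal In) (Ordinal Jn)); first by rewrite -val_eqE /= ltn_eqF.
- move=> t; rewrite !mxE /= -{1}(perm_size pm) !runlens_NF //.
  rewrite -catA nth_cat ltnn subnn /= [in RHS]nth_cat ltnn subnn /=.
  by congr ((nat_of_bool _)%:R); lia.
- move=> t; rewrite !mxE /= -{1}(perm_size pm) !runlens_NF //.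
  have es : size (p ++ y0 :: q) = size (p ++ k :: q) by rewrite !size_cat.
  rewrite {1}es nth_cat ltnn subnn /= -catA [in RHS]nth_cat ltnn subnn /=.
  by congr ((nat_of_bool _)%:R); lia.
- move=> r t rI rJ; rewrite !mxE -{1}(perm_size pm) !runlens_NF //.
  have {}rI : (r != size p :> nat) by [].
  have {}rJ : (r != size (p ++ y0 :: q) :> nat) by [].
  suff E : forall c c', nth 0%N ((p ++ k :: q) ++ c :: shape rs) r = nth 0%N ((p ++ y0 :: q) ++ c' :: shape rs) r.
    by rewrite (E _ (size B)).
  move=> c c'; rewrite !nth_cat !size_cat /=.
  case: ltnP => rs1; first by case: ltnP => // rp; case: (r - size p)%N (subn_eq0 r (size p)) => //; lia.
  rewrite size_cat /= in rJ.
  case: (r - _)%N (subn_eq0 r (size p + (size q).+1)) => //; lia.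
Qed.

Lemma part_size_le n la : is_part n la -> (size la <= n)%N.
Proof. by case/and3P=> _ l0 /eqP <-; apply: sumn_ge_size. Qed.

Lemma part_nth_le n la i j : is_part n la -> (i <= j)%N -> (nth 0 la j <= nth 0 la i)%N.
Proof.
case/and3P=> sl _ _ ij; have [js|js] := ltnP j (size la); last by rewrite nth_default.
have := sorted_leq_nth geq_transitive leqnn 0%N sl; apply; rewrite ?inE //.
exact: leq_ltn_trans ij js.
Qed.

(** Parts minus indices strictly decrease, so equal partitions give the identity matrix. Otherwise
    let i be the first index where they differ: column i vanishes if mu_i < la_i, and row i if mu_i
    > la_i. *)
Lemma det_part n la mu : is_part n la -> is_part n mu ->
  \det (\matrix_(i < n, k < n) ((nth 0 mu i + k == nth 0 la k + i)%N%:R : int)) = (mu == la)%:R.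
Proof.
move=> pl pm; case: eqP => [->|ne].
  rewrite -[RHS](det1 _ n); congr (\det _); apply/matrixP => i k; rewrite !mxE.
  congr ((nat_of_bool _)%:R); apply/eqP/eqP => [E|->//]; apply: val_inj => /=.
  have := @part_nth_le n la i k pl; have := @part_nth_le n la k i pl.
  case: (leqP i k) => ik; case: (leqP k i) => ki //; try lia.
have [i ni mi] : exists2 i, nth 0%N mu i != nth 0%N la i & forall j, (j < i)%N -> nth 0%N mu j = nth 0%N la j.
  have ex : exists i, nth 0%N mu i != nth 0%N la i.
    have [/hasP[i _ H]|/hasPn H] := boolP (has (fun i => nth 0%N mu i != nth 0%N la i) (iota 0 (size mu + size la))).
      by exists i.
    case: ne; apply: (@eq_nth_default _ 0%N); [by case/and3P: pm|by case/and3P: pl|].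
    move=> r; have [rs|rs] := ltnP r (size mu + size la).
      by apply/eqP; rewrite -[_ == _]negbK; apply: H; rewrite mem_iota.
    by rewrite !nth_default // (leq_trans _ rs) ?leq_addr ?leq_addl.
  exists (ex_minn ex); case: ex_minnP => // m _ mm j jm; apply/eqP; rewrite -[_ == _]negbK.
  by apply/negP => /mm; rewrite leqNgt jm.
have i_n : (i < n)%N.
  rewrite ltnNge; apply: contraNN ni => ni; rewrite !nth_default //.
    exact: leq_trans (part_size_le pl) ni.
  exact: leq_trans (part_size_le pm) ni.
move: ni; rewrite neq_ltn => /orP[lt|lt].
  rewrite (expand_det_col _ (Ordinal i_n)) big1 // => j _; rewrite !mxE /=.
  case: eqP => [E|_]; last by rewrite mul0r.
  have [ij|ji] := leqP i j; first by have := part_nth_le pm ij; lia.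
  by have := part_nth_le pl (ltnW ji); have := mi _ ji; lia.
rewrite (expand_det_row _ (Ordinal i_n)) big1 // => j _; rewrite !mxE /=.
case: eqP => [E|_]; last by rewrite mul0r.
have [ij|ji] := leqP i j; first by have := part_nth_le pl ij; lia.
by have := part_nth_le pm (ltnW ji); have := mi _ ji; lia.
Qed.

Lemma runlens_sorted y : lat y -> sorted leq y -> y != [::] ->
  runlens (size y) (asc y) = shape (tab y).
Proof.
move=> ly sy; have [bs [bb E]] := blocks_exist y; rewrite -E in ly sy *.
have Eb := sorted_blocks bb ly sy; case: bs {E} bb ly sy Eb => // b bs bb ly sy Eb _.
rewrite runlens_flatten //; apply: (@eq_nth_default _ 0%N).
- apply/negP => /mapP[s sb /esym/size0nil s0].
  by case/andP: bb => /allP/(_ s sb); rewrite s0.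
- by have /and3P[] := is_part_shape_tab ly.
- by move=> r; rewrite nth_shape_tab Eb flatten_Ab count_Jw shape_Ab.
Qed.

Lemma Phi_sorted la y : lat y -> sorted leq y -> is_part (size y) la ->
  Phi (size y) la (asc y) = (shape (tab y) == la)%:R.
Proof.
(* The empty word is apart: [runlens 0 [::]] is [[:: 0]], not the empty shape. *)
move=> ly sy pl; case: (eqVneq y [::]) => [y0|y0]; last first.
  by rewrite /Phi runlens_sorted //; apply: det_part => //; apply: is_part_shape_tab.
rewrite y0 /= in pl *; rewrite /Phi det_mx00.
case/and3P: pl => _ l0 /eqP s0.
by have := sumn_ge_size l0; rewrite s0; case: (la).
Qed.

(** Collects the sign-reversing step together with the equivalence, for use both on SYT(mu) and on a
    union of classes. *)
Lemma star_word n k la y : k \in [:: 0; 1; 2]%N -> lat y -> size y = n -> ~~ sorted leq y ->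
  exists y', [/\ slink_star (tab y) = tab y' /\ slink_star (tab y') = tab y,
    perm_eq y' y, lat y' /\ ~~ sorted leq y',
    tab_equiv n k (tab y) (slink_star (tab y)) & Phi n la (asc y') = - Phi n la (asc y)].
Proof.
move=> k3 ly <- sy; have [a [B [rs [nf ->]]]] := NF_exists ly sy.
have [I iI] := isI_exists nf; have Et := star_equiv k3 nf iI.
have [p [y0 [q [aE sp]]]] := isI_split iI; rewrite -sp aE in nf iI Et *.
have pm := perm_wordNF_star nf iI erefl; have P := Phi_star la nf iI.
have := slink_star_NF nf iI; have := NF_star nf iI; have := isI_star nf iI.
have [] := star_inv nf iI.
set kk := (_ + _ - _)%N in pm P *; move=> I1 I2 iI' nf' E1.
exists (wordNF (p ++ kk :: q) (starB (size p) y0 kk B) rs); split=> //.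
- by split=> //; rewrite slink_star_NF // I1 I2.
- by split; [exact: lat_wordNF|exact: NF_wordNF_unsorted nf'].
Qed.

End StraighteningCoefficients.

(** * Coefficients at monomials *)

Lemma monom_ofE (js : seq nat) i : monom_of js i = count_mem i js.
Proof.
elim: js => [|j js IH]; first by rewrite /monom_of big_nil cm1.
by rewrite /monom_of big_cons cmM ucmE -/(monom_of js) IH.
Qed.

Lemma monom_of_eq (js J : seq nat) : (monom_of js == monom_of J) = perm_eq js J.
Proof.
apply/eqP/idP => [E|p]; first by apply/allP => x _; rewrite /= -!monom_ofE E.
by apply/eqP/cmP => i; rewrite !monom_ofE (seq.permP p).
Qed.

Lemma sub_map_val (T : choiceType) (A : {fset T}) (js : seq T) : {subset js <= A} ->
  exists s : seq A, map val s = js.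
Proof.
elim: js => [|x js IH] H; first by exists [::].
have [s Es] : exists s : seq A, map val s = js by apply: IH => z zs; apply: H; rewrite inE zs orbT.
have xA : x \in A by rewrite H ?mem_head.
by exists ([` xA]%fset :: s); rewrite /= Es.
Qed.

(** The index lists with monomial [monom_of J] are the rearrangements of [J]; this frees the count
    from tuples over the support. *)
Lemma genseriesE (d : nat) (P : seq nat -> bool) (J : seq nat) :
  genseries d P (monom_of J) =
  ((if size J == d then count P (permutations J) else 0)%:Z)%R.
Proof.
rewrite /genseries; set m := monom_of J; set A := [set _ | _].
pose F (j : d.-tuple (finsupp m)) := map val j.
have Finj : injective F by move=> j j' /(inj_map val_inj)/val_inj.
have memA (js : seq nat) : (js \in map F (enum A)) = [&& size js == d, perm_eq js J & P js].
  apply/mapP/and3P => [[j]|[/eqP sj pj Pj]].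
    rewrite mem_enum inE => /andP[]; rewrite monom_of_eq => pj Pj ->.
    by rewrite /F size_map size_tuple eqxx.
  have sub : {subset js <= finsupp m}.
    move=> x xj; rewrite mem_finsupp monom_ofE -(seq.permP pj) -lt0n -has_count has_pred1 //.
  have [s Es] := sub_map_val sub.
  have ss : size s == d by rewrite -sj -Es size_map.
  exists (Tuple ss); last by rewrite /F /= Es.
  by rewrite mem_enum inE /= Es monom_of_eq pj Pj.
congr (Posz _); rewrite cardE -(size_map F).
case: eqP => sJ.
  rewrite -size_filter; apply: perm_size; apply: uniq_perm.
  - by rewrite map_inj_uniq // enum_uniq.
  - by rewrite filter_uniq // permutations_uniq.
  - move=> js; rewrite memA mem_filter mem_permutations.
    case pj : (perm_eq js J); last by rewrite !andbF.
    by rewrite (perm_size pj) sJ eqxx andbT.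
apply/eqP; rewrite size_eq0; apply/eqP; case E : (map F _) => [//|js s].
have : js \in map F (enum A) by rewrite E mem_head.
by rewrite memA => /and3P[/eqP sj /perm_size pj _]; case: sJ; rewrite -pj.
Qed.

Lemma nth_Jw_monom (al : seq nat) i : monom_of (Jw al) i = nth 0 al i.
Proof. by rewrite monom_ofE count_Jw. Qed.

Lemma monom_exists (m : {cmonom nat}) : exists al, m = monom_of (Jw al).
Proof.
pose N := (\max_(i <- finsupp m) i).+1.
exists [seq m i | i <- iota 0 N]; apply/eqP/cmP => i; rewrite nth_Jw_monom.
have [iN|Ni] := ltnP i N; first by rewrite (nth_map 0) ?size_iota // nth_iota.
rewrite nth_default ?size_map ?size_iota //; apply/eqP; rewrite -[_ == _]negbK -mem_finsupp.
apply/negP => im; have : i <= \max_(i <- finsupp m) i by rewrite (big_rem i) //= leq_maxl.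
by move: Ni; rewrite /N; lia.
Qed.

Definition compat (n : nat) (D J : seq nat) : bool :=
  all (fun k => (nth 0 J k.-1 == nth 0 J k) ==> (k \notin D)) (iota 1 n.-1).

(** Only one rearrangement of [J] is sorted, so the coefficient is 0 or 1. *)
Lemma fundamentalE n D J : sorted leq J ->
  fundamental n D (monom_of J) = (((size J == n) && compat n D J) : nat)%:Z%R.
Proof.
move=> sJ; rewrite /fundamental genseriesE; congr (Posz _); case: eqP => //= _.
have -> : (compat n D J : nat) = compat n D J * count_mem J (permutations J).
  by rewrite count_uniq_mem ?permutations_uniq // mem_permutations perm_refl muln1.
have -> : compat n D J * count_mem J (permutations J) =
    count (fun js => (js == J) && compat n D J) (permutations J).
  case: (compat n D J); rewrite ?mul1n ?mul0n; first by apply: eq_count => js /=; rewrite andbT.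
  by rewrite count_nil // => js _; rewrite andbF.
apply: eq_in_count => js; rewrite mem_permutations => pj.
apply/andP/andP => [[sj cj]|[/eqP-> cJ]]; last by split.
have e : js = J by apply: (sorted_eq leq_trans anti_leq).
by rewrite -{2}e e eqxx; split=> //; rewrite -e.
Qed.

(** Standardization: [J] may repeat an index only where [y] does not rise, which is the [lexi]
    condition on neighbours. *)
Lemma compat_asc n (y J : seq nat) : size y = n -> size J = n -> sorted leq J ->
  compat n (asc y) J = sorted lexi (zip y J).
Proof.
move=> sy sJ oJ; have sz : size (zip y J) = n by rewrite size_zip sy sJ minnn.
have asc_mem k : 0 < k < n -> (k \notin asc y) = (nth 0 y k <= nth 0 y k.-1).
  move=> kn; rewrite mem_filter mem_iota sy; have -> : 0 < k < 1 + n.-1 by lia.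
  by rewrite andbT -leqNgt.
apply/allP/(sortedP (0, 0)) => [H i|H k].
  rewrite sz => i_n; have := H i.+1; rewrite mem_iota asc_mem; last by lia.
  rewrite !nth_zip ?sy ?sJ // /lexi /= => H'.
  have := sortedP 0 oJ i; rewrite sJ => /(_ i_n); rewrite leq_eqVlt => /predU1P[e|-> //].
  move: H'; rewrite e eqxx ltnn /=; apply; lia.
rewrite mem_iota => kn; have := H k.-1; rewrite sz !nth_zip ?sy ?sJ // /lexi /=.
have -> : k.-1.+1 = k by lia.
rewrite asc_mem; last by lia.
move=> H'; apply/implyP => /eqP e; move: H'; rewrite e ltnn eqxx /=; apply; lia.
Qed.

(** * Schur functions as sums over lattice words *)

Lemma count_le_inj (T S : eqType) (f : T -> S) (s : seq T) (t : seq S) (P : pred T) (Q : pred S) :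
  uniq s -> (forall x, x \in s -> P x -> (f x \in t) && Q (f x)) ->
  (forall x y, x \in s -> y \in s -> P x -> P y -> f x = f y -> x = y) ->
  count P s <= count Q t.
Proof.
move=> us H inj; rewrite -!size_filter -(size_map f).
apply: uniq_leq_size.
  rewrite map_inj_in_uniq ?filter_uniq // => x y; rewrite !mem_filter => /andP[Px xs] /andP[Py ys].
  exact: inj.
by move=> z /mapP[x]; rewrite mem_filter => /andP[Px xs] ->; have := H x xs Px; rewrite mem_filter andbC.
Qed.

(** The Kostka number of shape [la] and content [J]: semistandard tableaux are encoded by their
    words of rows. *)
Definition Kw (la J : seq nat) : nat :=
  count (fun y => lat y && sorted lexi (zip y J)) (permutations (Jw la)).

Section Kostka.

Variables (n : nat) (la J : seq nat).
Hypotheses (pla : is_part n la) (sJ : sorted leq J) (szJ : size J = n).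

Let la0 : 0 \notin la. Proof. by case/and3P: pla. Qed.
Let sla : sumn la = n. Proof. by case/and3P: pla => _ _ /eqP. Qed.

Lemma size_perm_Jw y : perm_eq y (Jw la) -> size y = n.
Proof. by move/perm_size; rewrite size_Jwo sla. Qed.

Let shape_la y : lat y -> perm_eq y (Jw la) -> shape (tabJ y J) = la.
Proof.
move=> ly py; have sy := size_perm_Jw py.
apply: (@eq_nth_default _ 0) => //.
  rewrite shape_tabJ ?szJ // -(shape_tabJ (J := iota 1 (size y))) ?size_iota //.
  by have /and3P[] := is_part_shape_tab ly.
by move=> r; rewrite nth_shape_tabJ ?szJ // (seq.permP py) count_Jw.
Qed.

(** Semistandard fillings and lattice words correspond through [wordJ] and [tabJ]; the injectivity
    of each direction gives one of the two inequalities. *)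
Lemma schurE : schur la (monom_of J) = ((Kw la J)%:Z)%R.
Proof.
rewrite /schur genseriesE sla szJ eqxx; congr (Posz _); apply/eqP; rewrite eqn_leq.
have shr js : js \in permutations J -> shape (reshape la js) = la /\ flatten (reshape la js) = js.
  rewrite mem_permutations => /perm_size sj; split; first by rewrite reshapeKl // sj szJ sla.
  by rewrite reshapeKr // sj szJ sla.
apply/andP; split.
  have EX js : js \in permutations J -> is_ssyt (reshape la js) ->
      tabJ (wordJ (reshape la js)).1 J = reshape la js /\ (wordJ (reshape la js)).2 = J.
    move=> jJ /andP[rX _]; have [e1 e2] := shr _ jJ; rewrite mem_permutations in jJ.
    have e3 : (wordJ (reshape la js)).2 = J by apply: wordJ2; rewrite ?e2.
    by split=> //; rewrite -[in LHS]e3 wordJK // e1.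
  apply: (count_le_inj (f := fun js => (wordJ (reshape la js)).1)); first exact: permutations_uniq.
    move=> js jJ sX; have [E1 E2] := EX _ jJ sX; have [e1 e2] := shr _ jJ.
    have := perm_wordJ1 (reshape la js); rewrite e1 => p1.
    have lx := lexi_wordJ (reshape la js); rewrite E2 in lx.
    rewrite mem_permutations p1 lx andbT /= -(@is_ssyt_tabJ _ J) ?E1 //.
    by rewrite size_wordJ E2.
  move=> js js' jJ jJ' sX sX' /= E.
  have [E1 _] := EX _ jJ sX; have [E1' _] := EX _ jJ' sX'.
  have [_ <-] := shr _ jJ; have [_ <-] := shr _ jJ'.
  by rewrite -E1 -E1'; congr (flatten (tabJ _ J)).
have RX y : perm_eq y (Jw la) -> lat y -> reshape la (flatten (tabJ y J)) = tabJ y J.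
  by move=> py ly; rewrite -{1}(shape_la ly py) flattenK.
apply: (count_le_inj (f := fun y => flatten (tabJ y J))); first exact: permutations_uniq.
  move=> y; rewrite mem_permutations => py /andP[ly sy]; have sz := size_perm_Jw py.
  by rewrite mem_permutations perm_flatten_tabJ ?szJ //= RX // is_ssyt_tabJ ?szJ.
move=> y y'; rewrite !mem_permutations => py py' /andP[ly sy] /andP[ly' sy'] E.
have : tabJ y J = tabJ y' J by rewrite -RX // E RX.
by move/(congr1 wordJ); rewrite !tabJK ?szJ ?(size_perm_Jw py) ?(size_perm_Jw py') // => -[].
Qed.

(** At the level of coefficients, this is the expansion of the Schur function into the F_ID(T) with
    T in SYT(la). *)
Lemma Kw_compat : Kw la J =
  count (fun y => lat y && compat n (asc y) J) (permutations (Jw la)).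
Proof.
apply: eq_in_count => y; rewrite mem_permutations => /size_perm_Jw sy.
by rewrite (compat_asc sy szJ sJ).
Qed.

(** An entry in row r of a semistandard tableau is at least r, both counted from 0. Where [J] rises,
    the lattice condition yields an earlier letter one below the current one, to which induction
    applies. This gives the triangularity of [Kw]. *)
Lemma lat_le_sorted y : lat y -> size y = n -> sorted lexi (zip y J) ->
  forall k, k < n -> nth 0 y k <= nth 0 J k.
Proof.
move=> ly sy sz k; elim/ltn_ind: k => k IH k_n.
case: k IH k_n => [|k] IH k_n.
  have := latP _ ly 1 (nth 0 y 0).-1; case: (y) sy => [|z y'] /=; first by lia.
  by case: z => //= z; rewrite take0 /= eqxx (gtn_eqF (ltnSn z)).
have := sortedP (0, 0) sz k; rewrite size_zip sy szJ minnn => /(_ k_n).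
rewrite !nth_zip ?sy ?szJ // /lexi /= => /orP[Jk|/andP[/eqP <- yk]]; last first.
  by apply: leq_trans yk (IH k _ (ltnW k_n)).
rewrite leqNgt; apply/negP => yk.
have := latP _ ly k.+2 (nth 0 y k.+1).-1; rewrite prednK; last by lia.
have v0 : 0 < nth 0 y k.+1 by apply: leq_ltn_trans yk.
have vv : (nth 0 y k.+1 == (nth 0 y k.+1).-1) = false by rewrite gtn_eqF // ltn_predL.
rewrite (take_nth 0) ?sy // -!cats1 !count_cat /= eqxx vv !addn0 addn1 => H.
have : 0 < count_mem (nth 0 y k.+1).-1 (take k.+1 y) by apply: leq_ltn_trans H.
rewrite -has_count => /hasP[z /(nthP 0)[i]]; rewrite (size_takel (_ : k.+1 <= size y)) ?sy ?(ltnW k_n) // => ik <- /= /eqP E.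
rewrite nth_take // in E; have := IH i ik (ltn_trans ik k_n).
have : nth 0 J i <= nth 0 J k.
  have := sorted_leq_nth leq_trans leqnn 0 sJ; apply; rewrite ?inE ?szJ //.
    exact: ltn_trans ik k_n.
  exact: ltnW.
lia.
Qed.

End Kostka.

(** * Symmetry of Schur functions *)

Fixpoint dec (N : nat) (g : nat -> nat) : seq nat :=
  if N is M.+1 then nseq (g M) M ++ dec M g else [::].

Lemma count_dec N g r : count_mem r (dec N g) = if r < N then g r else 0.
Proof.
elim: N => [|N IH] //=; rewrite count_cat count_nseq IH /= ltnS.
by case: (ltngtP N r) => [Nr|rN|<-]; rewrite ?mul0n ?mul1n ?addn0 ?ltnn.
Qed.

Lemma mem_dec N g z : z \in dec N g -> z < N.
Proof. by rewrite -has_pred1 has_count count_dec; case: (ltnP z N). Qed.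

Lemma sorted_dec N g : sorted geq (dec N g).
Proof.
elim: N => [|N IH] //=; rewrite (sorted_pairwise geq_transitive) pairwise_cat.
rewrite -!(sorted_pairwise geq_transitive) sorted_geq_nseq IH !andbT.
by apply/allrelP => u v /nseqP[-> _] /mem_dec/ltnW.
Qed.

Lemma size_sum_count N b : all (ltn^~ N) b -> size b = \sum_(r < N) count_mem (r : nat) b.
Proof.
elim: b => [|z b IH] /=; first by rewrite big1.
case/andP=> zN /IH->; rewrite big_split /= -add1n; congr (_ + _).
rewrite (bigD1 (Ordinal zN)) //= eqxx big1 // => i.
by rewrite -val_eqE /= eq_sym => /negbTE->.
Qed.

Lemma mem_zip_snd (y J : seq nat) p : p \in zip y J -> p.2 \in J.
Proof.
elim: y J => [|x y IH] [|j J] //=; rewrite !inE => /predU1P[->|/IH ->]; by rewrite ?eqxx ?orbT.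
Qed.

Lemma lexi_cat (y y' J J' : seq nat) : size y = size J ->
  (forall j j', j \in J -> j' \in J' -> j < j') ->
  sorted lexi (zip (y ++ y') (J ++ J')) = sorted lexi (zip y J) && sorted lexi (zip y' J').
Proof.
move=> e H; rewrite zip_cat // !(sorted_pairwise lexi_trans) pairwise_cat.
have -> // : allrel lexi (zip y J) (zip y' J').
by apply/allrelP => a b /mem_zip_snd ab /mem_zip_snd ab'; rewrite /lexi H.
Qed.

Lemma lexi_nseq (b : seq nat) i : sorted lexi (zip b (nseq (size b) i)) = sorted geq b.
Proof.
have -> : zip b (nseq (size b) i) = [seq (z, i) | z <- b] by elim: b => //= z b ->.
by rewrite sorted_map; apply: eq_sorted => u v; rewrite /lexi /= ltnn eqxx.
Qed.

Lemma lexi_Jw_blocks (y1 b1 b2 y2 s1 s2 : seq nat) : size y1 = sumn s1 -> 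
  sorted lexi (zip (y1 ++ b1 ++ b2 ++ y2) (Jw (s1 ++ [:: size b1, size b2 & s2]))) =
  [&& sorted lexi (zip y1 (Jw s1)), sorted geq b1, sorted geq b2 &
      sorted lexi (zip y2 (Jwo (size s1).+2 s2))].
Proof.
move=> e; rewrite Jwo_cat add0n /= lexi_cat ?size_Jwo //.
  congr (_ && _); rewrite lexi_cat ?size_nseq ?lexi_nseq //.
    congr (_ && _); rewrite lexi_cat ?size_nseq ?lexi_nseq //.
    by move=> j j' /nseqP[-> _] /(allP (Jwo_ge _ _)).
  move=> j j' /nseqP[-> _]; rewrite mem_cat => /orP[/nseqP[-> _]//|/(allP (Jwo_ge _ _))].
  exact: ltnW.
move=> j j' /mem_Jw js; rewrite !mem_cat => /or3P[/nseqP[-> _]//|/nseqP[-> _]|/(allP (Jwo_ge _ _))].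
  exact: ltnW.
by move=> H; apply: leq_trans js _; apply: ltnW; apply: ltnW.
Qed.

(* The words of two consecutive blocks correspond to the shapes [k] with [low r <= k r <= up r] between the shapes [c] before and [nu] after them; [k r] is replaced by [low r + up r - k r]. *)
Section BenderKnuth.

Variable N : nat.

Section Shapes.

Variables (c nu : nat -> nat).

Definition low r := maxn (c r) (nu r.+1).
Definition up r := if r is q.+1 then minn (nu r) (c q) else nu 0.

(** The lower bound in row r and the upper bound in row r+1 are the maximum and the minimum of the
    same two numbers c_r and nu_(r+1). This is why the reflection exchanges the lengths of the two
    blocks. *)
Lemma sum_low_up : nu N = 0 ->
  \sum_(r < N) (low r + up r) = \sum_(r < N) c r + \sum_(r < N) nu r.
Proof.
move=> nuN; suff H M : \sum_(r < M) low r + \sum_(r < M.+1) up r =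
    \sum_(r < M) c r + \sum_(r < M.+1) nu r.
  have := H N; rewrite !(big_ord_recr N) /= nuN addn0.
  have -> : up N = 0 by case: (N) nuN => [|M] /= -> //; rewrite min0n.
  by rewrite addn0 big_split.
elim: M => [|M IH]; first by rewrite !big_ord_recr !big_ord0.
rewrite (big_ord_recr M) (big_ord_recr M.+1) /= [in RHS](big_ord_recr M) [in RHS](big_ord_recr M.+1) /=.
have E : low M + minn (nu M.+1) (c M) = c M + nu M.+1 by rewrite /low; lia.
by rewrite addnACA IH E addnACA.
Qed.

End Shapes.

Definition bk1 (y1 b1 b2 : seq nat) : seq nat :=
  let c r := count_mem r y1 in let nu r := count_mem r (y1 ++ b1 ++ b2) in
  dec N (fun r => low c nu r + up c nu r - count_mem r (y1 ++ b1) - c r).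

Definition bk2 (y1 b1 b2 : seq nat) : seq nat :=
  let c r := count_mem r y1 in let nu r := count_mem r (y1 ++ b1 ++ b2) in
  dec N (fun r => nu r - (low c nu r + up c nu r - count_mem r (y1 ++ b1))).

Section Word.

Variables (y1 b1 b2 y2 : seq nat).
Hypotheses (ly : lat (y1 ++ b1 ++ b2 ++ y2)) (s1 : sorted geq b1) (s2 : sorted geq b2).
Hypothesis yN : all (ltn^~ N) (y1 ++ b1 ++ b2).

Let c r := count_mem r y1.
Let k r := count_mem r (y1 ++ b1).
Let nu r := count_mem r (y1 ++ b1 ++ b2).
Let k' r := low c nu r + up c nu r - k r.

Let kE r : k r = c r + count_mem r b1. Proof. by rewrite /k count_cat. Qed.
Let nuE r : nu r = k r + count_mem r b2. Proof. by rewrite /nu /k catA count_cat. Qed.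

Let lat12 : [/\ lat y1, lat (y1 ++ b1) & lat ((y1 ++ b1) ++ b2)].
Proof.
have l3 : lat ((y1 ++ b1) ++ b2) by move: ly; rewrite !catA => /lat_catl.
have l2 := lat_catl l3; split=> //; exact: lat_catl l2.
Qed.

Let interlace1 r : k r.+1 <= c r.
Proof.
have [l1 l2 _] := lat12; move: l2; rewrite /lat latw_cat => /andP[_].
move/latw_blockP => H; rewrite kE; apply: H => // q; exact: lat_count.
Qed.

Let interlace2 r : nu r.+1 <= k r.
Proof.
have [_ l2 l3] := lat12; move: l3; rewrite /lat latw_cat => /andP[_].
move/latw_blockP => H; rewrite nuE; apply: H => // q; exact: lat_count.
Qed.

Let low_k r : low c nu r <= k r.
Proof. by rewrite /low geq_max interlace2 kE leq_addr. Qed.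

Let k_up r : k r <= up c nu r.
Proof. by case: r => [|r] /=; rewrite ?leq_min ?interlace1 nuE leq_addr. Qed.

Let low_k' r : low c nu r <= k' r.
Proof. by rewrite /k'; have := k_up r; lia. Qed.

Let k'_up r : k' r <= up c nu r.
Proof. by rewrite /k'; have := low_k r; lia. Qed.

Let c_k' r : c r <= k' r.
Proof. by apply: leq_trans (low_k' r); rewrite leq_maxl. Qed.

Let k'_nu r : k' r <= nu r.
Proof. by apply: leq_trans (k'_up r) _; case: r => //= r; rewrite geq_minl. Qed.

Let nu0 r : N <= r -> nu r = 0.
Proof. by move=> Nr; apply/count_memPn/negP => /(allP yN) /=; rewrite ltnNge Nr. Qed.

Lemma count_bk1 r : count_mem r (bk1 y1 b1 b2) + c r = k' r.
Proof.
rewrite /bk1 count_dec -/(c r) -/(k r) -/(nu r); case: ltnP => [_|Nr].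
  by rewrite -/(k' r) subnK.
by apply/eqP; rewrite add0n eqn_leq c_k' (leq_trans (k'_nu r)) // nu0.
Qed.

Lemma low_up_sub r : count_mem r (bk1 y1 b1 b2) + c r + k r = low c nu r + up c nu r.
Proof. by rewrite count_bk1 /k' subnK //; apply: leq_trans (k_up r) _; rewrite leq_addl. Qed.

Lemma count_bk2 r : count_mem r (bk2 y1 b1 b2) + k' r = nu r.
Proof.
rewrite /bk2 count_dec; case: ltnP => [_|Nr].
  by rewrite -/(k' r) subnK.
by apply/eqP; rewrite add0n eqn_leq k'_nu nu0.
Qed.

Lemma perm_bk : perm_eq (y1 ++ bk1 y1 b1 b2 ++ bk2 y1 b1 b2) (y1 ++ b1 ++ b2).
Proof.
apply/allP => r _; rewrite /= -/(nu r) !count_cat -/(c r).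
by rewrite addnA [c r + _]addnC count_bk1 addnC count_bk2.
Qed.

Lemma size_bk1 : size (bk1 y1 b1 b2) = size b2.
Proof.
have sub (s : seq nat) : {subset s <= y1 ++ b1 ++ b2} -> size s = \sum_(r < N) count_mem (r : nat) s.
  by move=> H; apply: size_sum_count; apply/allP => z /H/(allP yN).
have e1 : size y1 = \sum_(r < N) c r by apply: sub => z; rewrite mem_cat => ->.
have ek : size (y1 ++ b1) = \sum_(r < N) k r.
  by apply: sub => z zy; rewrite catA mem_cat zy.
have en : size (y1 ++ b1 ++ b2) = \sum_(r < N) nu r by apply: sub.
have := sum_low_up c (nu0 (leqnn N)); rewrite -e1 -en.
have -> : \sum_(r < N) (low c nu r + up c nu r) = \sum_(r < N) (k' r + k r).
  apply: eq_bigr => r _; rewrite /k' subnK //.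
  by apply: leq_trans (k_up r) _; rewrite leq_addl.
have -> : \sum_(r < N) (k' r + k r) = \sum_(r < N) (count_mem (r : nat) (bk1 y1 b1 b2) + c r + k r).
  by apply: eq_bigr => r _; rewrite count_bk1.
rewrite !big_split /= -e1 -ek -size_sum_count; last by apply/allP => z /mem_dec.
by rewrite !size_cat; lia.
Qed.

Lemma size_bk2 : size (bk2 y1 b1 b2) = size b1.
Proof. by have := perm_size perm_bk; rewrite !size_cat size_bk1 addnC [RHS]addnC => /addIn; rewrite addnC => /addIn. Qed.

(** The bounds [low] and [up] express exactly the interlacing with [nu] and [c] that makes both new
    blocks horizontal strips. *)
Lemma lat_bk : lat (y1 ++ bk1 y1 b1 b2 ++ bk2 y1 b1 b2 ++ y2).
Proof.
have [l1 _ _] := lat12.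
have l2 : lat (y1 ++ bk1 y1 b1 b2).
  rewrite /lat latw_cat -/(lat y1) l1 /=; apply/latw_blockP.
  - by move=> q; apply: lat_count.
  - exact: sorted_dec.
  - move=> r; rewrite !add0n addnC -/(c r.+1) count_bk1; apply: leq_trans (k'_up _) _.
    by rewrite /= geq_minr.
have l3 : lat (y1 ++ bk1 y1 b1 b2 ++ bk2 y1 b1 b2).
  rewrite catA /lat latw_cat -/(lat _) l2 /=; apply/latw_blockP.
  - by move=> q; apply: lat_count.
  - exact: sorted_dec.
  - move=> r; rewrite !add0n !count_cat -/(c r.+1) -/(c r) addnC [c r.+1 + _]addnC count_bk1.
    rewrite addnC [c r + _]addnC count_bk1 addnC count_bk2.
    by apply: leq_trans (low_k' r); rewrite leq_maxr.
have := @perm_lat_cat (y1 ++ b1 ++ b2) _ y2 _ l3; rewrite -!catA; apply=> //.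
by rewrite perm_sym perm_bk.
Qed.

End Word.

(** The new blocks determine [nu], hence the bounds, and reflecting the new intermediate shape
    recovers the old one. *)
Lemma bk_inj y1 b1 b2 y2 b1' b2' y2' :
  lat (y1 ++ b1 ++ b2 ++ y2) -> sorted geq b1 -> sorted geq b2 -> all (ltn^~ N) (y1 ++ b1 ++ b2) ->
  lat (y1 ++ b1' ++ b2' ++ y2') -> sorted geq b1' -> sorted geq b2' -> all (ltn^~ N) (y1 ++ b1' ++ b2') ->
  bk1 y1 b1 b2 = bk1 y1 b1' b2' -> bk2 y1 b1 b2 = bk2 y1 b1' b2' -> b1 = b1' /\ b2 = b2'.
Proof.
move=> ly s1 s2 yN ly' s1' s2' yN' e1 e2.
have enu r : count_mem r (y1 ++ b1 ++ b2) = count_mem r (y1 ++ b1' ++ b2').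
  rewrite -(seq.permP (perm_bk ly s1 s2 yN)) -(seq.permP (perm_bk ly' s1' s2' yN')).
  by rewrite e1 e2.
have c1 r := count_bk1 ly s1 s2 yN r; have c1' r := count_bk1 ly' s1' s2' yN' r.
have elu r (c nu nu' : nat -> nat) : nu =1 nu' -> low c nu r + up c nu r = low c nu' r + up c nu' r.
  by move=> E; rewrite /low /up !E; case: r.
have ek r : count_mem r (y1 ++ b1) = count_mem r (y1 ++ b1').
  have := low_up_sub ly s1 s2 yN r; have := low_up_sub ly' s1' s2' yN' r.
  rewrite -(elu r _ _ _ enu) => h' h; apply/eqP; rewrite -(eqn_add2l (count_mem r (bk1 y1 b1 b2) + count_mem r y1)).
  by rewrite h e1 h'.
have eb1 : b1 = b1'.
  by apply: sorted_geq_eq => // r; have := ek r; rewrite !count_cat => /addnI.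
split=> //; apply: sorted_geq_eq => // r; have := enu r; rewrite eb1 !count_cat => /addnI/addnI //.
Qed.

(* The sizes of the four parts of the word are n1, a, b and the rest. *)
Definition bk (n1 a b : nat) (y : seq nat) : seq nat :=
  let y1 := take n1 y in let b1 := take a (drop n1 y) in
  let b2 := take b (drop a (drop n1 y)) in
  y1 ++ bk1 y1 b1 b2 ++ bk2 y1 b1 b2 ++ drop b (drop a (drop n1 y)).

End BenderKnuth.

Lemma Kw_swap_le n la s1 s2 a b : is_part n la -> sumn (s1 ++ [:: a, b & s2]) = n ->
  Kw la (Jw (s1 ++ [:: a, b & s2])) <= Kw la (Jw (s1 ++ [:: b, a & s2])).
Proof.
move=> pla sn; pose N := size la; pose n1 := sumn s1.
have split4 y : y \in permutations (Jw la) -> exists y1 b1 b2 y2,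
    [/\ y = y1 ++ b1 ++ b2 ++ y2, size y1 = n1, size b1 = a, size b2 = b & all (ltn^~ N) y].
  rewrite mem_permutations => py; have sy := size_perm_Jw pla py.
  exists (take n1 y), (take a (drop n1 y)), (take b (drop a (drop n1 y))), (drop b (drop a (drop n1 y))).
  rewrite sumn_cat /= -/n1 in sn.
  rewrite !cat_take_drop !size_takel ?size_drop ?sy; try lia.
  split=> //; apply/allP => z; rewrite (perm_mem py); exact: mem_Jw.
have bkE y1 b1 b2 y2 : size y1 = n1 -> size b1 = a -> size b2 = b ->
    bk N n1 a b (y1 ++ b1 ++ b2 ++ y2) = y1 ++ bk1 N y1 b1 b2 ++ bk2 N y1 b1 b2 ++ y2.
  by move=> e1 ea eb; rewrite /bk -e1 -ea -eb !(take_size_cat, drop_size_cat).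
have allN y1 b1 b2 y2 : all (ltn^~ N) (y1 ++ b1 ++ b2 ++ y2) -> all (ltn^~ N) (y1 ++ b1 ++ b2).
  by rewrite !catA all_cat => /andP[].
apply: (count_le_inj (f := bk N n1 a b)); first exact: permutations_uniq.
  move=> y yp; have [y1 [b1 [b2 [y2 [E e1 ea eb /[1!E]/allN yN]]]]] := split4 y yp.
  move: yp; rewrite E mem_permutations => yp; rewrite bkE // -{1}ea -{1}eb => /andP[ly].
  rewrite lexi_Jw_blocks // => /and4P[o1 o2 o3 o4].
  rewrite mem_permutations (lat_bk ly o2 o3 yN) /=; apply/andP; split.
    rewrite -(permPr yp) !catA perm_cat2r -!catA; exact: perm_bk ly o2 o3 yN.
  have := size_bk1 ly o2 o3 yN; have := size_bk2 ly o2 o3 yN; rewrite ea eb => q1 q2.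
  by rewrite -{1}q2 -{1}q1 lexi_Jw_blocks // o1 o4 !sorted_dec.
move=> y y' yp yp'; have [y1 [b1 [b2 [y2 [E e1 ea eb /[1!E]/allN yN]]]]] := split4 y yp.
have [y1' [b1' [b2' [y2' [E' e1' ea' eb' /[1!E']/allN yN']]]]] := split4 y' yp'.
rewrite !bkE //.
rewrite -{1}ea -{1}eb => /andP[ly]; rewrite lexi_Jw_blocks // => /and4P[_ o2 o3 _].
rewrite -{1}ea' -{1}eb' => /andP[ly']; rewrite lexi_Jw_blocks // => /and4P[_ o2' o3' _] /eqP.
rewrite eqseq_cat ?e1 ?e1' // => /andP[/eqP ey1]; subst y1'.
rewrite eqseq_cat ?(size_bk1 ly o2 o3 yN) ?(size_bk1 ly' o2' o3' yN') ?eb ?eb' // => /andP[/eqP f1].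
rewrite eqseq_cat ?(size_bk2 ly o2 o3 yN) ?(size_bk2 ly' o2' o3' yN') ?ea ?ea' // => /andP[/eqP f2 /eqP ->].
by have [-> ->] := bk_inj ly o2 o3 yN ly' o2' o3' yN' f1 f2.
Qed.

Lemma Kw_swap n la s1 s2 a b : is_part n la -> sumn (s1 ++ [:: a, b & s2]) = n ->
  Kw la (Jw (s1 ++ [:: a, b & s2])) = Kw la (Jw (s1 ++ [:: b, a & s2])).
Proof.
move=> pla sn; apply/eqP; rewrite eqn_leq (Kw_swap_le pla sn) (Kw_swap_le pla) //.
by move: sn; rewrite !sumn_cat /=; lia.
Qed.

(** * Rearrangements, triangular systems and cancelling sums *)

(** Induction arranges the tail, then adjacent swaps carry the first element to its place. The
    hypothesis only concerns rearrangements of [s], because [Kw_swap] fixes the sum. *)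
Lemma adjacent_swap_perm (T : eqType) (S : Type) (g : seq T -> S) (s t : seq T) :
  (forall s1 a b s2, perm_eq (s1 ++ [:: a, b & s2]) s ->
     g (s1 ++ [:: a, b & s2]) = g (s1 ++ [:: b, a & s2])) ->
  perm_eq s t -> g s = g t.
Proof.
elim: s t g => [|x s IH] t g H pst; first by case: t pst => // x t /perm_size.
have xt : x \in t by rewrite -(perm_mem pst) mem_head.
case/splitPr: xt pst => t1 t2 pst.
have pst' : perm_eq s (t1 ++ t2).
  by move: pst; rewrite -[x :: t2]cat1s perm_sym perm_catCA perm_cons perm_sym.
have e1 : g (x :: s) = g (x :: t1 ++ t2).
  apply: (IH _ (fun s => g (x :: s))) => // s1 a b s2 ps.
  by apply: (H (x :: s1)); rewrite /= perm_cons.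
rewrite e1; elim/last_ind: t1 t2 {pst' e1} pst => // t1 z IHt t2 pst.
rewrite !cat_rcons -(H t1 x z t2); last by rewrite perm_sym (permPl pst) cat_rcons perm_cat2l -[_ :: _ :: _]/([:: z] ++ [:: x] ++ t2) perm_catCA.
apply: IHt; rewrite (permPl pst) cat_rcons perm_cat2l -[_ :: _ :: _]/([:: z] ++ [:: x] ++ t2) perm_catCA //.
Qed.

Import Order.TTheory GRing.Theory Num.Theory.

(** Solved over the integers by increasing rank, the diagonal being 1. It yields both the Schur
    expansion and Moebius inversion over subsets. *)
Lemma triangular_solve (I : finType) (P : pred I) (K : I -> I -> int) (rk : I -> nat) :
  (forall i, P i -> K i i = 1%R) ->
  (forall i j, P i -> P j -> K i j != 0%R -> i = j \/ rk i < rk j) ->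
  forall f : I -> int, exists d : I -> int,
  forall j, P j -> (f j = \sum_(i | P i) d i * K i j)%R.
Proof.
move=> K1 K0 f.
suff [d [Hd _]] : exists d : I -> int, (forall j, P j -> rk j < (\max_(i : I) rk i).+1 ->
    (f j = \sum_(i | P i) d i * K i j)%R) /\
    (forall i, (\max_(i : I) rk i).+1 <= rk i -> d i = 0%R).
  by exists d => j Pj; apply: Hd => //; rewrite ltnS leq_bigmax.
elim: (_.+1) => [|N [d [Hd d0]]].
  by exists (fun=> 0%R); split=> // j _; rewrite ltn0.
(* Coefficients of rank N are set to the current residue; those of higher rank are still 0. *)
exists (fun i => if rk i == N then (f i - \sum_(j | P j) d j * K j i)%R else d i); split; last first.
  by move=> i Ni; rewrite ifF ?d0 //; [apply: ltnW | apply: gtn_eqF].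
move=> j Pj; rewrite ltnS leq_eqVlt => /orP[/eqP jN|jN].
  rewrite (bigD1 j) //= jN eqxx K1 // mulr1.
  rewrite [X in (_ - X + _)%R](bigD1 j) //= (d0 j) ?jN // mul0r add0r.
  rewrite [X in (_ - X + _)%R](eq_bigr (fun i => (if rk i == N then (f i - \sum_(j | P j) d j * K j i)%R else d i) * K i j)%R).
    by rewrite subrK.
  move=> i /andP[Pi ij]; case: eqP => // iN.
  case: (eqVneq (K i j) 0%R) => [->|Kij]; first by rewrite !mulr0.
  by case: (K0 _ _ Pi Pj Kij) => [e|]; [rewrite e eqxx in ij | rewrite iN jN ltnn].
rewrite (Hd _ Pj jN); apply: eq_bigr => i Pi; case: eqP => // iN.
case: (eqVneq (K i j) 0%R) => [->|Kij]; first by rewrite !mulr0.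
case: (K0 _ _ Pi Pj Kij) => [e|]; first by move: jN; rewrite -e iN ltnn.
by rewrite iN => /(ltn_trans jN); rewrite ltnn.
Qed.

(** The sum equals its own negative, hence is 0 over the integers; fixed points of [h] need no
    separate treatment. *)
Lemma cancel_sum (T : eqType) (s : seq T) (h : T -> T) (F : T -> int) : uniq s ->
  (forall x, x \in s -> [/\ h x \in s, h (h x) = x & F (h x) = - F x]%R) ->
  (\sum_(x <- s) F x = 0)%R.
Proof.
move=> us H; have ph : perm_eq (map h s) s.
  apply: uniq_perm => //.
    by rewrite map_inj_in_uniq // => x y /H[_ hx _] /H[_ hy _] e; rewrite -hx e hy.
  move=> x; apply/mapP/idP => [[y /H[hy _ _] -> //]|xs].
  by have [hx hh _] := H x xs; exists (h x).
have : (\sum_(x <- s) F x = - \sum_(x <- s) F x)%R.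
  rewrite -{1}(perm_big _ ph) big_map -sumrN big_seq [RHS]big_seq.
  by apply: eq_bigr => x /H[].
by move: (\sum_(x <- s) F x)%R => z; lia.
Qed.

Lemma sumn_le_nth (y J : seq nat) : size y = size J ->
  (forall k, k < size J -> nth 0 y k <= nth 0 J k) ->
  sumn y <= sumn J /\ (sumn y = sumn J -> y = J).
Proof.
elim: y J => [|x y IH] [|j J] //= [e] H.
have [|le eq] := IH J e; first by move=> k kJ; apply: (H k.+1).
have x0 := H 0 isT; rewrite /= in x0; split; first exact: leq_add.
move=> E; have -> : y = J by apply: eq; lia.
by congr (_ :: _); lia.
Qed.

(** The rank [sumn (Jw la)] is the sum of the i la_i. The inequality comes letter by letter from
    [lat_le_sorted], and equality of the sums forces y = Jw mu. *)
Lemma lat_perm_Jw n la mu y : is_part n la -> is_part n mu -> perm_eq y (Jw la) ->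
  lat y -> sorted lexi (zip y (Jw mu)) -> la = mu \/ sumn (Jw la) < sumn (Jw mu).
Proof.
move=> pl pm py ly sy.
have sm : size (Jw mu) = n by rewrite size_Jwo; case/and3P: pm => _ _ /eqP.
have sz := size_perm_Jw pl py.
have [||le eq] := @sumn_le_nth y (Jw mu); first by rewrite sm.
  by rewrite sm; apply: (lat_le_sorted pm (sorted_Jwo 0 mu) sm ly sz sy).
have E : sumn y = sumn (Jw la) by apply: perm_sumn.
rewrite -E; case: (ltngtP (sumn y) (sumn (Jw mu))) le => // [|e] _; first by right.
left; apply: (@eq_nth_default _ 0); [by case/and3P: pl|by case/and3P: pm|].
by move=> r; rewrite -!count_Jw -(seq.permP py) (eq e).
Qed.

Lemma sorted_lexi_diag J : sorted leq J -> sorted lexi (zip J J).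
Proof.
move=> sJ; have -> : zip J J = [seq (z, z) | z <- J] by elim: (J) => //= z s ->.
rewrite sorted_map; apply: sub_sorted sJ => a b /=; rewrite /lexi /= leq_eqVlt.
by case/predU1P => [->|->//]; rewrite eqxx leqnn orbT.
Qed.

Lemma Kw_diag n la : is_part n la -> Kw la (Jw la) = 1.
Proof.
move=> pl; have [sl _ _] := and3P pl.
have <- : count_mem (Jw la) (permutations (Jw la)) = 1.
  by rewrite count_uniq_mem ?permutations_uniq // mem_permutations perm_refl.
apply: eq_in_count => y; rewrite mem_permutations => py /=.
apply/andP/eqP => [[ly sy]|->]; last by rewrite latw_leq_Jwo // sorted_lexi_diag // sorted_Jwo.
have sm : size (Jw la) = n by rewrite size_Jwo; case/and3P: pl => _ _ /eqP.
have [||_ eq] := @sumn_le_nth y (Jw la); first by rewrite (perm_size py).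
  by rewrite sm; apply: (lat_le_sorted pl (sorted_Jwo 0 la) sm ly (size_perm_Jw pl py) sy).
by apply: eq; apply: perm_sumn.
Qed.

Lemma Kw_triangular n la mu : is_part n la -> is_part n mu -> Kw la (Jw mu) != 0 ->
  la = mu \/ sumn (Jw la) < sumn (Jw mu).
Proof.
move=> pl pm; rewrite -lt0n -has_count => /hasP[y]; rewrite mem_permutations => py /andP[ly sy].
exact: lat_perm_Jw pl pm py ly sy.
Qed.

(** A partition of n has at most n parts, each at most n, so bounded sequences give a finite index
    type for the sums over partitions. *)
Lemma part_bseq n la : is_part n la -> exists b : n.-bseq 'I_n.+1, map val b = la.
Proof.
move=> pl; have sl := part_size_le pl.
have [b Eb] : exists b : seq 'I_n.+1, map val b = la.
  have : all (leq^~ n) la.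
    apply/allP => x xl; case/and3P: pl => _ _ /eqP <-.
    by elim: (la) xl => //= z s IH; rewrite inE => /predU1P[->|/IH]; [apply: leq_addr | move=> H; apply: leq_trans H (leq_addl _ _)].
  elim: (la) => [|x s IH] /=; first by exists [::].
  case/andP=> xn /IH[b <-]; exists (Ordinal (xn : x < n.+1) :: b) => //.
have sb : size b <= n by rewrite -(size_map val) Eb.
by exists (Bseq sb).
Qed.

Lemma bseq_inj n (b b' : n.-bseq 'I_n.+1) : map val b = map val b' -> b = b'.
Proof. by move/(inj_map val_inj)/val_inj. Qed.

Definition norm_part (al : seq nat) : seq nat := [seq x <- sort geq al | x != 0].

Lemma norm_partP n al : sumn al = n ->
  is_part n (norm_part al) /\ perm_eq al (norm_part al ++ nseq (count_mem 0 al) 0).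
Proof.
move=> sa; have gt : total geq by move=> x y; apply: leq_total.
have p1 : perm_eq al (norm_part al ++ nseq (count_mem 0 al) 0).
  rewrite -(permPl (permEl (perm_sort geq al))) -(permPl (permEl (perm_filterC (fun x => x != 0) _))).
  rewrite perm_cat2l (_ : [seq x <- sort geq al | predC (fun x => x != 0) x] = nseq (count_mem 0 al) 0) //.
  rewrite -(seq.permP (permEl (perm_sort geq al))) -size_filter.
  rewrite (eq_filter (a2 := pred1 0)) => [|x /=]; last by rewrite negbK.
  by apply/all_pred1P; apply: filter_all.
split=> //; rewrite /is_part; apply/and3P; split.
- by apply: (sorted_filter geq_transitive); apply: sort_sorted.
- by rewrite mem_filter eqxx.
- by rewrite -sa (perm_sumn p1) sumn_cat sumn_nseq mul0n addn0.
Qed.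

(** * Linear independence of the fundamental functions *)

Section Independence.

Variable n : nat.

Definition dset (D : seq nat) : {set 'I_n} := [set k : 'I_n | val k \in D].

Definition dlist (E : {set 'I_n}) : seq nat :=
  [seq k <- iota 1 n.-1 | k \in map val (enum E)].

Lemma dsetK D : D = [seq k <- iota 1 n.-1 | k \in D] -> dlist (dset D) = D.
Proof.
move=> ED; rewrite /dlist [RHS]ED; apply: eq_in_filter => k; rewrite mem_iota => kn.
have k_n : k < n by lia.
apply/mapP/idP => [[i]|kD]; first by rewrite mem_enum inE => iD ->.
by exists (Ordinal k_n); rewrite ?mem_enum ?inE.
Qed.

(** A sorted index list that rises from position k to k+1, counted from 1, exactly if k is in E. F_D
    therefore has coefficient 1 there if D is contained in E, and 0 otherwise. An element 0 of E
    merely shifts all indices. *)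
Definition Jset (E : {set 'I_n}) : seq nat :=
  mkseq (fun k => count (leq^~ k) (map val (enum E))) n.

Lemma sorted_Jset E : sorted leq (Jset E).
Proof.
rewrite /Jset /mkseq sorted_map; apply: (sub_sorted (e := leq)); last exact: iota_sorted.
by move=> a b /= ab; apply: sub_count => z /= za; apply: leq_trans za ab.
Qed.

Lemma size_Jset E : size (Jset E) = n.
Proof. by rewrite size_mkseq. Qed.

Lemma compat_Jset D E : D = [seq k <- iota 1 n.-1 | k \in D] ->
  compat n D (Jset E) = (dset D \subset E).
Proof.
move=> ED; have step k : 0 < k < n ->
    (nth 0 (Jset E) k.-1 == nth 0 (Jset E) k) = (k \notin map val (enum E)).
  move=> kn; rewrite !nth_mkseq; try lia.
  have -> : count (leq^~ k) (map val (enum E)) =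
      count (leq^~ k.-1) (map val (enum E)) + count_mem k (map val (enum E)).
    by apply: count_or => z /=; lia.
  rewrite -{1}[count (leq^~ k.-1) _]addn0 eqn_add2l eq_sym.
  by rewrite -leqn0 leqNgt -has_count has_pred1.
apply/allP/subsetP => [H i|H k].
  rewrite inE => iD; have : val i \in iota 1 n.-1 by move: iD; rewrite ED mem_filter => /andP[].
  move=> iI; have := H _ iI; rewrite mem_iota in iI; rewrite step; last by lia.
  rewrite iD /= implybF negbK mem_map ?mem_enum //; exact: val_inj.
move=> kI; rewrite mem_iota in kI; rewrite step; last by lia.
have k_n : k < n by lia.
apply/implyP; apply: contra => kD; have /H kE : Ordinal k_n \in dset D by rewrite inE.
by apply/mapP; exists (Ordinal k_n); rewrite ?mem_enum.
Qed.

(** Any functional on the F_D is thereby a combination of the coefficients at the monomials of the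
    lists [Jset E], which is the form in which independence is used. *)
Lemma mobius (F : {set 'I_n} -> int) : exists G : {set 'I_n} -> int,
  forall D, (F D = \sum_E G E * (D \subset E)%:R)%R.
Proof.
have [|| G H] := @triangular_solve {set 'I_n} predT (fun E D => (D \subset E)%:R%R) (fun E => #|~: E|) _ _ F.
- by move=> E _ /=; rewrite subxx.
- move=> E D _ _ /=; case DE : (D \subset E); rewrite ?eqxx // => _.
  have [->|ne] := eqVneq E D; [by left | right].
  apply: proper_card; rewrite properE !setCS DE /=.
  by apply: contra ne => ED; rewrite eqEsubset ED DE.
by exists G => D; apply: H.
Qed.

End Independence.

Lemma asc_filter n y : size y = n -> asc y = [seq k <- iota 1 n.-1 | k \in asc y].
Proof.
move=> sy; rewrite [LHS]/asc sy; apply: eq_in_filter => k kn.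
by rewrite mem_filter sy kn andbT.
Qed.

Lemma sorted_lat_Jw y la : sorted leq y -> perm_eq y (Jw la) -> y = Jw la.
Proof. by move=> sy py; apply: sorted_leq_eq_Jw => // r; rewrite (seq.permP py) count_Jw. Qed.

Lemma shape_tab_Jw n la : is_part n la -> shape (tab (Jw la)) = la.
Proof.
move=> pl; have /and3P[sl l0 _] := pl; apply: (@eq_nth_default _ 0) => //.
  by have /and3P[] := is_part_shape_tab (latw_leq_Jwo sl).
by move=> r; rewrite nth_shape_tab count_Jw.
Qed.

(** * Evaluating the functional on Schur functions and on classes *)

Definition wordT (T : tableau) : seq nat := (wordJ T).1.

Lemma wordT_tab y : lat y -> wordT (tab y) = y.
Proof. by move=> ly; rewrite /wordT tabJK ?size_iota ?sorted_lexi_iota. Qed.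

Lemma sum_Phi_lat n la mu : is_part n la -> is_part n mu ->
  (\sum_(y <- permutations (Jw mu) | lat y) Phi n la (asc y) = (mu == la)%:R)%R.
Proof.
move=> pl pm; have /and3P[sm m0 _] := pm.
have szm : size (Jw mu) = n by rewrite size_Jwo; case/and3P: pm => _ _ /eqP.
have lm : lat (Jw mu) by exact: latw_leq_Jwo.
rewrite (bigID (sorted leq)) /= [X in (_ + X)%R](_ : _ = 0%R) ?addr0.
  have E : forall y, y \in permutations (Jw mu) -> (lat y && sorted leq y) = (y == Jw mu).
    move=> y; rewrite mem_permutations => py; apply/andP/eqP => [[_ sy]|->].
      exact: sorted_lat_Jw.
    by rewrite lm sorted_Jwo.
  rewrite big_seq_cond (eq_bigl (fun y => (y \in permutations (Jw mu)) && (y == Jw mu))); last first.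
    by move=> y; case yp : (y \in _) => //=; rewrite E.
  rewrite -big_seq_cond -big_filter filter_pred1_uniq ?permutations_uniq ?mem_permutations //.
  by rewrite big_seq1 -szm Phi_sorted ?sorted_Jwo ?szm // (shape_tab_Jw pm).
rewrite -big_filter; apply: (cancel_sum (h := fun y => wordT (slink_star (tab y)))).
  by rewrite filter_uniq // permutations_uniq.
move=> y; rewrite mem_filter mem_permutations => /andP[/andP[ly sy] py].
have szy : size y = n by rewrite (perm_size py).
have [y' [[E1 E2] p [ly' sy'] _ P]] := star_word la (isT : 0 \in [:: 0; 1; 2]) ly szy sy.
rewrite E1 wordT_tab // E2 wordT_tab //; split=> //.
by rewrite mem_filter ly' sy' mem_permutations (permPl p).
Qed.

Section Classes.

Variables (n k : nat) (C : {set 'S_n}).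
Hypotheses (k3 : k \in [:: 0; 1; 2]) (uC : union_of_classes (@perm_equiv n k) C).

Lemma classes_closed p q : p \in C -> tab_equiv n k (Ptab p) (Ptab q) -> Qtab p = Qtab q -> q \in C.
Proof.
case: uC => A HA /HA[r rA [e1 e2]] e3 e4; apply/HA; exists r => //; split; last by rewrite e2.
exact: rst_trans e1 e3.
Qed.

Lemma Ptab_word (p : 'S_n) : exists y, [/\ lat y, size y = n, Ptab p = tab y & wordT (Ptab p) = y].
Proof.
have [y [ly sy Ey]] := syt_tab (Ptab_syt p); exists y; split=> //.
by rewrite Ey wordT_tab.
Qed.

Lemma sum_Phi_classes la : is_part n la ->
  (\sum_(p in C) Phi n la (IDw (word p)) = #|[set p in C | p \in SYam n la]|%:Z)%R.
Proof.
move=> pl; have /and3P[sl l0 _] := pl.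
rewrite (bigID (fun p => sorted leq (wordT (Ptab p)))) /= [X in (_ + X)%R](_ : _ = 0%R) ?addr0.
  rewrite (eq_bigr (fun p => ((p \in SYam n la) : nat)%:Z)%R); last first.
    move=> p /andP[pC]; have [y [ly sy Ey ->]] := Ptab_word p; rewrite IDw_word Ey ID_tab => oy.
    rewrite -{1}sy Phi_sorted ?sy // inE Ey natz; congr (Posz (nat_of_bool _)).
    rewrite -tab_Jw //; apply/eqP/eqP => [<-|/tab_inj E].
      by congr tab; apply: sorted_lat_Jw => //; apply: perm_Jw_shape.
    by rewrite E // ?latw_leq_Jwo // (shape_tab_Jw pl).
  rewrite -(big_morph Posz PoszD (erefl (Posz 0))); congr Posz.
  rewrite -sum1_card [RHS](eq_bigl (fun p => ((p \in C) && sorted leq (wordT (Ptab p))) && (p \in SYam n la))).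
    by rewrite [RHS]big_mkcondr; apply: eq_bigr => p _; case: (_ \in _).
  move=> p; rewrite !inE; case: (p \in C) => //=; rewrite andbC.
  case: eqP => // E; rewrite E -tab_Jw // wordT_tab ?latw_leq_Jwo //.
  by rewrite sorted_Jwo.
(* slink_star lifted to permutations by keeping the recording tableau. The default of [odflt] never
   occurs for the p at hand: slink_star preserves the shape, so [PQ_exists] applies. *)
pose h (p : 'S_n) := odflt p [pick q | (Ptab q == slink_star (Ptab p)) && (Qtab q == Qtab p)].
have hP p : p \in C -> ~~ sorted leq (wordT (Ptab p)) ->
    [/\ h p \in C, ~~ sorted leq (wordT (Ptab (h p))), Ptab (h p) = slink_star (Ptab p) /\ Qtab (h p) = Qtab p,
        slink_star (slink_star (Ptab p)) = Ptab p &
        Phi n la (IDw (word (h p))) = (- Phi n la (IDw (word p)))%R].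
  move=> pC; have [y [ly sy Ey ->]] := Ptab_word p => oy.
  have [y' [[E1 E2] pm [ly' oy'] te P]] := star_word la k3 ly sy oy.
  have [Eh Qh] : Ptab (h p) = slink_star (Ptab p) /\ Qtab (h p) = Qtab p.
    rewrite /h; case: pickP => [q /andP[/eqP -> /eqP ->] //|no].
    have [||q [Eq Qq]] := @PQ_exists n p (tab y').
    - by rewrite -sy -(perm_size pm); apply: tab_syt.
    - rewrite Ey; apply: (@eq_nth_default _ 0); try by case/and3P: (is_part_shape_tab ly).
        by case/and3P: (is_part_shape_tab ly').
      by move=> r; rewrite !nth_shape_tab (seq.permP pm).
    by have := no q; rewrite Eq Qq Ey E1 !eqxx.
  split=> //.
  - by apply: classes_closed pC _ (esym Qh); rewrite Eh Ey.
  - by rewrite Eh Ey E1 wordT_tab.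
  - by rewrite Ey E1 E2.
  - by rewrite !IDw_word Eh Ey E1 !ID_tab P.
rewrite (eq_bigl (mem [set p in C | ~~ sorted leq (wordT (Ptab p))])) => [|p]; last by rewrite !inE.
rewrite -big_enum; apply: (cancel_sum (h := h)); first exact: enum_uniq.
move=> p; rewrite !mem_enum !inE => /andP[pC oy].
have [hC ohy [Eh Qh] ss Ph] := hP p pC oy; have [_ _ [Ehh Qhh] _ _] := hP _ hC ohy.
split=> //; first by rewrite hC.
by apply: PQ_inj; rewrite ?Ehh ?Qhh ?Eh ?Qh.
Qed.

End Classes.

(** * The Schur expansion *)

Lemma swap_values_bij i : bijective (swap_values i i.+1).
Proof.
exists (swap_values i i.+1) => x; rewrite /swap_values;
  case: (eqVneq x i) => [->|xi]; rewrite ?eqxx ?(gtn_eqF (ltnSn i)) //;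
  by case: (eqVneq x i.+1) => [->|xi']; rewrite ?eqxx // (negbTE xi) (negbTE xi').
Qed.

Lemma symmetric_swap f s1 a b s2 : is_symmetric_function f ->
  f (monom_of (Jw (s1 ++ [:: a, b & s2]))) = f (monom_of (Jw (s1 ++ [:: b, a & s2]))).
Proof.
case=> _ H; symmetry; apply: (H _ (swap_values_bij (size s1))) => i.
rewrite !nth_Jw_monom /swap_values.
have n1 t : nth 0 (s1 ++ t) (size s1) = nth 0 t 0 by rewrite nth_cat ltnn subnn.
have n2 t : nth 0 (s1 ++ t) (size s1).+1 = nth 0 t 1 by rewrite nth_cat ltnNge leqnSn /= subSnn.
case: (eqVneq i (size s1)) => [->|i1]; first by rewrite n1 n2.
case: (eqVneq i (size s1).+1) => [->|i2]; first by rewrite n1 n2.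
rewrite !nth_cat; case: ltnP => // si.
have [e1 e2] : i - size s1 <> 0 /\ i - size s1 <> 1 by lia.
by case: (i - size s1) e1 e2 => [|[|j]].
Qed.

Lemma Jw_zeros al z : Jw (al ++ nseq z 0) = Jw al.
Proof. by rewrite Jwo_cat Jwo_nil0 cats0. Qed.

(** The unitriangular system matches the coefficients at partitions. All other exponent lists
    follow, as both sides are invariant under permuting exponents and dropping zeros. *)
Lemma schur_span n (f : series) : is_symmetric_function f ->
  exists d : n.-bseq 'I_n.+1 -> int, forall al, sumn al = n ->
  (f (monom_of (Jw al)) =
     \sum_(la : n.-bseq 'I_n.+1 | is_part n (map val la)) d la * (Kw (map val la) (Jw al))%:Z)%R.
Proof.
move=> fs; pose P (la : n.-bseq 'I_n.+1) := is_part n (map val la).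
have [|| d Hd] := @triangular_solve _ P (fun la mu => (Kw (map val la) (Jw (map val mu)))%:Z%R)
   (fun la => sumn (Jw (map val la))) _ _ (fun la => f (monom_of (Jw (map val la)))).
- by move=> la pl /=; rewrite (Kw_diag pl).
- move=> la mu pl pm /= K0; have [] := Kw_triangular pl pm K0; last by right.
  by move/bseq_inj; left.
exists d => al sal; have [pp pal] := norm_partP sal.
have [mu Emu] := part_bseq pp.
have -> : f (monom_of (Jw al)) = f (monom_of (Jw (map val mu))).
  rewrite Emu -(Jw_zeros (norm_part al) (count_mem 0 al)).
  apply: (adjacent_swap_perm (g := fun s => f (monom_of (Jw s)))) pal.
  by move=> s1 a b s2 _; apply: symmetric_swap.
rewrite Hd /P ?Emu //; apply: eq_bigr => la pl; congr (_ * (Posz _))%R.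
rewrite -(Jw_zeros (norm_part al) (count_mem 0 al)); symmetry.
apply: (adjacent_swap_perm (g := fun s => Kw (map val la) (Jw s))) pal.
by move=> s1 a b s2 ps; apply: (Kw_swap pl); rewrite (perm_sumn ps).
Qed.

Lemma sorted_is_Jw J : sorted leq J -> exists al, J = Jw al.
Proof.
move=> sJ; exists [seq count_mem i J | i <- iota 0 (nr J)].
apply: sorted_leq_eq_Jw => // r; have [rJ|Jr] := ltnP r (nr J).
  by rewrite (nth_map 0) ?size_iota // nth_iota.
rewrite nth_default ?size_map ?size_iota //; apply/count_memPn.
by apply/negP => /nr_gt; rewrite ltnNge Jr.
Qed.

Theorem corollary2p18 (n k : nat) (C : {set 'S_n}) (f : series) :
  k \in [:: 0; 1; 2] ->
  union_of_classes (@perm_equiv n k) C ->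
  (forall m, f m = \sum_(p in C) fundamental n (IDw (word p)) m)%R ->
  is_symmetric_function f ->
  forall m, (f m =
    \sum_(la : n.-bseq 'I_n.+1 | is_part n (map val la))
       #|[set p in C | p \in SYam n (map val la)]|%:Z * schur (map val la) m)%R.
Proof.
move=> k3 uC Hf fs; have [d Hd] := schur_span n fs.
have dE (la : n.-bseq 'I_n.+1) : is_part n (map val la) ->
    d la = (#|[set p in C | p \in SYam n (map val la)]|%:Z)%R.
  move=> pl; rewrite -(sum_Phi_classes k3 uC pl).
  (* [G] turns the functional into a combination of coefficients, so that it can be applied to both
     expansions of f. *)
  have [G HG] := mobius (fun E => Phi n (map val la) (@dlist n E)).
  have PhiE D : D = [seq i <- iota 1 n.-1 | i \in D] ->
      (Phi n (map val la) D = \sum_E G E * (compat n D (@Jset n E))%:R)%R.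
    move=> ED; rewrite -{1}(dsetK ED) HG; apply: eq_bigr => E _.
    by rewrite compat_Jset.
  have IDE (p : 'S_n) : IDw (word p) = [seq i <- iota 1 n.-1 | i \in IDw (word p)].
    by have [y [ly sy Ey _]] := Ptab_word p; rewrite IDw_word Ey ID_tab; apply: asc_filter.
  rewrite (eq_bigr _ (fun p _ => PhiE _ (IDE p))) exchange_big /=.
  (* The coefficient of f at the monomial of E, once from its definition and once from its Schur
     expansion. *)
  have fE E : (\sum_(p in C) G E * (compat n (IDw (word p)) (Jset E))%:R =
      \sum_(mu : n.-bseq 'I_n.+1 | is_part n (map val mu)) d mu *
        \sum_(y <- permutations (Jw (map val mu)) | lat y) G E * (compat n (asc y) (Jset E))%:R)%R.
    have [al Eal] := sorted_is_Jw (sorted_Jset E).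
    have sal : sumn al = n by rewrite -(size_Jwo 0) -Eal size_Jset.
    have := Hd al sal; rewrite Hf -Eal => H.
    rewrite -mulr_sumr.
    have -> : (\sum_(p in C) (compat n (IDw (word p)) (Jset E))%:R =
        \sum_(p in C) fundamental n (IDw (word p)) (monom_of (Jset E)) :> int)%R.
      by apply: eq_bigr => p _; rewrite fundamentalE ?sorted_Jset // size_Jset eqxx natz.
    rewrite H mulr_sumr; apply: eq_bigr => mu pm; rewrite mulrCA; congr (_ * _)%R.
    rewrite -mulr_sumr; congr (_ * _)%R.
    rewrite (Kw_compat pm (sorted_Jset E) (size_Jset E)) -sum1_count -natz natr_sum.
    by rewrite big_mkcondr; apply: eq_bigr => y _; case: (compat _ _ _).
  (* Summing over E turns the coefficients of s_mu back into [Phi], and [sum_Phi_lat] leaves only mu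
     = la. *)
  have muE (mu : n.-bseq 'I_n.+1) : is_part n (map val mu) ->
      (\sum_E d mu * \sum_(y <- permutations (Jw (map val mu)) | lat y)
                       G E * (compat n (asc y) (Jset E))%:R =
       d mu * (map val mu == map val la)%:R)%R.
    move=> pm; rewrite -mulr_sumr exchange_big /=; congr (_ * _)%R.
    rewrite -(sum_Phi_lat pl pm) big_seq_cond [RHS]big_seq_cond.
    apply: eq_bigr => y /andP[]; rewrite mem_permutations => /(size_perm_Jw pm) sy _.
    by rewrite PhiE //; apply: asc_filter.
  rewrite (eq_bigr _ (fun E _ => fE E)) exchange_big /= (bigD1 la) //= muE // eqxx mulr1.
  rewrite big1 ?addr0 // => mu /andP[pm ne]; rewrite muE //.
  by case: eqP => [/bseq_inj e|_]; [rewrite e eqxx in ne | rewrite mulr0].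
move=> m; have [al ->] := monom_exists m.
(* Outside degree n both sides have coefficient 0. *)
have [sal|sal] := eqVneq (sumn al) n.
  rewrite (Hd al sal); apply: eq_bigr => la pl; rewrite dE //.
  by rewrite (schurE pl (sorted_Jwo 0 al)) // size_Jwo.
rewrite Hf big1 => [|p _]; last by rewrite fundamentalE ?sorted_Jwo // size_Jwo (negbTE sal).
rewrite big1 // => la /and3P[_ _ /eqP sla].
by rewrite /schur genseriesE size_Jwo sla (negbTE sal) mulr0.
Qed.
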